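(* Suppose that $B = \overline{B^o} \neq \varnothing$, that $B \subset A^o$, and that $\dim(\partial B) < d$, where $\dim$ denotes Hausdorff dimension. Let $k \in \mathbb{N}$. Then as $n \to \infty$, $$\mathbb{E}[N_{n,k}] \sim \tfrac12 (\ln n)^2; \qquad N_{n,k} \sim \tfrac12 (\ln n)^2 \quad \text{almost surely},$$ and $$\nu_{n,k}^{1/\sqrt{n}} \to \exp(\sqrt{2}) \quad \text{almost surely}.$$
   Context: Setting: $d \in \mathbb{N}$; $A \subset \mathbb{R}^d$ is compact with non-empty interior and $\overline{A^o} = A$ (here $D^o$, $\overline{D}$ denote interior and closure, and $\partial D = \overline{D}\setminus D^o$); $B \subset A$ is compact. $X_1, X_2, \ldots$ are independent identically distributed random vectors in $\mathbb{R}^d$ with probability density function $f$ with support $A$, and $f$ is continuous on $A$. It is assumed that $f_0 := \inf_{x \in B} f(x) > 0$. Notation: $B(x,r) = \{y \in \mathbb{R}^d : \|y-x\| \le r\}$ (Euclidean norm). $\mathcal{X}_n = \{X_1,\ldots,X_n\}$, and $\mathcal{X}_n(D)$ is the number of points of $\mathcal{X}_n$ in $D \subset \mathbb{R}^d$. For $n,k\in\mathbb{N}$ the $k$-coverage threshold is $$R_{n,k} := \inf\{ r > 0 : \mathcal{X}_n(B(x,r)) \ge k \ \ \forall x \in B\}, \qquad \inf \varnothing := +\infty.$$ It is non-increasing in $n$. The number of records up to time $n > k$ is $$N_{n,k} := 1 + \sum_{i=k+1}^n \mathbf{1}_{\{R_{i,k} < R_{i-1,k}\}}.$$ The record times are $\nu_{1,k}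 := k$ and, for each successive $m \ge 1$, $\nu_{m+1,k} := \inf\{n > \nu_{m,k} : R_{n,k} < R_{n-1,k}\}$. $g(n) \sim h(n)$ means $g(n)/h(n) \to 1$ as $n \to \infty$. *)

(* Defs.v *)
From HB Require Import structures.
From mathcomp Require Import all_boot all_order all_algebra.
From mathcomp Require Import all_classical all_reals all_analysis.

Set Implicit Arguments.
Unset Strict Implicit.
Unset Printing Implicit Defensive.

Import Order.TTheory GRing.Theory Num.Theory.
Import numFieldNormedType.Exports.

Local Open Scope classical_set_scope.
Local Open Scope ring_scope.

(* R^d is 'rV[R]_d.  Its library topology comes from the sup norm, hence is the
   Euclidean topology; its sigma-algebra is the Borel one. *)
HB.instance Definition _ (R : realType) (d : nat) :=
  Measurable.copy 'rV[R]_d (g_sigma_algebraType (@open 'rV[R]_d)).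

Lemma open_measurable_rV (R : realType) (d : nat) (U : set 'rV[R]_d) :
  open U -> measurable U.
Proof. exact: sub_sigma_algebra. Qed.

Lemma measurable_coord (R : realType) (d : nat) (j : 'I_d) :
  measurable_fun [set: 'rV[R]_d] (fun x : 'rV[R]_d => x ord0 j).
Proof.
apply: (measurability _ (measurable_realfun.RGenOpens.measurableE R)) => _ [_ [a [b ->]] <-].
rewrite setTI; apply: open_measurable_rV.
by apply: open_comp; [move=> x _; exact: coord_continuous | exact: interval_open].
Qed.

Lemma measurable_fun_rV (dT : measure_display) (T : measurableType dT)
    (R : realType) (d : nat) (g : T -> 'rV[R]_d) :
  (forall j, measurable_fun [set: T] (fun w => g w ord0 j)) ->
  measurable_fun [set: T] g.
Proof.
move=> mg; apply: (@measurability _ _ _ _ setT g (@open 'rV[R]_d) erefl).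
move=> _ [U oU <-]; rewrite setTI.
pose I := ('rV[rat]_d * nat)%type.
pose box (p : I) := [set y : 'rV[R]_d |
  forall j, `|ratr (p.1 ord0 j) - y ord0 j| < p.2.+1%:R^-1].
pose F (p : I) := if `[< box p `<=` U >] then g @^-1` box p else set0.
have -> : g @^-1` U = \bigcup_p F p.
  apply/seteqP; split => [w Uw|w [p _]]; last first.
    by rewrite /F; case: asboolP => // pU /pU.
  have [e /= e0 eU] : nbhs_ball (g w) U.
    by apply/nbhs_ballP; exact: open_nbhs_nbhs.
  have [n ne] : exists n : nat, n.+1%:R^-1 < e / 2.
    have := @near_infty_natSinv_lt R (PosNum (divr_gt0 e0 (ltr0n R 2))).
    by move=> [n _ /(_ n (leqnn n))] /= h; exists n.
  have n0 : 0 < n.+1%:R^-1 :> R by rewrite invr_gt0.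
  have /choice[q hq] : forall j, exists q : rat,
      `|ratr q - g w ord0 j| < n.+1%:R^-1 :> R.
    move=> j; have [|q] := @rat_in_itvoo R (g w ord0 j - n.+1%:R^-1)
      (g w ord0 j + n.+1%:R^-1); first by rewrite ltrD2l gtrN.
    by rewrite in_itv/= => qj; exists q; rewrite ltr_distl.
  have bw : box (\row_j q j, n) (g w) by move=> j; rewrite /= mxE.
  exists (\row_j q j, n) => //; rewrite /F asboolT// => y yb.
  apply: eU; split => // i j; rewrite !ord1.
  rewrite /ball /= (le_lt_trans (ler_distD (ratr (q j)) _ _))//.
  rewrite [ltRHS]splitr ltrD//.
    by rewrite distrC (lt_trans (hq j)).
  by have := yb j; rewrite /= mxE => /lt_trans -> //.
apply: countable_bigcupT_measurable => [|p]; first exact: countableP.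
rewrite /F; case: asboolP => // _.
have -> : g @^-1` box p =
    \bigcap_(j in [set: 'I_d])
      ((fun w => g w ord0 j) @^-1` ball (ratr (p.1 ord0 j) : R) p.2.+1%:R^-1).
  by apply/seteqP; split => [w h j _|w h j]; have := h j; [exact|exact].
apply: fin_bigcap_measurable => // j _.
rewrite -[X in measurable X]setTI; apply: mg => //.
by apply: measurable_realfun.open_measurable; exact: ball_open.
Qed.

(* d-dimensional Lebesgue measure: the d-fold product of lebesgue_measure,
   carried to 'rV[R]_d along (a, x) |-> (a, x_1, ..., x_d). *)
Definition cons_rV (R : realType) (d : nat) (p : measurableTypeR R * 'rV[R]_d) : 'rV[R]_d.+1 :=
  row_mx p.1%:M p.2.

Lemma cons_rV0 (R : realType) (d : nat) (p : measurableTypeR R * 'rV[R]_d) :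
  cons_rV p ord0 ord0 = p.1.
Proof.
have -> : ord0 = lshift d ord0 :> 'I_(1 + d) by exact: val_inj.
by apply: etrans (row_mxEl p.1%:M p.2 ord0 ord0) _; rewrite mxE mulr1n.
Qed.

Lemma cons_rVS (R : realType) (d : nat) (p : measurableTypeR R * 'rV[R]_d) (j : 'I_d) :
  cons_rV p ord0 (lift ord0 j) = p.2 ord0 j.
Proof.
have -> : lift ord0 j = rshift 1 j :> 'I_(1 + d) by exact: val_inj.
exact: row_mxEr.
Qed.

Definition uncons_rV (R : realType) (d : nat) (x : 'rV[R]_d.+1) :
    measurableTypeR R * 'rV[R]_d :=
  (x ord0 ord0, \row_j x ord0 (lift ord0 j)).

Lemma cons_rVK (R : realType) (d : nat) :
  cancel (@cons_rV R d) (@uncons_rV R d).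
Proof.
move=> [a x]; rewrite /uncons_rV cons_rV0; congr (_, _).
by apply/rowP => j; rewrite mxE cons_rVS.
Qed.

Lemma measurable_cons_rV (R : realType) (d : nat) :
  measurable_fun [set: measurableTypeR R * 'rV[R]_d] (@cons_rV R d).
Proof.
apply: measurable_fun_rV => j; have [i ->|->] := unliftP ord0 j.
- under eq_fun do rewrite cons_rVS.
  exact: (measurableT_comp (measurable_coord i) measurable_snd).
- by under eq_fun do rewrite cons_rV0; exact: measurable_fst.
Qed.

Lemma measurable_uncons_rV (R : realType) (d : nat) :
  measurable_fun [set: 'rV[R]_d.+1] (@uncons_rV R d).
Proof.
apply: measurable_fun_pair; first exact: measurable_coord.
apply: measurable_fun_rV => j; under eq_fun do rewrite mxE.
exact: measurable_coord.
Qed.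

HB.instance Definition _ (R : realType) (d : nat) :=
  isMeasurableFun.Build _ _ _ _ (@cons_rV R d) (@measurable_cons_rV R d).

Section cons_measure.
Context (R : realType) (d : nat).
Variable m : {sigma_finite_measure set 'rV[R]_d -> \bar R}.

Definition cons_measure : set 'rV[R]_d.+1 -> \bar R :=
  pushforward (@lebesgue_measure R \x m)%E (@cons_rV R d).

Let cons_measure0 : cons_measure set0 = 0%E. Proof. exact: measure0. Qed.

Let cons_measure_ge0 A : (0 <= cons_measure A)%E. Proof. exact: measure_ge0. Qed.

Let cons_measure_sigma_additive : semi_sigma_additive cons_measure.
Proof. exact: measure_semi_sigma_additive. Qed.

HB.instance Definition _ := isMeasure.Build _ _ _ cons_measure
  cons_measure0 cons_measure_ge0 cons_measure_sigma_additive.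

Let cons_measure_sigma_finite : sigma_finite setT cons_measure.
Proof.
have /sigma_finiteP[F [TF ndF Foo]] := @sigma_finiteT _ _ _ (@lebesgue_measure R).
have /sigma_finiteP[G [TG ndG Goo]] := sigma_finiteT m.
exists (fun n => @uncons_rV R d @^-1` (F n `*` G n)).
  rewrite -preimage_bigcup -(preimage_setT (@uncons_rV R d)) -setXTT TF TG.
  congr (_ @^-1` _); apply/seteqP; split => [[u x] [[i _ /= Fu] [j _ /= Gx]]|].
    exists (maxn i j) => //; split => /=.
      by move: u Fu; exact/subsetPset/ndF/leq_maxl.
    by move: x Gx; exact/subsetPset/ndG/leq_maxr.
  by move=> [u x] [n _ [/= Fu Gx]]; split; exists n.
move=> n; have [mF Fn] := Foo n; have [mG Gn] := Goo n; split.
  rewrite -[X in measurable X]setTI; apply: measurable_uncons_rV => //.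
  exact: measurableX.
rewrite /cons_measure /pushforward.
have -> : @cons_rV R d @^-1` (@uncons_rV R d @^-1` (F n `*` G n)) = F n `*` G n.
  by apply/seteqP; split => p; rewrite /preimage /mkset cons_rVK.
by rewrite product_measure1E// lte_mul_pinfty// ge0_fin_numE.
Qed.

HB.instance Definition _ := Measure_isSigmaFinite.Build _ _ _ cons_measure
  cons_measure_sigma_finite.

End cons_measure.

Fixpoint lebesgue_rV (R : realType) (d : nat) :
    {sigma_finite_measure set 'rV[R]_d -> \bar R} :=
  match d with
  | 0 => \d_(0 : 'rV[R]_0)
  | d'.+1 => cons_measure (lebesgue_rV R d')
  end.

Lemma lebesgue_rV_box (R : realType) (d : nat) (a b : 'I_d -> R) :
  (forall j, a j <= b j) ->
  lebesgue_rV R d [set x : 'rV[R]_d | forall j, a j <= x ord0 j <= b j] =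
  (\prod_(j < d) (b j - a j))%:E.
Proof.
elim: d a b => [|d IH] a b ab.
  by rewrite big_ord0 /= diracE mem_set// => -[].
rewrite big_ord_recl EFinM -IH// -[(b ord0 - a ord0)%:E]/((b ord0)%:E - (a ord0)%:E)%E.
have -> : ((b ord0)%:E - (a ord0)%:E)%E = lebesgue_measure `[a ord0, b ord0]%classic.
  rewrite lebesgue_measure_itv/= lte_fin.
  have := ab ord0; rewrite le_eqVlt => /predU1P[->|->//].
  by rewrite ltxx subee.
rewrite /= /cons_measure /pushforward -product_measure1E//; last first.
  rewrite [X in measurable X](_ : _ = \bigcap_(j in [set: 'I_d])
    ((fun x : 'rV[R]_d => x ord0 j) @^-1`
       `[a (lift ord0 j), b (lift ord0 j)]%classic)).
    apply: fin_bigcap_measurable => // j _.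
    by rewrite -[X in measurable X]setTI; exact: measurable_coord.
  by apply/seteqP; split => x /= h j => [_|]; have := h j; rewrite /= in_itv//= => /(_ I).
congr (_ _); apply/seteqP; split => [[u x] /= h|[u x] /= [h1 h2] j].
- split=> [|j]; first by have := h ord0; rewrite cons_rV0 in_itv.
  by have := h (lift ord0 j); rewrite cons_rVS.
- have [i ->|->] := unliftP ord0 j; first by rewrite cons_rVS; exact: h2.
  by rewrite cons_rV0; move: h1; rewrite in_itv.
Qed.

Definition enorm (R : realType) (d : nat) (x : 'rV[R]_d) : R :=
  Num.sqrt (\sum_(j < d) x ord0 j ^+ 2).

Definition eball (R : realType) (d : nat) (x : 'rV[R]_d) (r : R) :
    set 'rV[R]_d :=
  [set y | enorm (y - x) <= r].

Definition frontier (T : topologicalType) (D : set T) : set T :=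
  closure D `\` interior D.

Section hausdorff_dimension.
Context (R : realType) (d : nat).
Implicit Types (S U : set 'rV[R]_d) (s delta : R).
Local Open Scope ereal_scope.

Definition ediam U : \bar R :=
  ereal_sup [set (enorm (x - y))%:E | x in U & y in U].

(* The empty set is split off so that it has weight 0 even for s = 0. *)
Definition hausdorff_weight s U : \bar R :=
  if U == set0 then 0 else ediam U `^ s.

Definition hausdorff_premeasure s delta S : \bar R :=
  ereal_inf [set \sum_(i <oo) hausdorff_weight s (F i) |
    F in [set F : nat -> set 'rV[R]_d |
      S `<=` \bigcup_i F i /\ forall i, ediam (F i) <= delta%:E]].

Definition hausdorff_measure s S : \bar R :=
  ereal_sup [set hausdorff_premeasure s delta S |
    delta in [set delta : R | (0 < delta)%R]].

Definition hausdorff_dim S : \bar R :=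
  ereal_inf [set s%:E | s in [set s : R |
    (0 <= s)%R /\ hausdorff_measure s S = 0]].

End hausdorff_dimension.

Section random_vectors.
Context (dT : measure_display) (T : measurableType dT) (R : realType) (d : nat).
Variables (P : probability T R) (X : nat -> T -> 'rV[R]_d).

Definition independent_seq : Prop :=
  forall (J : seq nat) (D : nat -> set 'rV[R]_d),
    uniq J -> (forall j, measurable (D j)) ->
    P (\bigcap_(j in [set` J]) X j @^-1` D j) =
    (\prod_(j <- J) P (X j @^-1` D j))%E.

Definition has_density (Y : T -> 'rV[R]_d) (f : 'rV[R]_d -> R) : Prop :=
  [/\ measurable_fun [set: 'rV[R]_d] f,
      (forall x, 0 <= f x) &
      forall D : set 'rV[R]_d, measurable D ->
        P (Y @^-1` D) = (\int[lebesgue_rV R d]_(x in D) (f x)%:E)%E].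

End random_vectors.

Section coverage.
Context (T : Type) (R : realType) (d : nat).
Variables (X : nat -> T -> 'rV[R]_d) (B : set 'rV[R]_d) (k : nat).

(* X is indexed from 0: the first n points are X 0, ..., X n.-1.  They are
   counted as elements of a set, hence undup. *)
Definition npoints (n : nat) (w : T) (D : set 'rV[R]_d) : nat :=
  count (fun x => x \in D) (undup [seq X i w | i <- iota 0 n]).

Definition threshold (n : nat) (w : T) : \bar R :=
  ereal_inf [set r%:E | r in [set r : R |
    0 < r /\ forall x, B x -> (k <= npoints n w (eball x r))%N]].

Definition is_record (n : nat) (w : T) : bool :=
  (threshold n w < threshold n.-1 w)%E.

Definition nrecords (n : nat) (w : T) : nat :=
  1 + \sum_(k.+1 <= i < n.+1) is_record i w.

(* The record times are indexed from 1; the value at index 0 is irrelevant.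
   The value +oo means that there are fewer than m records. *)
Fixpoint record_time (m : nat) (w : T) : \bar R :=
  match m with
  | 0 | 1 => k%:R%:E
  | m'.+1 => ereal_inf [set n%:R%:E | n in [set n : nat |
      (record_time m' w < n%:R%:E)%E /\ is_record n w]]
  end.

End coverage.

Definition asymp (R : realType) (g h : nat -> R) : Prop :=
  g n / h n @[n --> \oo] --> (1 : R).

(* Main.v *)
(* Call a hole of a configuration at scale [r] a point of [B] with fewer than
   [k] sample points at distance less than [r], and let [R_n] be the threshold.
   Adding [k] copies of a point [y] lowers [R_n] exactly when [y] is closer than
   [R_n] to every hole at scale [R_n].  Perturbing the sample along countably
   many directions shows that almost surely there is a single such hole; hence, given
   the first [n] points, this "hit" has probability the mass [h_n] of one ball of
   radius [R_n].  A union bound over a grid, and a second moment bound over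
   disjoint balls placed where the density is close to its infimum, show that
   [h_n = (1 + o(1)) ln n / n], up to an error of mean [O(1/n)].

   A record is a hit.  A point that hits without a record still hits once it has
   been added to the sample, and at most [k] points of a sample hit it; so by
   exchangeability this has probability at most [k / (n + 1)].  The number of
   records minus the sum of the conditional record probabilities is a martingale
   with second moment [O(ln^2 n)].  Altogether,
   for every [e > 0],
     [|N_n - ln^2 n / 2| <= e * ln^2 n + Y_n] with [E Y_n = O(ln n)].
   This gives the mean; Markov's inequality and the Borel-Cantelli lemma along
   [n = 2^(j^2)], with monotonicity in between, give the almost sure statement;
   and inverting [N_n = m] at the [m]-th record time gives the last one. *)

Require Import Defs.
From HB Require Import structures.
From mathcomp Require Import all_boot all_order all_algebra.
From mathcomp Require Import all_classical all_reals all_analysis.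
From mathcomp Require Import measurable_realfun perm ring lra zify.

Set Implicit Arguments.
Unset Strict Implicit.
Unset Printing Implicit Defensive.

Import Order.TTheory GRing.Theory Num.Theory.
Import numFieldNormedType.Exports.

Local Open Scope classical_set_scope.
Local Open Scope ring_scope.

(** * Coverage thresholds *)

(** The hit probability is the mass of the intersection of the balls around all holes. One hole
    bounds it from above; a bound from below needs the intersection to be a single ball, which is
    why uniqueness of the hole is proved at all. The sample is only known to have a bounded density,
    and the threshold is not differentiated. Instead, two holes yield a line of configurations along
    which the threshold rises with positive slope on both sides of the sample; such configurations
    are null because a small set of them has many disjoint translates along the line.

    The mass [ln n / n] is the same for all densities: a ball of mass [m] stays empty with
    probability about [exp (- n m)], and there are about [n / ln n] disjoint places for it. An error
    of mean [O(1/n)] is what the sum over the times can afford: it contributes [O(ln n)], and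
    Markov's inequality at level [ln^2 n] then gives probability [O(1 / ln n)], which is
    [O(1 / j^2)] at [n = 2^(j^2)]. *)

Section euclid.
Context (R : realType) (d : nat).
Implicit Types (x y z : 'rV[R]_d) (r : R).

Definition dot x y : R := \sum_(j < d) x ord0 j * y ord0 j.

Lemma dotC x y : dot x y = dot y x.
Proof. by apply: eq_bigr => j _; rewrite mulrC. Qed.

Lemma dotDl x y z : dot (x + y) z = dot x z + dot y z.
Proof. by rewrite /dot -big_split; apply: eq_bigr => j _; rewrite mxE mulrDl. Qed.

Lemma dotNl x y : dot (- x) y = - dot x y.
Proof. by rewrite /dot -sumrN; apply: eq_bigr => j _; rewrite mxE mulNr. Qed.

Lemma dotZl r x y : dot (r *: x) y = r * dot x y.
Proof. by rewrite /dot mulr_sumr; apply: eq_bigr => j _; rewrite mxE mulrA. Qed.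

Lemma dotDr x y z : dot x (y + z) = dot x y + dot x z.
Proof. by rewrite !(dotC x) dotDl. Qed.

Lemma dotNr x y : dot x (- y) = - dot x y.
Proof. by rewrite !(dotC x) dotNl. Qed.

Lemma dotZr r x y : dot x (r *: y) = r * dot x y.
Proof. by rewrite !(dotC x) dotZl. Qed.

Lemma dot_ge0 x : 0 <= dot x x.
Proof. by apply: sumr_ge0 => j _; rewrite -expr2 sqr_ge0. Qed.

Lemma enormE x : enorm x = Num.sqrt (dot x x).
Proof. by congr Num.sqrt; apply: eq_bigr => j _; rewrite expr2. Qed.

Lemma enorm_ge0 x : 0 <= enorm x.
Proof. exact: sqrtr_ge0. Qed.

Lemma sqr_enorm x : enorm x ^+ 2 = dot x x.
Proof. by rewrite enormE sqr_sqrtr ?dot_ge0. Qed.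

Lemma enormN x : enorm (- x) = enorm x.
Proof. by rewrite !enormE dotNl dotNr opprK. Qed.

Lemma enormB x y : enorm (x - y) = enorm (y - x).
Proof. by rewrite -enormN opprB. Qed.

Lemma enormZ r x : enorm (r *: x) = `|r| * enorm x.
Proof.
by rewrite !enormE dotZl dotZr mulrA -expr2 sqrtrM ?sqr_ge0// sqrtr_sqr.
Qed.

Lemma enorm0 : enorm (0 : 'rV[R]_d) = 0.
Proof. by rewrite -(scale0r 0) enormZ normr0 mul0r. Qed.

Lemma coord_le_enorm x j : `|x ord0 j| <= enorm x.
Proof.
rewrite -ler_sqr ?nnegrE ?enorm_ge0// sqr_enorm real_normK ?num_real//.
rewrite /dot (bigD1 j)//= -expr2 lerDl sumr_ge0// => i _.
by rewrite -expr2 sqr_ge0.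
Qed.

Lemma enorm_eq0 x : (enorm x == 0) = (x == 0).
Proof.
apply/eqP/eqP => [x0|->]; last exact: enorm0.
apply/rowP => j; rewrite mxE; apply/eqP; rewrite -normr_eq0 eq_le normr_ge0 andbT.
by rewrite -x0 coord_le_enorm.
Qed.

Lemma dot_gt0 x : x != 0 -> 0 < dot x x.
Proof. by move=> x0; rewrite -sqr_enorm exprn_gt0// lt_def enorm_eq0 x0 enorm_ge0. Qed.

Lemma cauchy_schwarz x y : dot x y <= enorm x * enorm y.
Proof.
have [/eqP|x0] := eqVneq (enorm x) 0.
  by rewrite enorm_eq0 => /eqP ->; rewrite enorm0 mul0r -(scale0r 0) dotZl mul0r.
have [/eqP|y0] := eqVneq (enorm y) 0.
  by rewrite enorm_eq0 => /eqP ->; rewrite enorm0 mulr0 -(scale0r 0) dotZr mul0r.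
have xp : 0 < enorm x by rewrite lt_def x0 enorm_ge0.
have yp : 0 < enorm y by rewrite lt_def y0 enorm_ge0.
have := dot_ge0 (enorm y *: x - enorm x *: y).
rewrite !(dotDl, dotDr, dotNl, dotNr, dotZl, dotZr) (dotC y x) -!sqr_enorm.
move: (enorm x) (enorm y) xp yp => a b a0 b0 h.
have {}h : 0 <= (2 * (a * b)) * (a * b - dot x y) by apply: le_trans h _; lra.
by rewrite -subr_ge0 -(pmulr_rge0 _ (_ : 0 < 2 * (a * b)))// !mulr_gt0.
Qed.

Lemma enormD x y : enorm (x + y) <= enorm x + enorm y.
Proof.
rewrite -ler_sqr ?nnegrE ?addr_ge0 ?enorm_ge0// sqrrD !sqr_enorm.
rewrite dotDl !dotDr (dotC y x); have := cauchy_schwarz x y; lra.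
Qed.

Lemma enorm_triangle x y z : enorm (x - z) <= enorm (x - y) + enorm (y - z).
Proof. by apply: le_trans (enormD _ _); rewrite addrA subrK. Qed.

Lemma enorm_le_coord x r : (forall j, `|x ord0 j| <= r) -> enorm x <= d%:R * r.
Proof.
move=> xr; apply: (@le_trans _ _ (\sum_(j < d) `|x ord0 j|)).
  rewrite -ler_sqr ?nnegrE ?enorm_ge0 ?sumr_ge0// sqr_enorm expr2 mulr_suml.
  apply: ler_sum => j _; rewrite (le_trans (ler_norm _))// normrM ler_wpM2l//.
  by rewrite (bigD1 j)//= lerDl sumr_ge0.
by rewrite (le_trans (ler_sum _ (fun j _ => xr j)))// sumr_const card_ord mulr_natl.
Qed.

Definition oball x r : set 'rV[R]_d := [set y | enorm (y - x) < r].

Lemma oball_nbhs x r : 0 < r -> nbhs x (oball x r).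
Proof.
(* With sup-norm radius [r / d.+1], the crude bound by [d] times the largest coordinate stays
   strict, also for [d = 0]. *)
move=> r0; apply/nbhs_ballP; exists (r / d.+1%:R) => /=; first by rewrite divr_gt0.
move=> y xy; rewrite /oball /=.
apply: (@le_lt_trans _ _ (d%:R * (r / d.+1%:R))); last first.
  rewrite mulrCA gtr_pMr// ltr_pdivrMr// mul1r ltr_nat //.
apply: enorm_le_coord => j; rewrite !mxE distrC ltW//.
by case: xy => _; exact.
Qed.

Lemma nbhs_oball x (U : set 'rV[R]_d) :
  nbhs x U -> exists2 e : R, 0 < e & oball x e `<=` U.
Proof.
move=> /nbhs_ballP[e /= e0 eU]; exists e => // y xy; apply: eU; split => // i j.
rewrite !ord1 -ball_normE /=.
apply: le_lt_trans xy; have := coord_le_enorm (y - x) j.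
by rewrite !mxE distrC.
Qed.

Lemma enorm_continuous x : continuous (fun y => enorm (y - x)).
Proof.
move=> y; apply/(@cvgrPdist_lt _ _ _ (nbhs y) (nbhs_filter y)) => e e0.
apply: filterS (oball_nbhs y e0) => z; rewrite /oball/= => zy.
rewrite ltr_norml; have := enorm_triangle z y x; have := enorm_triangle y z x.
by move: zy; rewrite (enormB y z); lra.
Qed.

Lemma open_oball x r : open (oball x r).
Proof.
have -> : oball x r = (fun y => enorm (y - x)) @^-1` [set t | t < r] by [].
apply: open_comp; last exact: open_lt.
by move=> y _; exact: enorm_continuous.
Qed.

End euclid.

Lemma filter_all_seq (I : eqType) (U : Type) (F : set_system U) (s : seq I)
    (Q : I -> U -> Prop) : Filter F ->
  (forall p, F (Q p)) -> F [set y | forall p, p \in s -> Q p y].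
Proof.
move=> FF FQ; elim: s => [|p s IH]; first exact: filterE.
apply: filterS2 (FQ p) IH => y Qp Qs q.
by rewrite inE => /predU1P[->//|/Qs].
Qed.

(** * Thresholds of finite configurations *)

Section config.
Context (R : realType) (d : nat).
Implicit Types (x y z : 'rV[R]_d) (r : R) (s t : seq 'rV[R]_d).

Definition cnt s (D : set 'rV[R]_d) : nat := count (fun x => x \in D) s.

Lemma cnt_cat s t D : cnt (s ++ t) D = (cnt s D + cnt t D)%N.
Proof. exact: count_cat. Qed.

Lemma sub_cnt s (D E : set 'rV[R]_d) : D `<=` E -> (cnt s D <= cnt s E)%N.
Proof. by move=> DE; apply: sub_count => x /set_mem/DE/mem_set. Qed.

Lemma sub_in_cnt s (D E : set 'rV[R]_d) :
  (forall x, x \in s -> D x -> E x) -> (cnt s D <= cnt s E)%N.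
Proof.
elim: s => //= x s IH DE; apply: leq_add; last first.
  by apply: IH => y ys; apply: DE; rewrite inE ys orbT.
have := DE x; rewrite inE eqxx /= => /(_ erefl) DEx.
by case: (boolP (x \in D)) => // /set_mem/DEx/mem_set ->.
Qed.

Context (B : set 'rV[R]_d) (k : nat).

Definition covers s r := forall x, B x -> (k <= cnt s (eball x r))%N.

(* Points count with multiplicity: this is [threshold] for distinct points. *)
Definition thr s : \bar R := ereal_inf [set r%:E | r in [set r | 0 < r /\ covers s r]].

Lemma thr_le s r : 0 < r -> covers s r -> (thr s <= r%:E)%E.
Proof. by move=> r0 rc; apply: ereal_inf_lbound; exists r. Qed.

(** Every closed ball of radius less than [r] around [x] lies in the open one. Hence holes are
    counted with open balls although [covers] uses closed ones. *)
Lemma thr_ge s x r : B x -> (cnt s (oball x r) < k)%N -> (r%:E <= thr s)%E.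
Proof.
move=> Bx xk; apply: le_ereal_inf_tmp => _ [q [q0 qc] <-]; rewrite lee_fin leNgt.
apply/negP => qr; have := leq_trans xk (qc x Bx); rewrite ltnNge => /negP; apply.
by apply: sub_cnt => y; rewrite /eball /oball/= => /le_lt_trans; exact.
Qed.

Lemma thr_lt s (r : \bar R) : (thr s < r)%E ->
  exists q, [/\ 0 < q, covers s q & (q%:E < r)%E].
Proof. by move=> /ereal_inf_lt [_ [q [q0 qc] <-] qr]; exists q. Qed.

Lemma perm_thr s t : perm_eq s t -> thr s = thr t.
Proof.
move=> /seq.permP st; rewrite /thr /covers; congr (ereal_inf (_ @` _)).
apply/seteqP; split=> r /= [r0 h]; split=> // x Bx; first by rewrite /cnt -st h.
by rewrite /cnt st h.
Qed.

Lemma thr_cat s t : (thr (s ++ t) <= thr s)%E.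
Proof.
apply: le_ereal_inf_tmp => _ [q [q0 qc] <-]; apply: thr_le => // x Bx.
by rewrite cnt_cat (leq_trans (qc x Bx))// leq_addr.
Qed.

Hypothesis B_compact : compact B.

Lemma thr_fin s : (forall s', exists2 x, B x & x \notin s') -> (0 < k <= size s)%N ->
  exists2 r, 0 < r & thr s = r%:E.
Proof.
move=> Binf /andP[k0 ks].
have lt_oo : (thr s < +oo)%E.
  have [M MB] : exists M : R, forall x p, B x -> p \in s -> enorm (p - x) <= M.
    (* [compact_near_coveringP] turns a bound near each point of [B] into one for all of [B];
       [thr_witness] and [density_unif_cont] use it in the same way. *)
    have : \forall M \near +oo, forall x, B x -> (forall p, p \in s -> enorm (p - x) <= M).
      move/compact_near_coveringP : B_compact; apply => x Bx.
      have h p : \forall x' \near x & M \near +oo, enorm (p - x') <= M.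
        exists (oball x 1, [set M | enorm (p - x) + 1 <= M]).
          split; first exact: oball_nbhs.
          by apply: nbhs_pinfty_ge; rewrite num_real.
        move=> [y M] /= [yx pM]; apply: le_trans pM.
        by rewrite (le_trans (enorm_triangle p x y))// lerD2l enormB ltW.
      exact: (@filter_all_seq _ _ _ s (fun p yM => enorm (p - yM.1) <= yM.2)).
    by move=> [M [_ hM]]; exists (M + 1) => x p Bx ps; apply: (hM (M + 1)) => //; rewrite ltrDl.
  apply: (@le_lt_trans _ _ (Num.max M 1)%:E); last by rewrite ltry.
  apply: thr_le => [|x Bx]; first by rewrite lt_max ltr01 orbT.
  have -> : cnt s (eball x (Num.max M 1)) = size s; last by [].
  apply/eqP; rewrite -all_count; apply/allP => p ps; apply: mem_set.
  by rewrite /eball/= le_max MB.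
have [x Bx xs] := Binf s.
have [e e0 he] : exists2 e : R, 0 < e & forall p, p \in s -> e <= enorm (p - x).
  elim: s xs {ks lt_oo} => [_|p s IH]; first by exists 1.
  rewrite inE negb_or => /andP[xp /IH[e e0 he]].
  exists (Num.min e (enorm (p - x))).
    by rewrite lt_min e0 lt_def enorm_eq0 subr_eq0 eq_sym xp enorm_ge0.
  move=> q; rewrite inE => /predU1P[->|/he]; first by rewrite ge_min lexx orbT.
  by rewrite ge_min => ->.
have es : (e%:E <= thr s)%E.
  apply: (thr_ge Bx); suff -> : cnt s (oball x e) = 0%N by [].
  apply/eqP; rewrite -leqn0 leqNgt -has_count; apply/negP => /hasP[p ps /set_mem].
  by rewrite /oball/= ltNge he.
move: lt_oo es; case: (thr s) => [r|//|//] _; rewrite lee_fin => er.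
by exists r => //; exact: lt_le_trans er.
Unshelve. all: by end_near. Qed.

(** The infimum leaves a hole at its own scale. Otherwise [k] points lie strictly within [r] of each
    [x] in [B]; finitely many strict inequalities leave a margin, uniform on [B] by compactness, and
    some [r - e] would already cover. *)
Lemma thr_witness s r : 0 < r -> thr s = r%:E ->
  exists2 x, B x & (cnt s (oball x r) < k)%N.
Proof.
move=> r0 sr; apply: contrapT => noW.
have Wn x : B x -> (k <= cnt s (oball x r))%N.
  by move=> Bx; rewrite leqNgt; apply/negP => xk; apply: noW; exists x.
have : \forall e \near (0:R)^'+, forall x, B x -> (k <= cnt s (eball x (r - e)))%N.
  move/compact_near_coveringP : B_compact; apply => x Bx.
  have h p : \forall y \near x & e \near (0:R)^'+,
      enorm (p - x) < r -> enorm (p - y) <= r - e.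
    have [pr|_] := boolP (enorm (p - x) < r); last exact: filterE.
    pose g := (r - enorm (p - x)) / 2.
    have g0 : 0 < g by rewrite divr_gt0// subr_gt0.
    exists (oball x g, [set e | e <= g]).
      by split; [exact: oball_nbhs|exact: nbhs_right_le].
    move=> [y e] /= [yx eg] _.
    have := enorm_triangle p x y; rewrite (enormB x y).
    move: yx eg; rewrite /oball/= /g; lra.
  have {}h : \forall y \near x & e \near (0:R)^'+,
      forall p, p \in s -> enorm (p - x) < r -> enorm (p - y) <= r - e.
    exact: (@filter_all_seq _ _ _ s (fun p ye =>
      enorm (p - x) < r -> enorm (p - ye.1) <= r - ye.2)).
  apply: filterS h => -[y e] /= h; apply: (leq_trans (Wn x Bx)).
  exact: sub_in_cnt.
move=> H; have [e [e0 er He]] : exists e : R, [/\ 0 < e, e < r & 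
    forall x, B x -> (k <= cnt s (eball x (r - e)))%N].
  near (0:R)^'+ => e; exists e; split; near: e => //.
    exact: nbhs_right_gt.
  exact: nbhs_right_lt.
have := @thr_le s (r - e); rewrite subr_gt0 er => /(_ erefl) h.
have : (thr s <= (r - e)%:E)%E by apply: h.
by rewrite sr lee_fin lerBrDr gerDl leNgt e0.
Unshelve. all: by end_near. Qed.

Lemma thr_lipschitz s t r : 0 < r -> size s = size t ->
  (forall i, (i < size s)%N -> enorm (nth 0 s i - nth 0 t i) <= r) ->
  (thr t <= thr s + r%:E)%E.
Proof.
move=> r0 st h; rewrite -leeBlDr//; apply: le_ereal_inf_tmp => _ [q [q0 qc] <-].
rewrite leeBlDr// -EFinD; apply: thr_le => [|x Bx]; first exact: addr_gt0.
apply: leq_trans (qc x Bx) _.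
elim: s t st h {qc} => [|p s IH] [|p' t]//= [st] h.
apply: leq_add; last by apply: IH => // i si; exact: (h i.+1).
have := h 0%N isT; case: (boolP (p \in _)) => // /set_mem pq /= pp'.
rewrite mem_set// /eball/=.
have := enorm_triangle p' p x; move: pq pp'; rewrite /eball/= (enormB p' p); lra.
Qed.

End config.

(** * Hits and their relation to holes *)

Section hits.
Context (R : realType) (d : nat) (B : set 'rV[R]_d) (k : nat).
Hypotheses (B_compact : compact B) (k_gt0 : (0 < k)%N).
Implicit Types (x y : 'rV[R]_d) (s : seq 'rV[R]_d) (r : R).

Local Notation thr := (thr B k).

Definition lowers s y : bool := (thr (rcons s y) < thr s)%E.

(* [k] copies of [y] instead of one, so that only the position of [y] relative
   to the holes matters and not the number of points they lack. *)
Definition hits s y : bool := (thr (s ++ nseq k y) < thr s)%E.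

Lemma lowers_hits s y : lowers s y -> hits s y.
Proof.
apply: le_lt_trans; rewrite -(prednK k_gt0) -[nseq _ y]/(y :: nseq k.-1 y).
by rewrite -cat_rcons thr_cat.
Qed.

(** Without a record the threshold after [y] is still that of [s], and [k] further copies bring it
    at least as low as they did before. *)
Lemma hits_rcons s y : hits s y -> ~~ lowers s y -> hits (rcons s y) y.
Proof.
rewrite /hits /lowers -leNgt => h /(lt_le_trans _); apply.
apply: le_lt_trans h; rewrite (@perm_thr _ _ _ _ _ ((s ++ nseq k y) ++ [:: y])).
  exact: thr_cat.
by rewrite -cats1 -!catA perm_cat2l perm_catC.
Qed.

Lemma cnt_nseq y D : cnt (nseq k y) D = ((y \in D) * k)%N.
Proof. by rewrite /cnt count_nseq. Qed.

(** A hole whose open ball avoids [y] is untouched by the copies and keeps the threshold at [r]. *)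
Lemma hits_sub s x y r : B x -> (cnt s (oball x r) < k)%N -> thr s = r%:E ->
  hits s y -> oball x r y.
Proof.
move=> Bx xk sr; rewrite /hits sr => h; apply: contrapT => nxy.
move: h; apply/negP; rewrite -leNgt (thr_ge Bx)// cnt_cat cnt_nseq memNset//.
by rewrite mul0n addn0.
Qed.

(** [k] copies fill every hole whose ball contains [y]; a threshold still equal to [r] would leave a
    hole, by [thr_witness]. *)
Lemma sub_hits s y r : 0 < r -> thr s = r%:E ->
  (forall x, B x -> (cnt s (oball x r) < k)%N -> oball x r y) -> hits s y.
Proof.
move=> r0 sr h; rewrite /hits lt_neqAle thr_cat andbT; apply/negP => /eqP.
rewrite sr => /(thr_witness B_compact r0)[x Bx].
rewrite cnt_cat cnt_nseq => xk; have xy := h x Bx (leq_ltn_trans (leq_addr _ _) xk).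
by move: xk; rewrite mem_set// mul1n ltnNge leq_addl.
Qed.

(** All points that hit lie in the ball of one hole, which contains fewer than [k] points. *)
Lemma count_hits s r : 0 < r -> thr s = r%:E -> (count (hits s) s < k)%N.
Proof.
move=> r0 sr; have [x Bx xk] := thr_witness B_compact r0 sr.
apply: leq_ltn_trans (xk); rewrite (_ : count _ s = cnt s [set y | hits s y]).
  by apply: sub_in_cnt => y _; exact: (hits_sub Bx xk sr).
by apply: eq_count => y; apply/idP/idP => [/mem_set|/set_mem].
Qed.

End hits.

(** * Independent samples *)

Section tuple_law.
Context (dV : measure_display) (V : measurableType dV) (R : realType).

Definition rect n (D : 'I_n -> set V) : set (n.-tuple V) :=
  [set t | forall i, D i (tnth t i)].

Lemma measurable_rect n (D : 'I_n -> set V) :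
  (forall i, measurable (D i)) -> measurable (rect D).
Proof.
move=> mD; have -> : rect D =
    \bigcap_(i in [set: 'I_n]) ((fun t : n.-tuple V => tnth t i) @^-1` D i).
  by apply/seteqP; split => t h i; [move=> _; exact: h|exact: h].
apply: fin_bigcap_measurable => // i _.
by rewrite -[X in measurable X]setTI; exact: measurable_tnth.
Qed.

(** Rectangles are a pi-system, and they generate the product sigma-algebra because cylinders over
    one coordinate are rectangles. *)
Lemma tuple_measure_unique n (m1 m2 : {measure set (n.-tuple V) -> \bar R}) :
  (m1 setT < +oo)%E ->
  (forall D : 'I_n -> set V, (forall i, measurable (D i)) ->
    m1 (rect D) = m2 (rect D)) ->
  forall E, measurable E -> m1 E = m2 E.
Proof.
move=> m1oo m12 E mE.
pose G : set (set (n.-tuple V)) := [set E | exists2 D : 'I_n -> set V,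
  (forall i, measurable (D i)) & E = rect D].
apply: (@measure_unique _ R _ G (fun=> setT)) => //.
- rewrite eqEsubset; split; last first.
    apply: smallest_sub; first exact: sigma_algebra_measurable.
    by move=> _ [D mD ->]; exact: measurable_rect.
  apply: smallest_sub; first exact: smallest_sigma_algebra.
  move=> F; rewrite -bigcup_seq/= => -[i _ [D mD <-]]; apply: sub_sigma_algebra.
  exists (fun j => if j == i then D else setT).
    by move=> j; case: ifP => // _; exact: measurableT.
  rewrite setTI; apply/seteqP; split => [t /= Dt j|t /(_ i)]; last by rewrite eqxx.
  by case: ifP => // /eqP ->.
- move=> _ _ [D mD ->] [D' mD' ->]; exists (fun i => D i `&` D' i).
    by move=> i; exact: measurableI.
  by apply/seteqP; split=> [t [h1 h2] i|t h]; split => // i; have [] := h i.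
- move=> _; exists (fun=> setT) => //; apply/esym; rewrite -subTset => t _ i //.
- by rewrite bigcup_const.
- by move=> A [D mD ->]; exact: m12.
Qed.

End tuple_law.

Section independent_pair.
Context (dT dW dV : measure_display) (T : measurableType dT) (R : realType)
  (W : measurableType dW) (V : measurableType dV) (P : probability T R)
  (Y : {mfun T >-> W}) (Z : {mfun T >-> V}).
Variable m : probability V R.
Hypothesis indep : forall E D, measurable E -> measurable D ->
  P (Y @^-1` E `&` Z @^-1` D) = (P (Y @^-1` E) * m D)%E.

Lemma indep_integral (F : W * V -> \bar R) :
  measurable_fun setT F -> (forall z, 0 <= F z)%E ->
  (\int[P]_w F (Y w, Z w) = \int[P]_w \int[m]_y F (Y w, y))%E.
Proof.
move=> mF F0.
have mf : measurable_fun setT (fun w => (Y w, Z w)).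
  by apply: measurable_fun_pair; exact: measurable_funP.
pose h : {mfun T >-> _} := HB.pack (fun w => (Y w, Z w))
  (isMeasurableFun.Build _ _ _ _ _ mf).
have -> : (\int[P]_w F (Y w, Z w) = \int[distribution P h]_z F z)%E.
  by rewrite ge0_integral_distribution.
have -> : (\int[distribution P h]_z F z = \int[distribution P Y \x m]_z F z)%E.
  apply: eq_measure_integral => G mG _; apply/esym.
  apply: (@product_measure_unique _ _ _ _ _ _ _ (distribution P h)) => //.
rewrite fubini_tonelli1// ge0_integral_distribution//.
  exact: measurable_fun_fubini_tonelli_F.
by move=> x; apply: integral_ge0.
Qed.

End independent_pair.

Section sample.
Context (dT : measure_display) (T : measurableType dT) (R : realType)
  (dV : measure_display) (V : measurableType dV) (P : probability T R).
Variable X : nat -> {mfun T >-> V}.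

Definition law : probability V R := distribution P (X 0%N).

Hypothesis X_iid : forall (J : seq nat) (D : nat -> set V),
  uniq J -> (forall j, measurable (D j)) ->
  P (\bigcap_(j in [set` J]) X j @^-1` D j) = (\prod_(j <- J) law (D j))%E.

Definition sampl n (s : 'I_n -> nat) (w : T) : n.-tuple V := [tuple X (s i) w | i < n].

Lemma measurable_sampl n (s : 'I_n -> nat) : measurable_fun setT (sampl s).
Proof.
apply/measurable_fun_tnthP => i /=.
rewrite (_ : _ \o _ = X (s i)); first exact: measurable_funP.
by apply/funext => w /=; rewrite tnth_mktuple.
Qed.

Lemma sampl_rect n (s : 'I_n -> nat) (D : 'I_n -> set V) :
  injective s -> (forall i, measurable (D i)) ->
  P (sampl s @^-1` rect D) = (\prod_(i < n) law (D i))%E.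
Proof.
move=> s_inj mD.
pose D' j := if [pick i | s i == j] is Some i then D i else setT.
have D's i : D' (s i) = D i.
  by rewrite /D'; case: pickP => [j /eqP/s_inj ->//|/(_ i)]; rewrite eqxx.
have mD' j : measurable (D' j).
  by rewrite /D'; case: pickP => // _; exact: measurableT.
have := X_iid (J := map s (enum 'I_n)) _ mD'; rewrite map_inj_uniq// enum_uniq.
move=> /(_ isT); rewrite big_map big_enum/= => h.
transitivity (P (\bigcap_(j in [set` [seq s i | i <- enum 'I_n]]) X j @^-1` D' j)).
  congr (P _); apply/seteqP; split=> w.
    move=> h1 _ /= /mapP[i _ ->] /=; rewrite D's.
    by have := h1 i; rewrite tnth_mktuple.
  move=> h1 i; rewrite tnth_mktuple -D's; apply: (h1 (s i)) => /=.
  by rewrite map_f// mem_enum.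
by rewrite h; apply: eq_bigr => i _; rewrite D's.
Qed.

(** Exchangeability: the law of a finite sample does not depend on which distinct indices are
    read. *)
Lemma sampl_law n (s t : 'I_n -> nat) : injective s -> injective t ->
  forall E, measurable E -> P (sampl s @^-1` E) = P (sampl t @^-1` E).
Proof.
move=> si ti E mE.
pose ms (u : 'I_n -> nat) : {mfun T >-> n.-tuple V} :=
  HB.pack (sampl u) (isMeasurableFun.Build _ _ _ _ _ (measurable_sampl u)).
apply: (@tuple_measure_unique _ _ _ _ (distribution P (ms s)) (distribution P (ms t))) => //.
  exact: (le_lt_trans (@probability_le1 _ _ _ (distribution P (ms s)) _ measurableT) (ltry 1)).
move=> D mD; transitivity (\prod_(i < n) law (D i))%E; first exact: sampl_rect.
by apply/esym; exact: sampl_rect.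
Qed.

Definition first n : T -> n.-tuple V := sampl (fun i : 'I_n => val i).

Lemma measurable_first n : measurable_fun setT (@first n).
Proof. exact: measurable_sampl. Qed.

HB.instance Definition _ n :=
  isMeasurableFun.Build _ _ _ _ (@first n) (@measurable_first n).

(** Both sides are finite measures in [E], so rectangles suffice; for these the event is a rectangle
    in [n.+1] sample points. *)
Lemma first_indep n E D : measurable E -> measurable D ->
  P (@first n @^-1` E `&` X n @^-1` D) = (P (@first n @^-1` E) * law D)%E.
Proof.
move=> mE mD.
have mXD : measurable (X n @^-1` D).
  by rewrite -[X in measurable X]setTI; exact: measurable_funP.
have lD : 0 <= fine (law D) by rewrite fine_ge0.
have lDE : law D = (fine (law D))%:E by rewrite fineK// fin_num_measure.
rewrite lDE muleC.
apply: (@tuple_measure_unique _ _ _ _ (pushforward (mrestr P mXD) (@first n))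
  (mscale (NngNum lD) (distribution P (@first n)))) => //.
  apply: (@le_lt_trans _ _ 1%E); last exact: ltry.
  rewrite /pushforward /mrestr; apply: probability_le1.
  by apply: measurableI => //; exact: measurable_funPTI.
move=> {E mE} E mE.
rewrite [RHS](_ : _ = law D * P (@first n @^-1` rect E))%E; last by rewrite [in RHS]lDE.
rewrite (sampl_rect (s := fun i : 'I_n => val i))//.
rewrite muleC [LHS](_ : _ = P (@first n @^-1` rect E `&` X n @^-1` D))//.
pose E' (i : 'I_n.+1) := if unlift ord_max i is Some j then E j else D.
have mE' i : measurable (E' i) by rewrite /E'; case: unliftP.
have := @sampl_rect n.+1 (fun i => val i) E' (fun i j => @val_inj _ _ _ i j) mE'.
rewrite big_ord_recr /= /E' unlift_none => h.
transitivity (P (sampl (fun i : 'I_n.+1 => val i) @^-1` rect E')).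
  congr (P _); apply/seteqP; split=> w.
    move=> [/= h1 h2] i; rewrite tnth_mktuple /E'.
    case: unliftP => [j ->|->//] /=.
    by have := h1 j; rewrite tnth_mktuple /= /bump leqNgt ltn_ord.
  move=> h1; split; last first.
    by have := h1 ord_max; rewrite tnth_mktuple /E' unlift_none.
  move=> i; have := h1 (lift ord_max i); rewrite !tnth_mktuple /E' liftK.
  by rewrite /= /bump leqNgt ltn_ord.
rewrite h; congr (_ * _)%E; apply: eq_bigr => i _.
have -> : widen_ord (leqnSn n) i = lift ord_max i.
  by apply: val_inj; rewrite /= /bump leqNgt ltn_ord.
by rewrite liftK.
Qed.

End sample.

(** * Separability and measurability of the threshold *)

Section separability.
Context (R : realType) (d : nat).

Lemma rat_dense (x : 'rV[R]_d) (e : R) : 0 < e ->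
  exists q : 'rV[rat]_d, enorm (x - map_mx ratr q) < e.
Proof.
move=> e0; pose g := e / d.+1%:R.
have g0 : 0 < g by rewrite divr_gt0.
have /choice[q hq] : forall j, exists q : rat, `|x ord0 j - ratr q| < g :> R.
  move=> j; have [|q] := @rat_in_itvoo R (x ord0 j - g) (x ord0 j + g).
    by rewrite ltrD2l gtrN.
  by rewrite in_itv/= => qj; exists q; rewrite distrC ltr_distl.
exists (\row_j q j); apply: (@le_lt_trans _ _ (d%:R * g)).
  by apply: enorm_le_coord => j; rewrite !mxE ltW.
by rewrite /g mulrCA gtr_pMr// ltr_pdivrMr// mul1r ltr_nat.
Qed.

(** For each rational centre and each radius [1 / (n + 1)], a point of [B] is chosen in that ball if
    there is one. This reduces a covering condition on all of [B] to countably many conditions. *)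
Lemma countable_dense_subset (B : set 'rV[R]_d) : B !=set0 ->
  exists u : 'rV[rat]_d * nat -> 'rV[R]_d, (forall p, B (u p)) /\
    forall x e, B x -> 0 < e -> exists p, enorm (x - u p) < e.
Proof.
move=> [b Bb].
have /choice[u hu] : forall p : 'rV[rat]_d * nat, exists y, B y /\
    ((exists2 z, B z & enorm (z - map_mx ratr p.1) < p.2.+1%:R^-1) ->
     enorm (y - map_mx ratr p.1) < p.2.+1%:R^-1).
  move=> p; have [[z Bz zp]|np] := pselect (exists2 z, B z &
    enorm (z - map_mx ratr p.1) < p.2.+1%:R^-1); first by exists z.
  by exists b.
exists u; split=> [p|x e Bx e0]; first by have [] := hu p.
have [n ne] : exists n : nat, n.+1%:R^-1 < e / 2.
  have := @near_infty_natSinv_lt R (PosNum (divr_gt0 e0 (ltr0n R 2))).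
  by move=> [n _ /(_ n (leqnn n))] /= h; exists n.
have [q xq] := @rat_dense x (n.+1%:R^-1) (ltac:(by rewrite invr_gt0)).
exists (q, n); have [_ /(_ _)/= uq] := hu (q, n).
have {}uq := uq (ex_intro2 _ _ x Bx xq).
rewrite /= in uq xq.
apply: le_lt_trans (enorm_triangle x (map_mx ratr q) _) _.
by rewrite (enormB (map_mx _ _) (u _)) [ltRHS](splitr e) ltrD// (lt_trans _ ne).
Qed.

Lemma measurable_oball (x : 'rV[R]_d) r : measurable (oball x r).
Proof. by apply: open_measurable_rV; exact: open_oball. Qed.

Lemma measurable_eball (x : 'rV[R]_d) r : measurable (eball x r).
Proof.
rewrite -(setCK (eball x r)); apply: measurableC; apply: open_measurable_rV.
rewrite (_ : ~` _ = (fun y => enorm (y - x)) @^-1` [set t | r < t]).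
  apply: open_comp; last exact: open_gt.
  by move=> y _; exact: enorm_continuous.
by apply/seteqP; split=> y; rewrite /eball/= ltNge => /negP.
Qed.

End separability.

Section thr_measurable.
Context (R : realType) (d : nat) (B : set 'rV[R]_d) (k : nat).
Context (dZ : measure_display) (Z : measurableType dZ).
Hypothesis B_neq0 : B !=set0.
Variables (f : Z -> seq 'rV[R]_d) (m : nat).
Hypothesis f_size : forall z, size (f z) = m.
Hypothesis f_meas : forall i, (i < m)%N -> measurable_fun setT (fun z => nth 0 (f z) i).

Lemma cnt_sum (s : seq 'rV[R]_d) D :
  (cnt s D)%:R = \sum_(i < size s) \1_D (nth 0 s i) :> R.
Proof.
elim: s => [|x s IH] /=; first by rewrite big_ord0.
by rewrite big_ord_recl /= -IH natrD indicE.
Qed.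

Lemma measurable_cnt_ge D j : measurable D -> measurable [set z | (j <= cnt (f z) D)%N].
Proof.
move=> mD; have -> : [set z | (j <= cnt (f z) D)%N] =
    [set z | j%:R <= \sum_(i < m) \1_D (nth 0 (f z) i) :> R].
  by apply/seteqP; split => z /=; rewrite -(ler_nat R) cnt_sum f_size.
rewrite -[X in measurable X]setTI; apply: measurable_fun_le => //.
apply: measurable_sum => i; apply: measurableT_comp; last exact: f_meas.
exact: measurable_indic.
Qed.

Lemma measurable_thr : measurable_fun setT (fun z => thr B k (f z)).
Proof.
apply: (@measurability _ _ _ _ setT _ _ (ErealGenInftyO.measurableE R)) => _ [_ [r ->] <-].
have [u [uB u_dense]] := countable_dense_subset B_neq0.
rewrite setTI [X in measurable X](_ : _ = \bigcup_(q : rat)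
   if (0 < (ratr q : R) < r) then \bigcap_(p : 'rV[rat]_d * nat)
    [set z | (k <= cnt (f z) (eball (u p) (ratr q)))%N] else (set0 : set Z)); last first.
  apply/seteqP; split => z /=; rewrite in_itv/=; last first.
    move=> [q _]; case: ifPn => // /andP[q0 qr] hz.
    (* [r'] leaves room above [q] for the distance from [x] to the dense family. *)
    pose r' := (ratr q + r) / 2.
    apply: (@le_lt_trans _ _ r'%:E); last by rewrite lte_fin /r'; lra.
    apply: thr_le => [|x Bx]; first by rewrite /r'; lra.
    have [|p xp] := u_dense x (r' - ratr q) Bx; first by rewrite /r'; lra.
    apply: leq_trans (hz p Logic.I) _; apply: sub_cnt => y; rewrite /eball/= => yp.
    have := enorm_triangle y (u p) x; move: xp; rewrite (enormB x); lra.
  move=> /thr_lt[q [q0 qc]]; rewrite lte_fin => qr.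
  have [a] := rat_in_itvoo qr; rewrite in_itv/= => /andP[qa ar].
  exists a => //; rewrite (lt_trans q0 qa) ar /= => p _ /=.
  apply: leq_trans (qc (u p) (uB p)) _; apply: sub_cnt => y.
  by rewrite /eball/= => /le_trans; apply; exact: ltW.
apply: countable_bigcupT_measurable => [|q]; first exact: countableP.
case: ifP => // _; rewrite -[X in measurable X]setCK setC_bigcap; apply: measurableC.
apply: countable_bigcupT_measurable => [|p]; first exact: countableP.
by apply/measurableC/measurable_cnt_ge; exact: measurable_eball.
Qed.

End thr_measurable.

(** * Volumes and densities *)

Section lebesgue_ball.
Context (R : realType) (d : nat).
Local Notation leb := (lebesgue_rV R d).
Implicit Types (a b : 'I_d -> R).

Definition box a b : set 'rV[R]_d := [set x | forall j, a j <= x ord0 j <= b j].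

Lemma measurable_box a b : measurable (box a b).
Proof.
have -> : box a b = \bigcap_(j in [set: 'I_d])
    ((fun x : 'rV[R]_d => x ord0 j) @^-1` `[a j, b j]%classic).
  apply/seteqP; split => x /= h j; first by move=> _; rewrite /= in_itv/= h.
  by have := h j Logic.I; rewrite /= in_itv.
apply: fin_bigcap_measurable => // j _.
by rewrite -[X in measurable X]setTI; exact: measurable_coord.
Qed.

Lemma lebesgue_box a b : (forall j, a j <= b j) ->
  leb (box a b) = (\prod_(j < d) (b j - a j))%:E.
Proof. exact: lebesgue_rV_box. Qed.

Lemma box0 a b j : b j < a j -> box a b = set0.
Proof.
move=> ba; apply/seteqP; split=> // x /(_ j)/andP[h1 h2].
by have := le_lt_trans (le_trans h1 h2) ba; rewrite ltxx.
Qed.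

(** The identity from the sigma-algebra generated by the boxes to the Borel one is measurable
    coordinate by coordinate, since an open half-space [x_j < r] is a countable union of boxes. *)
Lemma sigma_box : measurable = <<s [set box a b | a in setT & b in setT] >> :> set (set 'rV[R]_d).
Proof.
set G := (X in <<s X >>); rewrite eqEsubset; split; last first.
  apply: smallest_sub; first exact: sigma_algebra_measurable.
  by move=> _ [a _ [b _ <-]]; exact: measurable_box.
have mid : measurable_fun [set: g_sigma_algebraType G]
    (id : g_sigma_algebraType G -> 'rV[R]_d).
  apply: measurable_fun_rV => j.
  apply: (@measurability _ _ _ _ setT _ _ (RGenInftyO.measurableE R)) => _ [_ [r ->] <-].
  rewrite setTI (_ : _ @^-1` _ = \bigcup_(n : nat)
      box (fun=> - n%:R) (fun i => if i == j then r - n.+1%:R^-1 else n%:R)).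
    apply: bigcupT_measurable => n; apply: sub_sigma_algebra.
    by exists (fun=> - n%:R) => //; exists (fun i => if i == j then r - n.+1%:R^-1 else n%:R).
  apply/seteqP; split => x /=; rewrite in_itv/=; last first.
    move=> [n _ /(_ j)]; rewrite eqxx => /andP[_ /le_lt_trans]; apply.
    by rewrite gtrBl invr_gt0.
  move=> xr; have : \forall n \near \oo, box (fun=> - n%:R)
      (fun i => if i == j then r - n.+1%:R^-1 else n%:R) x.
    have xr0 : 0 < r - x ord0 j by rewrite subr_gt0.
    near=> n => i.
    have : enorm x <= n%:R by near: n; exact: nbhs_infty_ger.
    move=> /(le_trans (coord_le_enorm x i)); rewrite ler_norml => /andP[-> xn] /=.
    case: eqP => // ->; rewrite lerBrDr -lerBrDl ltW//.
    by near: n; exact: (@near_infty_natSinv_lt R (PosNum xr0)).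
  by move=> [n _ /(_ n (leqnn n))] h; exists n.
move=> D mD; have := mid measurableT D mD; rewrite setTI preimage_id; exact.
Unshelve. all: by end_near. Qed.

Lemma box_unique (m1 m2 : {measure set 'rV[R]_d -> \bar R}) :
  (forall a b, (forall j, a j <= b j) -> m1 (box a b) = m2 (box a b)) ->
  (forall a b, (m1 (box a b) < +oo)%E) ->
  forall D, measurable D -> m1 D = m2 D.
Proof.
move=> m12 m1oo D mD.
apply: (@measure_unique _ R _ [set box a b | a in setT & b in setT]
  (fun n => box (fun=> - n%:R) (fun=> n%:R))) => //.
- exact: sigma_box.
- move=> _ _ [a _ [b _ <-]] [a' _ [b' _ <-]].
  exists (fun j => Num.max (a j) (a' j)) => //.
  exists (fun j => Num.min (b j) (b' j)) => //.
  apply/seteqP; split=> x /=.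
    by move=> h; split=> j; have := h j; rewrite ge_max le_min =>
      /andP[/andP[h1 h2] /andP[h3 h4]]; apply/andP.
  move=> [h1 h2] j; have /andP[u1 u2] := h1 j; have /andP[v1 v2] := h2 j.
  by rewrite ge_max le_min u1 u2 v1 v2.
- by move=> n; exists (fun=> - n%:R) => //; exists (fun=> n%:R).
- rewrite -subTset => x _; have : \forall n \near \oo, enorm x <= n%:R.
    exact: nbhs_infty_ger.
  move=> [n _ /(_ n (leqnn n)) xn]; exists n => // j.
  by rewrite -ler_norml (le_trans (coord_le_enorm x j)).
- move=> _ [a _ [b _ <-]]; have [h|] := pselect (forall j, a j <= b j).
    exact: m12.
  by move=> /existsNP[j /negP]; rewrite -ltNge => /box0 ->; rewrite !measure0.
Qed.

Lemma lebesgue_box_lty a b : (leb (box a b) < +oo)%E.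
Proof.
have [h|] := pselect (forall j, a j <= b j); first by rewrite lebesgue_box// ltry.
by move=> /existsNP[j /negP]; rewrite -ltNge => /box0 ->; rewrite measure0.
Qed.

Section affine.
Context (x : 'rV[R]_d) (r : R).
Hypothesis r0 : 0 < r.

Let phi (y : 'rV[R]_d) := x + r *: y.

Let measurable_phi : measurable_fun setT phi.
Proof.
apply: measurable_fun_rV => j; rewrite /phi; under eq_fun do rewrite !mxE.
apply: measurable_funD => //; apply: measurable_funM => //.
exact: measurable_coord.
Qed.

HB.instance Definition _ := isMeasurableFun.Build _ _ _ _ phi measurable_phi.

Lemma lebesgue_affine D : measurable D ->
  leb D = ((r ^+ d)%:E * leb (phi @^-1` D))%E.
Proof.
have rd0 : 0 <= r ^+ d by rewrite exprn_ge0 ?ltW.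
apply: (@box_unique leb (mscale (NngNum rd0) (pushforward leb phi))) => [a b ab|a b].
  rewrite /= /mscale/= /pushforward.
  rewrite (_ : phi @^-1` _ = box (fun j => (a j - x ord0 j) / r) (fun j => (b j - x ord0 j) / r)).
    have ab' j : (a j - x ord0 j) / r <= (b j - x ord0 j) / r.
      by rewrite ler_pM2r ?invr_gt0// lerD2r.
    rewrite (lebesgue_box ab) (lebesgue_box ab').
    rewrite -EFinM; congr (_%:E); rewrite -[in r ^+ d](card_ord d) -prodr_const.
    by rewrite -big_split; apply: eq_bigr => j _ /=; field; rewrite gt_eqF.
  apply/seteqP; split => y /= h j; have := h j; rewrite !mxE;
    by rewrite ler_pdivrMr// ler_pdivlMr// [_ * r]mulrC lerBlDl lerBrDl.
exact: lebesgue_box_lty.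
Qed.

End affine.

Definition ball_vol : R := fine (leb (oball 0 1)).

Lemma oball_box (x : 'rV[R]_d) (r : R) : oball x r `<=` box (fun j => x ord0 j - r) (fun j => x ord0 j + r).
Proof.
move=> y; rewrite /oball/= => yx j; rewrite -ler_distlC distrC ltW//.
by apply: le_lt_trans yx; have := coord_le_enorm (y - x) j; rewrite !mxE.
Qed.

Lemma box_oball (x : 'rV[R]_d) (r : R) : 0 < r ->
  box (fun j => x ord0 j - r / d.+1%:R) (fun j => x ord0 j + r / d.+1%:R) `<=` oball x r.
Proof.
move=> r0 y yb; rewrite /oball/=.
apply: (@le_lt_trans _ _ (d%:R * (r / d.+1%:R))); last first.
  by rewrite mulrCA gtr_pMr// ltr_pdivrMr// mul1r ltr_nat.
by apply: enorm_le_coord => j; rewrite !mxE distrC ler_distlC; exact: yb.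
Qed.

Lemma ball_vol_gt0 : 0 < ball_vol.
Proof.
apply: fine_gt0; apply/andP; split.
  apply: (@lt_le_trans _ _ (leb (box (fun j => (0 : 'rV[R]_d) ord0 j - 1 / d.+1%:R)
     (fun j => (0 : 'rV[R]_d) ord0 j + 1 / d.+1%:R)))).
    rewrite lebesgue_box => [|j]; last first.
      by rewrite !mxE sub0r add0r ge0_cp// divr_ge0.
    rewrite lte_fin prodr_gt0// => j _; rewrite !mxE sub0r add0r opprK addr_gt0// divr_gt0//.
  apply: le_measure; rewrite ?inE; [exact: measurable_box|exact: measurable_oball|].
  exact: box_oball.
apply: le_lt_trans (lebesgue_box_lty (fun j => (0 : 'rV[R]_d) ord0 j - 1)
  (fun j => (0 : 'rV[R]_d) ord0 j + 1)).
apply: le_measure; rewrite ?inE; [exact: measurable_oball|exact: measurable_box|].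
exact: oball_box.
Qed.

Lemma lebesgue_oball x r : 0 < r -> leb (oball x r) = (ball_vol * r ^+ d)%:E.
Proof.
move=> r0; rewrite (lebesgue_affine x r0)//; last exact: measurable_oball.
rewrite (_ : _ @^-1` _ = oball 0 1).
  rewrite mulrC EFinM /ball_vol fineK// fin_real//.
  have := ball_vol_gt0; rewrite /ball_vol.
  by case: (leb _) => [s|/=|/=]; rewrite ?ltxx// ltNyr ltry.
by apply/seteqP; split=> y;
  rewrite /oball /preimage/= subr0 [x + _]addrC addrK enormZ gtr0_norm// gtr_pMr.
Qed.

End lebesgue_ball.

(** * The density near [B] *)

Section density.
Context (R : realType) (d : nat).
Local Notation leb := (lebesgue_rV R d).
Variables (A B : set 'rV[R]_d) (f : 'rV[R]_d -> R) (mu : {measure set 'rV[R]_d -> \bar R}).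
Hypotheses (A_compact : compact A) (B_compact : compact B).
Hypotheses (f_meas : measurable_fun setT f) (f_ge0 : forall x, 0 <= f x).
Hypothesis mu_f : forall D, measurable D -> mu D = (\int[leb]_(x in D) (f x)%:E)%E.
Hypotheses (f_supp : closure [set x | f x != 0] = A) (f_cont : {within A, continuous f}).
Hypotheses (B_sub : B `<=` interior A) (f_inf : 0 < inf (f @` B)).

Let EFin_f_meas D : measurable D -> measurable_fun D (fun x => (f x)%:E).
Proof.
move=> mD; apply/measurable_EFinP; exact: measurable_funTS.
Qed.

Lemma density_bounded : exists2 C : R, 0 < C & forall x, f x <= C.
Proof.
have [M [_ hM]] := compact_bounded (continuous_compact f_cont A_compact).
exists (Num.max 1 (M + 1)) => [|x]; first by rewrite lt_max ltr01.
have [/eqP ->|fx] := boolP (f x == 0); first by rewrite le_max ler01.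
rewrite le_max; apply/orP; right; rewrite (le_trans (ler_norm _))//.
apply: (hM (M + 1)); first by rewrite ltrDl.
by exists x => //; rewrite -f_supp; exact: subset_closure.
Qed.

Lemma density_le (C : R) D : measurable D -> 0 <= C -> (forall x, D x -> f x <= C) ->
  (mu D <= C%:E * leb D)%E.
Proof.
move=> mD C0 fC; rewrite mu_f// -integral_cst//.
apply: ge0_le_integral => //.
- by move=> x _; rewrite lee_fin.
- exact: EFin_f_meas.
Qed.

Lemma density_ge (C : R) D : measurable D -> 0 <= C -> (forall x, D x -> C <= f x) ->
  (C%:E * leb D <= mu D)%E.
Proof.
move=> mD C0 fC; rewrite mu_f// -integral_cst//.
apply: ge0_le_integral => //.
- exact: EFin_f_meas.
Qed.

Lemma density_setC : mu (~` A) = 0.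
Proof.
have mA : measurable A.
  rewrite -(setCK A); apply: measurableC; apply: open_measurable_rV.
  by rewrite -f_supp; apply: closed_openC; exact: closed_closure.
apply/eqP; rewrite eq_le measure_ge0 andbT.
rewrite (le_trans (@density_le 0 _ _ _ _))//; first exact: measurableC.
  move=> x Ax; have [/eqP->//|fx] := boolP (f x == 0); exfalso; apply: Ax.
  by rewrite -f_supp; exact: subset_closure.
by rewrite mul0e.
Qed.

(** [y] ranges over the whole space, because a ball around a boundary point of [B] leaves [B]. This
    is possible since [B] lies in the interior of [A], so that [f] is continuous at each point of
    [B]. *)
Lemma density_unif_cont (e : R) : 0 < e -> exists2 r, 0 < r &
  forall x y, B x -> enorm (y - x) < r -> `|f y - f x| <= e.
Proof.
move=> e0.
have : \forall r \near (0:R)^'+, forall x, B x ->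
    forall y, enorm (y - x) < r -> `|f y - f x| <= e.
  move/compact_near_coveringP : B_compact; apply => x Bx.
  have fx : {for x, continuous f}.
    have := continuous_subspaceW (@interior_subset _ A) f_cont.
    rewrite continuous_open_subspace; last exact: open_interior.
    by apply; rewrite inE; exact: B_sub.
  have e20 : 0 < e / 2 by rewrite divr_gt0.
  have /nbhs_oball[g g0 hg] := (@cvgrPdist_lt _ _ _ (nbhs x) (nbhs_filter x) f (f x)).1 fx _ e20.
  exists (oball x (g / 2), [set r | r <= g / 2]).
    split; first by apply: oball_nbhs; rewrite divr_gt0.
    by apply: nbhs_right_le; rewrite divr_gt0.
  move=> [x' r] /= [xx' rg] y yx'.
  have h1 : `|f x - f x'| < e / 2.
    by apply: hg; apply: lt_trans xx' _; rewrite ltr_pdivrMr// ltr_pMr// ltr1n.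
  have h2 : `|f x - f y| < e / 2.
    apply: hg; rewrite /oball/= in xx' *.
    by have := enorm_triangle y x' x; lra.
  by rewrite -(subrKA (f x)) (le_trans (ler_normD _ _))// distrC; lra.
move=> H; near (0:R)^'+ => r; exists r; first by near: r; exact: nbhs_right_gt.
move=> x y Bx; exact: (near H r).
Unshelve. all: by end_near. Qed.

Lemma density_inf_le x : B x -> inf (f @` B) <= f x.
Proof.
by move=> Bx; apply: ge_inf; [exists 0 => _ [y _ <-]|exists x].
Qed.

Lemma density_oball (e : R) : 0 < e -> e < inf (f @` B) -> exists2 r0, 0 < r0 &
  forall x r, B x -> 0 < r -> r <= r0 ->
  (((f x - e) * (ball_vol R d * r ^+ d))%:E <= mu (oball x r) /\
   mu (oball x r) <= ((f x + e) * (ball_vol R d * r ^+ d))%:E)%E.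
Proof.
move=> e0 ef; have [r0 r00 h] := density_unif_cont e0.
exists r0 => // x r Bx r_gt0 rr0; rewrite !(EFinM _ (_ * _)) -(lebesgue_oball x r_gt0).
have mb := measurable_oball x r.
have h' y : oball x r y -> `|f y - f x| <= e.
  by move=> yx; apply: h => //; exact: lt_le_trans rr0.
split.
- apply: density_ge => // [|y /h']; first by rewrite subr_ge0 (le_trans (ltW ef))// density_inf_le.
  rewrite ler_norml; lra.
- apply: density_le => // [|y /h']; first by rewrite addr_ge0// ltW.
  rewrite ler_norml; lra.
Qed.

Hypotheses (B_reg : B = closure (interior B)) (B_neq0 : B !=set0).

(** A near minimiser may lie on the boundary of [B]; as [B] is the closure of its interior, it can
    be moved to an interior point with little change of [f]. *)
Lemma density_inf_approx (e : R) : 0 < e -> exists x r,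
  [/\ 0 < r, oball x r `<=` B & f x <= inf (f @` B) + e].
Proof.
move=> e0; have e20 : 0 < e / 2 by rewrite divr_gt0.
have hi : has_inf (f @` B).
  split; last by exists 0 => _ [y _ <-].
  by have [b Bb] := B_neq0; exists (f b), b.
have [_ [x Bx <-] fx] := inf_adherent e20 hi.
have [r r0 hr] := density_unif_cont e20.
have : closure (interior B) x by rewrite -B_reg.
move=> /(_ _ (oball_nbhs x r0))[y [iy yx]].
have [s s0 sB] := nbhs_oball iy.
exists y, s; split => //.
by have := hr x y Bx yx; rewrite ler_norml; lra.
Qed.

End density.

(** * Expectations and occupancy *)

Section bounded_expectation.
Context (dT : measure_display) (T : measurableType dT) (R : realType) (P : probability T R).
Implicit Types (f g : T -> R) (D : set T).

(** Bounded measurable functions: closed under the operations below and integrable for every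
    probability, which keeps integrability out of the later arguments. *)
Definition bmf f := measurable_fun setT f /\ exists M : R, forall x, `|f x| <= M.

Lemma bmf_integrable f : bmf f -> P.-integrable setT (EFin \o f).
Proof.
move=> [mf [M fM]]; apply: measurable_bounded_integrable => //.
  by rewrite (le_lt_trans (probability_le1 _ _))// ltry.
exists M; split; first by rewrite num_real.
by move=> N MN x _ /=; apply: le_trans (ltW MN).
Qed.

Lemma bmf_cst (r : R) : bmf (fun=> r).
Proof. by split; [exact: measurable_cst|exists `|r|]. Qed.

Lemma bmfD f g : bmf f -> bmf g -> bmf (fun x => f x + g x).
Proof.
move=> [mf [M fM]] [mg [N gN]]; split; first exact: measurable_funD.
by exists (M + N) => x; rewrite (le_trans (ler_normD _ _))// lerD.
Qed.

Lemma bmfM f g : bmf f -> bmf g -> bmf (fun x => f x * g x).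
Proof.
move=> [mf [M fM]] [mg [N gN]]; split; first exact: measurable_funM.
by exists (M * N) => x; rewrite normrM ler_pM.
Qed.

Lemma bmfZ (r : R) f : bmf f -> bmf (fun x => r * f x).
Proof. exact: (bmfM (bmf_cst r)). Qed.

Lemma bmfB f g : bmf f -> bmf g -> bmf (fun x => f x - g x).
Proof.
move=> bf /(bmfZ (-1)) bg; have := bmfD bf bg.
by congr bmf; apply/funext => x; rewrite mulN1r.
Qed.

Lemma bmf_sum (I : Type) (s : seq I) (Q : pred I) (h : I -> T -> R) :
  (forall i, bmf (h i)) -> bmf (fun x => \sum_(i <- s | Q i) h i x).
Proof.
move=> bh; elim: s => [|i s IH].
  by under eq_fun do rewrite big_nil; exact: bmf_cst.
under eq_fun do rewrite big_cons; case: (Q i) => //; exact: bmfD.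
Qed.

Lemma bmf_indic D : measurable D -> bmf (\1_D : T -> R).
Proof.
move=> mD; split; first exact: measurable_indic.
by exists 1 => x; rewrite indicE; case: (x \in D); rewrite ?normr1// normr0.
Qed.

Definition Ex f : R := \int[P]_x f x.

Lemma ExE f : bmf f -> (\int[P]_x (f x)%:E)%E = (Ex f)%:E.
Proof. by move=> bf; rewrite /Ex /Rintegral fineK//; exact/integrable_fin_num/bmf_integrable. Qed.

Lemma ExD f g : bmf f -> bmf g -> Ex (fun x => f x + g x) = Ex f + Ex g.
Proof. by move=> bf bg; rewrite /Ex RintegralD//; exact: bmf_integrable. Qed.

Lemma ExB f g : bmf f -> bmf g -> Ex (fun x => f x - g x) = Ex f - Ex g.
Proof. by move=> bf bg; rewrite /Ex RintegralB//; exact: bmf_integrable. Qed.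

Lemma ExZ (r : R) f : bmf f -> Ex (fun x => r * f x) = r * Ex f.
Proof. by move=> bf; rewrite /Ex RintegralZl//; exact: bmf_integrable. Qed.

Lemma Ex_cst (r : R) : Ex (fun=> r) = r.
Proof.
rewrite /Ex Rintegral_cst// (_ : fine _ = 1) ?mulr1//.
by rewrite [X in fine X](_ : _ = 1%E)//; exact: probability_setT.
Qed.

Lemma Ex_le f g : bmf f -> bmf g -> (forall x, f x <= g x) -> Ex f <= Ex g.
Proof. by move=> bf bg fg; apply: le_Rintegral => //; exact: bmf_integrable. Qed.

Lemma Ex_ge0 f : (forall x, 0 <= f x) -> 0 <= Ex f.
Proof. by move=> f0; apply: Rintegral_ge0. Qed.

Lemma Ex_indic D : measurable D -> Ex \1_D = fine (P D).
Proof. by move=> mD; rewrite /Ex /Rintegral integral_indic// setIT. Qed.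

Lemma Ex_sum (I : Type) (s : seq I) (Q : pred I) (h : I -> T -> R) :
  (forall i, bmf (h i)) ->
  Ex (fun x => \sum_(i <- s | Q i) h i x) = \sum_(i <- s | Q i) Ex (h i).
Proof.
move=> bh; elim: s => [|i s IH].
  by under eq_fun do rewrite big_nil; rewrite big_nil Ex_cst.
under eq_fun do rewrite big_cons; rewrite big_cons; case: (Q i) => //.
by rewrite ExD//; [rewrite IH|exact: bmf_sum].
Qed.

Lemma measurable_ge_set f (a : R) : measurable_fun setT f -> measurable [set x | a <= f x].
Proof.
move=> mf; rewrite -[X in measurable X]setTI.
by apply: measurable_fun_le => //; exact: measurable_cst.
Qed.

Lemma Ex_markov f (a : R) : bmf f -> (forall x, 0 <= f x) ->
  a * fine (P [set x | a <= f x]) <= Ex f.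
Proof.
move=> bf f0; have mD := measurable_ge_set a (proj1 bf).
rewrite -Ex_indic// -ExZ; last exact: bmf_indic.
apply: Ex_le => //; first exact/bmfZ/bmf_indic.
by move=> x; rewrite indicE; case: (boolP (x \in _)) => [/set_mem|_]; rewrite ?mulr1 ?mulr0.
Qed.

Lemma prob_le1 D : measurable D -> fine (P D) <= 1.
Proof. by move=> mD; rewrite -lee_fin fineK ?probability_le1// fin_num_measure. Qed.

Lemma prob_ge0 D : 0 <= fine (P D).
Proof. exact: fine_ge0. Qed.

Lemma prob_le D E : measurable D -> measurable E -> D `<=` E -> fine (P D) <= fine (P E).
Proof.
move=> mD mE DE; rewrite -lee_fin !fineK ?fin_num_measure//.
by apply: le_measure; rewrite ?inE.
Qed.

Lemma prob_bigU (I : finType) (D : I -> set T) : (forall i, measurable (D i)) ->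
  fine (P (\bigcup_i D i)) <= \sum_i fine (P (D i)).
Proof.
move=> mD; have mU : measurable (\bigcup_i D i).
  by apply: fin_bigcup_measurable => // ; exact: finite_finset.
rewrite -Ex_indic// -(eq_bigr _ (fun i _ => Ex_indic (mD i))) -Ex_sum; last first.
  by move=> i; exact: bmf_indic.
apply: Ex_le; first exact: bmf_indic.
  by apply: bmf_sum => i; exact: bmf_indic.
move=> x; rewrite indicE; case: (boolP (x \in _)) => [/set_mem[i _ Di]|_].
  by rewrite (bigD1 i)//= indicE mem_set// lerDl sumr_ge0.
by rewrite sumr_ge0.
Qed.

Lemma indicM D E x : \1_D x * \1_E x = \1_(D `&` E) x :> R.
Proof. by rewrite indicI. Qed.

(* Chebyshev's inequality for the number of the events [E i] that occur *)
Lemma neg_correlated (I : finType) (E : I -> set T) : (forall i, measurable (E i)) ->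
  (forall i j, i != j -> fine (P (E i `&` E j)) <= fine (P (E i)) * fine (P (E j))) ->
  (\sum_i fine (P (E i))) * fine (P (\bigcap_i ~` E i)) <= 1.
Proof.
move=> mE nE; set S := \sum_i _.
have mN : measurable (\bigcap_i ~` E i).
  by rewrite -setC_bigcup; apply: measurableC; apply: fin_bigcup_measurable => //; exact: finite_finset.
have S0 : 0 <= S by apply: sumr_ge0 => i _; exact: prob_ge0.
have bZ : bmf (fun x => \sum_i \1_(E i) x) by apply: bmf_sum => i; exact: bmf_indic.
have EZ : Ex (fun x => \sum_i \1_(E i) x) = S.
  by rewrite Ex_sum => [|i]; [apply: eq_bigr => i _; exact: Ex_indic|exact: bmf_indic].
have EZ2 : Ex (fun x => (\sum_i \1_(E i) x) * (\sum_i \1_(E i) x)) <= S + S * S.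
  under [X in Ex X]eq_fun do rewrite big_distrlr/=.
  rewrite Ex_sum => [|i]; last by apply: bmf_sum => j; apply: bmfM; exact: bmf_indic.
  rewrite {2}/S big_distrl -big_split; apply: ler_sum => i _ /=.
  rewrite Ex_sum => [|j]; last by apply: bmfM; exact: bmf_indic.
  rewrite (bigD1 i)//= lerD//.
    under [X in Ex X]eq_fun do rewrite indicM setIid.
    by rewrite Ex_indic.
  rewrite mulr_sumr [leRHS](bigD1 i)//= ler_wpDl ?mulr_ge0 ?prob_ge0//.
  apply: ler_sum => j ji; under [X in Ex X]eq_fun do rewrite indicM.
  by rewrite Ex_indic ?nE//; [rewrite eq_sym|exact: measurableI].
have key : S * S * fine (P (\bigcap_i ~` E i)) <= S.
  rewrite -Ex_indic// -ExZ; last exact: bmf_indic.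
  apply: (@le_trans _ _ (Ex (fun x => (\sum_i \1_(E i) x) * (\sum_i \1_(E i) x) - 2 * S * (\sum_i \1_(E i) x) + S * S))).
    apply: Ex_le.
    - exact/bmfZ/bmf_indic.
    - apply: bmfD; last exact: bmf_cst.
      by apply: bmfB; [exact: bmfM|exact: bmfZ].
    - move=> x; rewrite indicE; case: (boolP (x \in _)) => [/set_mem h|_].
        by rewrite big1 => [|i _]; [rewrite mulr1; lra|rewrite indicE memNset//; exact: h].
      rewrite mulr0; have := sqr_ge0 ((\sum_i \1_(E i) x) - S); lra.
  rewrite ExD; [|by apply: bmfB; [exact: bmfM|exact: bmfZ]|exact: bmf_cst].
  rewrite ExB; [|exact: bmfM|exact: bmfZ].
  rewrite ExZ// EZ Ex_cst; apply: (@le_trans _ _ (S + S * S - 2 * S * S + S * S)).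
    by rewrite !lerD2r.
  lra.
have [->|S1] := eqVneq S 0; first by rewrite mul0r.
have S_gt0 : 0 < S by rewrite lt_def S1.
by move: key; rewrite -mulrA -[X in _ <= X -> _]mulr1 ler_pM2l.
Qed.

End bounded_expectation.

(** * Occupation numbers of the sample *)

Section occupancy.
Context (dT : measure_display) (T : measurableType dT) (R : realType) (d : nat)
  (P : probability T R) (X : nat -> {mfun T >-> 'rV[R]_d}).
Implicit Types (D : set 'rV[R]_d) (w : T).

Definition pts n w : seq 'rV[R]_d := [seq X i w | i <- iota 0 n].

Lemma pts_first n w : pts n w = first X n w :> seq _.
Proof. by rewrite /first /sampl /= /pts -val_enum_ord -map_comp. Qed.

Lemma size_pts n w : size (pts n w) = n.
Proof. by rewrite size_map size_iota. Qed.

Lemma ptsS n w : pts n.+1 w = rcons (pts n w) (X n w).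
Proof.
rewrite /pts -map_rcons; congr map.
by rewrite -addn1 iotaD cats1.
Qed.

Lemma nth_pts n w i : (i < n)%N -> nth 0 (pts n w) i = X i w.
Proof. by move=> ni; rewrite (nth_map 0%N) ?size_iota// nth_iota. Qed.

Lemma measurable_pts_cnt n D j : measurable D ->
  measurable [set w | (j <= cnt (pts n w) D)%N].
Proof.
move=> mD; apply: (@measurable_cnt_ge _ _ _ _ _ n) => //.
  by move=> w; exact: size_pts.
move=> i ni; under eq_fun do rewrite nth_pts//.
exact: measurable_funP.
Qed.

Lemma measurable_pts_cnt_lt n D j : measurable D ->
  measurable [set w | (cnt (pts n w) D < j)%N].
Proof.
move=> mD; rewrite (_ : [set w | _] = ~` [set w | (j <= cnt (pts n w) D)%N]).
  by apply: measurableC; exact: measurable_pts_cnt.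
by apply/seteqP; split=> w /=; rewrite ltnNge => /negP.
Qed.

Lemma measurable_tuple_cnt_lt n D j : measurable D ->
  measurable [set t : n.-tuple 'rV[R]_d | (cnt t D < j)%N].
Proof.
move=> mD; rewrite (_ : [set t | _] = ~` [set t : n.-tuple 'rV[R]_d | (j <= cnt t D)%N]).
  apply: measurableC; apply: (@measurable_cnt_ge _ _ _ _ _ n) => // [t|i ni].
    exact: size_tuple.
  rewrite (_ : (fun _ => _) = (fun t : n.-tuple 'rV[R]_d => tnth t (Ordinal ni))).
    exact: measurable_tnth.
  by apply/funext => t; rewrite (tnth_nth 0).
by apply/seteqP; split=> w /=; rewrite ltnNge => /negP.
Qed.

Hypothesis X_iid : forall (J : seq nat) (D : nat -> set 'rV[R]_d),
  uniq J -> (forall j, measurable (D j)) ->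
  P (\bigcap_(j in [set` J]) X j @^-1` D j) = (\prod_(j <- J) law P X (D j))%E.

Local Notation mu := (law P X).

Lemma pts_next n E D : measurable E -> measurable D ->
  fine (P ([set w | E (first X n w)] `&` [set w | D (X n w)])) =
  fine (P [set w | E (first X n w)]) * fine (mu D).
Proof.
move=> mE mD; rewrite -fineM ?fin_num_measure//; last first.
  by apply: measurable_funPTI.
by rewrite -(first_indep X_iid).
Qed.

(** This is the Chernoff bound [P(N < j) <= z^-j E[z^N]] for a binomial count [N], by induction on
    the number of points. *)
Lemma binomial_tail n j D (z : R) : measurable D -> 0 < z <= 1 ->
  fine (P [set w | (cnt (pts n w) D < j)%N]) <=
  z^-1 ^+ j * (1 - (1 - z) * fine (mu D)) ^+ n.
Proof.
move=> mD /andP[z0 z1]; set q := fine (mu D).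
have q0 : 0 <= q by exact: prob_ge0.
have q1 : q <= 1 by exact: prob_le1.
have h0 : 0 <= 1 - (1 - z) * q by rewrite subr_ge0 mulr_ile1// ?subr_ge0// gerBl ltW.
elim: n j => [|n IH] j.
  rewrite expr0 mulr1; case: j => [|j].
    by rewrite expr0; apply: prob_le1; exact: measurable_pts_cnt_lt.
  apply: (@le_trans _ _ 1); last by rewrite exprn_ege1// invf_ge1.
  by apply: prob_le1; exact: measurable_pts_cnt_lt.
case: j => [|j].
  have -> : [set w | (cnt (pts n.+1 w) D < 0)%N] = set0 by apply/seteqP; split.
  by rewrite measure0 mulr_ge0 ?exprn_ge0// invr_ge0 ltW.
have mX E : measurable E -> measurable [set w | E (X n w)].
  by move=> mE; apply: measurable_funPTI.
(* The last point is independent of the others and falls in [D] or not. *)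
have e1 : fine (P [set w | (cnt (pts n.+1 w) D < j.+1)%N]) =
    fine (P [set w | (cnt (pts n w) D < j.+1)%N]) * (1 - q) +
    fine (P [set w | (cnt (pts n w) D < j)%N]) * q.
  have -> : 1 - q = fine (mu (~` D)).
    by rewrite probability_setC// fineB// fin_num_measure.
  have mt i : measurable [set t : n.-tuple 'rV[R]_d | (cnt t D < i)%N].
    exact: measurable_tuple_cnt_lt.
  have := pts_next (mt j.+1) (measurableC mD).
  have := pts_next (mt j) mD.
  have eq1 i : [set w | [set t : n.-tuple 'rV[R]_d | (cnt t D < i)%N] (first X n w)] =
      [set w | (cnt (pts n w) D < i)%N].
    by apply/seteqP; split => w /=; rewrite pts_first.
  rewrite !{}eq1 => <- <-; rewrite -fineD ?fin_num_measure//; last 2 first.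
    by apply: measurableI; [exact: measurable_pts_cnt_lt|exact/mX/measurableC].
    by apply: measurableI; [exact: measurable_pts_cnt_lt|exact/mX].
  rewrite -measureU//; last 3 first.
    by apply: measurableI; [exact: measurable_pts_cnt_lt|exact/mX/measurableC].
    by apply: measurableI; [exact: measurable_pts_cnt_lt|exact/mX].
    by apply/seteqP; split => // w [[_ h1] [_ h2]].
  have eqS w : cnt (pts n.+1 w) D = (cnt (pts n w) D + (X n w \in D))%N.
    by rewrite ptsS -cats1 cnt_cat /cnt /= addn0.
  congr (fine (P _)); apply/seteqP; split => w; rewrite /mkset eqS /=.
    case: (boolP (X n w \in D)) => [/set_mem Dw|/negP Dw].
      by rewrite addn1 ltnS => h; right.
    by rewrite !addn0 => h; left; split => // /mem_set.
  by move=> [[h1 /= h2]|[h1 /= h2]]; [rewrite memNset ?addn0|rewrite mem_set ?addn1].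
rewrite e1 [(1 - _) ^+ n.+1]exprSr (le_trans (lerD (ler_wpM2r _ (IH j.+1)) (ler_wpM2r _ (IH j))))//.
  by rewrite subr_ge0.
rewrite -/q [z^-1 ^+ j.+1]exprSr.
rewrite -subr_ge0 le_eqVlt; apply/orP; left; apply/eqP.
by field; rewrite gt_eqF.
Qed.

Lemma void_prob n D : measurable D ->
  fine (P [set w | cnt (pts n w) D = 0%N]) = (1 - fine (mu D)) ^+ n.
Proof.
move=> mD; have -> : 1 - fine (mu D) = fine (mu (~` D)).
  by rewrite probability_setC// fineB// fin_num_measure.
have := X_iid (J := iota 0 n) (D := fun=> ~` D) (iota_uniq _ _) (fun=> measurableC mD).
have -> : \bigcap_(j in [set` iota 0 n]) X j @^-1` (~` D) =
    [set w | cnt (pts n w) D = 0%N].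
  apply/seteqP; split=> w /=.
    move=> h; apply/eqP; rewrite -leqn0 leqNgt -has_count; apply/negP => /hasP[y].
    by move=> /mapP[i /h Di ->] /set_mem.
  move=> /eqP; rewrite -leqn0 leqNgt -has_count => /hasPn h i /= ni Di.
  by have := h (X i w) (map_f _ ni); rewrite mem_set.
move=> ->; rewrite big_const_seq count_predT size_iota.
have iterE (x : R) m : iter m ( *%E x%:E) 1%E = (x ^+ m)%:E.
  by elim: m => [|m IH] //=; rewrite IH -EFinM exprS.
have [x muE] : exists x, mu (~` D) = x%:E.
  by exists (fine (mu (~` D))); rewrite fineK// fin_num_measure//; exact: measurableC.
by rewrite muE iterE.
Qed.

End occupancy.

(** * The mass of a hole *)

Section real_facts.
Context (R : realType).
Implicit Types (a b c e t u x : R).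

(** Supplies one small [t] that absorbs all the factors [1 + t] and [1 - t] accumulated in the
    estimates on holes. *)
Lemma near_slack m a b : 0 < a -> a < b -> exists t,
  [/\ 0 < t, t < 1 & (1 + t) ^+ m * a <= (1 - t) ^+ m * b].
Proof.
move=> a0 ab.
have c : (1 - t) ^+ m * b - (1 + t) ^+ m * a @[t --> 0^'+] -->
    (1 - 0) ^+ m * b - (1 + 0) ^+ m * a.
  apply: cvgB; apply: cvgMr_tmp.
    apply: (@cvg_comp _ _ _ _ (fun t : R => t ^+ m) _ (nbhs (1 - 0 : R))).
      by apply: cvgB; [exact: cvg_cst|exact: cvg_at_right_filter].
    exact: exprn_continuous.
  apply: (@cvg_comp _ _ _ _ (fun t : R => t ^+ m) _ (nbhs (1 + 0 : R))).
    by apply: cvgD; [exact: cvg_cst|exact: cvg_at_right_filter].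
  exact: exprn_continuous.
rewrite subr0 addr0 expr1n !mul1r in c.
near (0:R)^'+ => t; exists t; split; first by near: t; exact: nbhs_right_gt.
  by near: t; exact: nbhs_right_lt.
rewrite -subr_ge0; near: t; apply: (cvgr_ge _ c).
by rewrite subr_gt0.
Unshelve. all: by end_near. Qed.

Lemma exists_root m x : (0 < m)%N -> 0 < x -> exists2 r, 0 < r & r ^+ m = x.
Proof.
move=> m0 x0; exists (x `^ m%:R^-1); first exact: powR_gt0.
by rewrite -powR_mulrn ?powR_ge0// -powRrM mulVf ?powRr1 ?ltW// pnatr_eq0 -lt0n.
Qed.

Lemma near_ln_ge e : \forall n \near \oo, e <= ln (n%:R : R).
Proof.
near=> n; have n0 : (0 < n)%N by near: n; exact: nbhs_infty_gt.
rewrite -ler_expR lnK ?posrE ?ltr0n//.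
by near: n; exact: nbhs_infty_ger.
Unshelve. all: by end_near. Qed.

Lemma near_ln_div e : 0 < e -> \forall n \near \oo, ln (n%:R : R) / n%:R <= e.
Proof.
move=> e0; near=> n; have n0 : (0 < n)%N by near: n; exact: nbhs_infty_gt.
have n0' : 0 < n%:R :> R by rewrite ltr0n.
have e20 : 0 < e / 2 by rewrite divr_gt0.
rewrite ler_pdivrMr//.
have h : ln (e / 2 * n%:R) <= e / 2 * n%:R.
  by rewrite ltW// ln_sublinear// mulr_gt0.
rewrite lnM ?posrE// in h.
have : 2 / e * (- ln (e / 2)) <= n%:R by near: n; exact: nbhs_infty_ger.
have e2 : e / 2 * (2 / e) = 1 by field; rewrite gt_eqF.
rewrite -(@ler_pM2l _ (e / 2))// mulrA e2 mul1r.
lra.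
Unshelve. all: by end_near. Qed.

Lemma expR_ge_sqr u : 0 <= u -> u ^+ 2 / 4 <= expR u.
Proof.
move=> u0; have h := expR_ge1Dx (u / 2); have := expRD (u / 2) (u / 2).
have -> : u / 2 + u / 2 = u by field.
move=> ->; apply: (@le_trans _ _ ((u / 2) * (u / 2))); first by rewrite le_eqVlt; apply/orP; left; apply/eqP; field.
by apply: ler_pM; rewrite ?divr_ge0//; lra.
Qed.

Lemma expRN_mul_le c u : 0 < c -> 0 <= u -> expR (- (c * u)) * u <= c^-1.
Proof.
move=> c0 u0; rewrite expRN ler_pdivrMl ?expR_gt0// ler_pdivlMr//.
by rewrite mulrC (le_trans _ (expR_ge1Dx _))// lerDr.
Qed.

Lemma onem_le_expR u : 1 - u <= expR (- u).
Proof. exact: expR_ge1Dx. Qed.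

Lemma onem_ge_expR u : 0 <= u -> u < 1 -> expR (- (u / (1 - u))) <= 1 - u.
Proof.
move=> u0 u1; have u1' : 0 < 1 - u by rewrite subr_gt0.
rewrite expRN -[leRHS]invrK lef_pV2 ?posrE ?invr_gt0 ?expR_gt0//.
apply: le_trans (expR_ge1Dx _).
by rewrite le_eqVlt; apply/orP; left; apply/eqP; field; rewrite gt_eqF.
Qed.

End real_facts.

Section holes.
Context (dT : measure_display) (T : measurableType dT) (R : realType) (d : nat)
  (P : probability T R) (X : nat -> {mfun T >-> 'rV[R]_d}).
Hypothesis X_iid : forall (J : seq nat) (D : nat -> set 'rV[R]_d),
  uniq J -> (forall j, measurable (D j)) ->
  P (\bigcap_(j in [set` J]) X j @^-1` D j) = (\prod_(j <- J) law P X (D j))%E.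
Variables (B : set 'rV[R]_d) (k : nat) (f : 'rV[R]_d -> R) (f0 Cf K : R).
Hypotheses (d_gt0 : (0 < d)%N) (f0_gt0 : 0 < f0) (f_ge : forall x, B x -> f0 <= f x)
  (f_le : forall x, f x <= Cf) (K_gt0 : 0 < K)
  (B_bd : forall x, B x -> forall j, `|x ord0 j| <= K) (B_neq0 : B !=set0).
Local Notation mu D := (fine (law P X D)).
Local Notation vol r := (ball_vol R d * r ^+ d).
Local Notation lnd n := (ln n%:R / n%:R : R).
Hypothesis mass_oball : forall e, 0 < e -> e < f0 -> exists2 r0, 0 < r0 &
  forall x r, B x -> 0 < r -> r <= r0 ->
  (f x - e) * vol r <= mu (oball x r) <= (f x + e) * vol r.

(** Cube of side [2 * K / M] containing a point with coordinates in [[- K, K]]; the index [M] occurs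
    only for coordinates equal to [K], hence [M.+1] values. *)
Definition cell M (x : 'rV[R]_d) : {ffun 'I_d -> 'I_M.+1} :=
  [ffun j => inord (Num.truncn ((x ord0 j + K) / (2 * K) * M%:R))].

Lemma cell_close M x y : (0 < M)%N -> B x -> B y -> cell M x = cell M y ->
  enorm (x - y) <= d%:R * (2 * K / M%:R).
Proof.
move=> M0 Bx By /ffunP xy; apply: enorm_le_coord => j; rewrite !mxE.
have M0' : 0 < M%:R :> R by rewrite ltr0n.
have h z : B z -> 0 <= (z ord0 j + K) / (2 * K) * M%:R <= M%:R.
  move=> /B_bd/(_ j); rewrite ler_norml => /andP[h1 h2].
  have zK : 0 <= z ord0 j + K by lra.
  apply/andP; split; first by rewrite mulr_ge0 ?divr_ge0 ?mulr_ge0 ?(ltW K_gt0).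
  by rewrite -[leRHS]mul1r ler_pM2r// ler_pdivrMr ?mulr_gt0// mul1r; lra.
have g z : B z -> (Num.truncn ((z ord0 j + K) / (2 * K) * M%:R) < M.+1)%N.
  by move=> /h/andP[h1 h2]; rewrite ltnS -(@ler_nat R) (le_trans _ h2)// truncn_le.
have := xy j; rewrite !ffunE => /(congr1 val); rewrite /= !inordK ?g// => e.
have /andP[x1 _] := h x Bx; have /andP[y1 _] := h y By.
rewrite ler_pdivlMr// -[M%:R]gtr0_norm// -normrM.
have -> : (x ord0 j - y ord0 j) * M%:R = 2 * K * ((x ord0 j + K) / (2 * K) * M%:R -
    (y ord0 j + K) / (2 * K) * M%:R) by field; rewrite gt_eqF.
rewrite normrM (@gtr0_norm _ (2 * K)) ?mulr_gt0//; apply: ler_piMr.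
  by rewrite mulr_ge0 ?ltW.
have aux p (u v : R) : p%:R <= u < p.+1%:R -> p%:R <= v < p.+1%:R -> `|u - v| <= 1.
  by rewrite ler_norml -natr1; lra.
by have := truncn_itv x1; have := truncn_itv y1; rewrite e => a b; exact: aux b a.
Qed.

Lemma lnd_gt0 n : 0 < ln (n%:R : R) -> 0 < lnd n.
Proof.
move=> l0; rewrite divr_gt0// ltr0n; case: n l0 => //.
by rewrite ln0 ?ltxx.
Qed.

(** Holes are measured by mass and not by radius: the test radius [rg g] at the representative [g]
    of a cell is adapted to [f g], so that all test balls have mass about [al * lnd n]. Each of them
    has fewer than [k] points with probability [O(n^-(1 + e/2))], and there are [O(n / ln n)]
    cells. *)
Lemma upper_holes (e : R) : 0 < e -> exists2 C : R, 0 < C & \forall n \near \oo,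
  exists U : set T, [/\ measurable U, fine (P U) <= C * expR (- (e / 2 * ln n%:R)) &
    forall w x r, ~ U w -> B x -> 0 < r -> (cnt (pts X n w) (oball x r) < k)%N ->
      mu (oball x r) <= (1 + e) * lnd n].
Proof.
move=> e0.
(* The exponent suffices for both sides: [d] factors [1 + t] for enlarging a ball and one for the
   oscillation of [f]; one factor [1 - t] for that oscillation and one for the tail bound at
   [z = t]. *)
have [||t [t0 t1 slack]] := @near_slack R d.+2 (1 + e / 2) (1 + e); [lra|lra|].
have t1' : 0 < 1 - t by rewrite subr_gt0.
have tf : 0 < t * f0 by rewrite mulr_gt0.
have [|r0 r00 mass] := mass_oball tf; first by rewrite gtr_pMl.
have [b Bb] := B_neq0.
have Cf_gt0 : 0 < Cf by rewrite (lt_le_trans f0_gt0)// (le_trans (f_ge Bb)).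
have th0 := ball_vol_gt0 R d.
(* The division makes the exponent in the tail bound exactly [(1 + e / 2) * ln n]. *)
pose al := (1 + e / 2) / (1 - t) ^+ 2.
have al0 : 0 < al by rewrite divr_gt0 ?exprn_gt0//; lra.
have [|c1 c10 c1E] := @exists_root R d (al / (Cf * ball_vol R d)) d_gt0.
  by rewrite divr_gt0// mulr_gt0.
have [|c2 c20 c2E] := @exists_root R d (al / (f0 * ball_vol R d)) d_gt0.
  by rewrite divr_gt0// mulr_gt0.
(* With [M >= S / rho] cells per axis, two points of [B] in one cell are within
   [t / 2 * (c1 * rho)], and [c1 * rho] is below every test radius. *)
pose S := 4 * K * d%:R / (t * c1).
have S0 : 0 < S by rewrite divr_gt0 ?mulr_gt0 ?ltr0n.
exists ((S + 2) ^+ d * t^-1 ^+ k); first by rewrite mulr_gt0 ?exprn_gt0 ?invr_gt0//; lra.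
have r0c2 : 0 < r0 / (2 * c2) by rewrite divr_gt0// mulr_gt0.
near=> n.
have n0 : (0 < n)%N by near: n; exact: nbhs_infty_gt.
have n0' : 0 < n%:R :> R by rewrite ltr0n.
have ln1 : 1 <= ln (n%:R : R) by near: n; exact: near_ln_ge.
have Ln0 : 0 < lnd n by apply: lnd_gt0; exact: lt_le_trans ln1.
(* [rho] is the unit of length: since [f] lies between [f0] and [Cf] on [B], all test radii lie
   between [c1 * rho] and [c2 * rho]. *)
have [rho rho0 rhoE] := exists_root d_gt0 Ln0.
have le_root (a c : R) : 0 <= a -> 0 <= c -> a ^+ d <= c ^+ d -> a <= c.
  by move=> a0 c0; rewrite ler_pXn2r.
have alL : 0 < al * lnd n by apply: mulr_gt0.
have crho c : 0 < c -> 0 <= c * rho by move=> c0; rewrite mulr_ge0 ?ltW.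
have rho1 : rho <= 1.
  apply: (le_root); rewrite ?(ltW rho0)// rhoE expr1n.
  by near: n; exact: near_ln_div.
have rho2 : rho <= r0 / (2 * c2).
  apply: (le_root); rewrite ?(ltW rho0) ?(ltW r0c2)// rhoE.
  by near: n; apply: near_ln_div; exact: exprn_gt0.
have /choice[rg rgP] : forall g, exists r, B g ->
    [/\ 0 < r, r ^+ d = al * lnd n / (f g * ball_vol R d), c1 * rho <= r & r <= c2 * rho].
  move=> g; have [Bg|nBg] := pselect (B g); last by exists 0.
  have fg0 : 0 < f g by rewrite (lt_le_trans f0_gt0)// f_ge.
  have [|r r_gt0 rE] := @exists_root R d (al * lnd n / (f g * ball_vol R d)) d_gt0.
    by apply: divr_gt0; apply: mulr_gt0.
  exists r => _; split => //.
  - apply: (le_root); rewrite ?crho ?(ltW r_gt0)// exprMn rE c1E rhoE.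
    rewrite [leLHS]mulrAC ler_pM2l//.
    by rewrite lef_pV2 ?posrE ?mulr_gt0// ler_pM2r// f_le.
  - apply: (le_root); rewrite ?crho ?(ltW r_gt0)// exprMn rE c2E rhoE.
    rewrite [leRHS]mulrAC ler_pM2l//.
    by rewrite lef_pV2 ?posrE ?mulr_gt0// ler_pM2r// f_ge.
have rg_r0 g : B g -> (1 + t) * rg g <= r0.
  move=> Bg; have [h1 h2 h3 h4] := rgP g Bg.
  have -> : r0 = 2 * (c2 * (r0 / (2 * c2))) by field; rewrite gt_eqF.
  apply: ler_pM; [lra|exact: ltW|lra|].
  by rewrite (le_trans h4)// ler_wpM2l// ltW.
pose v g := al * lnd n / f g.
have fg0 g : B g -> 0 < f g by move=> Bg; rewrite (lt_le_trans f0_gt0)// f_ge.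
have v0 g : B g -> 0 <= v g by move=> Bg; apply: divr_ge0; apply: ltW => //; exact: fg0.
have alv g : B g -> al * lnd n = f g * v g.
  by move=> Bg; rewrite /v; field; rewrite !gt_eqF// fg0.
have volE g : B g -> vol (rg g) = v g.
  move=> Bg; have [_ -> _ _] := rgP g Bg; rewrite /v; field.
  by rewrite !gt_eqF// fg0.
have lower g : B g -> (1 - t) * (al * lnd n) <= mu (oball g (rg g)).
  move=> Bg; have [h1 h2 h3 h4] := rgP g Bg.
  have rr : rg g <= r0.
    by apply: le_trans (rg_r0 g Bg); rewrite mulrDl mul1r lerDl mulr_ge0 ?ltW.
  have /andP[+ _] := mass g _ Bg h1 rr; apply: le_trans.
  rewrite volE// (alv g Bg) mulrA ler_wpM2r ?v0//.
  by rewrite mulrBl mul1r lerB// ler_pM2l// f_ge.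
have alU : (1 + t) ^+ d.+1 * al <= 1 + e.
  rewrite /al mulrA ler_pdivrMr ?exprn_gt0//.
  apply: (@le_trans _ _ ((1 + t) ^+ d.+2 * (1 + e / 2))).
    rewrite ler_wpM2r//; first lra.
    by rewrite [leRHS]exprS ler_peMl ?exprn_ge0//; lra.
  apply: le_trans slack _; rewrite [leRHS]mulrC ler_wpM2r//; first lra.
  by rewrite -addn2 exprD ler_piMl ?exprn_ge0// ?exprn_ile1// ?ltW//; lra.
have upper g : B g -> mu (oball g ((1 + t) * rg g)) <= (1 + e) * lnd n.
  move=> Bg; have [h1 h2 h3 h4] := rgP g Bg.
  have h5 : 0 < (1 + t) * rg g by rewrite mulr_gt0//; lra.
  have /andP[_ +] := mass g _ Bg h5 (rg_r0 g Bg); move=> /le_trans; apply.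
  rewrite exprMn [ball_vol R d * _]mulrCA volE//.
  apply: (@le_trans _ _ ((1 + t) ^+ d.+1 * (al * lnd n))); last first.
    by rewrite mulrA ler_wpM2r// ltW.
  rewrite (alv g Bg) exprSr -mulrA mulrCA ler_wpM2l ?exprn_ge0//; first lra.
  rewrite mulrA ler_wpM2r ?v0// mulrDl mul1r lerD2l ler_pM2l//.
  exact: f_ge.
pose M := (Num.truncn (S / rho)).+1.
have MS : S / rho <= M%:R by rewrite ltW// truncnS_gt.
have M0 : 0 < M%:R :> R by rewrite ltr0n.
have close x y : B x -> B y -> cell M x = cell M y -> enorm (x - y) <= t / 2 * rg y.
  move=> Bx By /(cell_close _ Bx By) => /(_ isT) /le_trans; apply.
  have [h1 h2 h3 h4] := rgP y By.
  apply: (@le_trans _ _ (t / 2 * (c1 * rho))); last by rewrite ler_wpM2l ?divr_ge0// ltW.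
  rewrite mulrA ler_pdivrMr//.
  apply: (@le_trans _ _ (t / 2 * (c1 * rho) * (S / rho))); last first.
    by rewrite ler_wpM2l// mulr_ge0 ?divr_ge0 ?mulr_ge0 ?ltW.
  rewrite le_eqVlt; apply/orP; left; apply/eqP; rewrite /S; field.
  by rewrite !gt_eqF.
(* Representatives are taken in [B], where the mass bounds hold; a cell that misses [B] gets the
   default [b]. *)
have /choice[rep repP] : forall c, exists g, B g /\
    forall x, B x -> cell M x = c -> cell M g = c.
  move=> c; have [[x Bx xc]|nx] := pselect (exists2 x, B x & cell M x = c).
    by exists x.
  by exists b; split => // x Bx xc; exfalso; apply: nx; exists x.
pose V c := [set w | (cnt (pts X n w) (oball (rep c) (rg (rep c))) < k)%N].
have mV c : measurable (V c).
  by apply: measurable_pts_cnt_lt; exact: measurable_oball.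
exists (\bigcup_c V c); split.
- by apply: fin_bigcup_measurable => // ; exact: finite_finset.
- apply: le_trans (prob_bigU P mV) _.
  have hV c : fine (P (V c)) <= t^-1 ^+ k * expR (- ((1 + e / 2) * ln n%:R)).
    have [Bg _] := repP c.
    apply: le_trans (binomial_tail X_iid n k (measurable_oball _ _) (_ : 0 < t <= 1)) _.
      by rewrite t0 ltW.
    rewrite ler_wpM2l ?exprn_ge0 ?invr_ge0// ?(ltW t0)//.
    have q1 : mu (oball (rep c) (rg (rep c))) <= 1 by apply: prob_le1; exact: measurable_oball.
    have q0 : 0 <= mu (oball (rep c) (rg (rep c))) by exact: prob_ge0.
    apply: (@le_trans _ _ (expR (- ((1 - t) * mu (oball (rep c) (rg (rep c))))) ^+ n)).
      rewrite lerXn2r ?nnegrE ?expR_ge0 ?onem_le_expR// subr_ge0.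
      by rewrite mulr_ile1//; lra.
    rewrite -expRM_natl ler_expR mulrN lerN2.
    have -> : (1 + e / 2) * ln n%:R = n%:R * ((1 - t) * ((1 - t) * (al * lnd n))).
      by rewrite /al; field; rewrite !gt_eqF.
    by rewrite !ler_wpM2l ?lower// ltW.
  apply: le_trans (ler_sum _ (fun c _ => hV c)) _.
  rewrite sumr_const card_ffun !card_ord -[leLHS]mulr_natl natrX.
  have hM : M.+1%:R <= (S + 2) / rho.
    rewrite -natr1 -[M]/(_.+1) -natr1 mulrDl.
    have : (Num.truncn (S / rho))%:R <= S / rho by rewrite truncn_le// divr_ge0// ltW.
    have : 1 <= rho^-1 by rewrite invf_ge1.
    by lra.
  apply: (@le_trans _ _ (((S + 2) / rho) ^+ d * (t^-1 ^+ k * expR (- ((1 + e / 2) * ln n%:R))))).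
    rewrite ler_wpM2r//; first by rewrite mulr_ge0 ?exprn_ge0 ?invr_ge0 ?expR_ge0// ltW.
    by rewrite lerXn2r ?nnegrE// divr_ge0 ?ltW//; lra.
  rewrite expr_div_n rhoE -!mulrA ler_wpM2l ?exprn_ge0//; first lra.
  rewrite mulrCA ler_wpM2l ?exprn_ge0 ?invr_ge0 ?(ltW t0)//.
  have -> : expR (- ((1 + e / 2) * ln n%:R)) = n%:R^-1 * expR (- (e / 2 * ln (n%:R : R))).
    by rewrite mulrDl mul1r opprD expRD (expRN (ln _)) lnK ?posrE.
  rewrite [in leRHS]mulrA [leLHS]mulrA -[leRHS]mul1r ler_wpM2r ?expR_ge0//.
  by rewrite invf_div mulrAC mulfV ?gt_eqF// mul1r invf_le1// (lt_le_trans ltr01).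
- move=> w x r nU Bx r_gt0 xk.
  have [Bg gc] := repP (cell M x); move: gc => /(_ x Bx erefl) gc.
  set g := rep (cell M x) in Bg gc *.
  have [h1 h2 h3 h4] := rgP g Bg.
  have xg := close x g Bx Bg (esym gc).
  (* Either the ball of the hole contains the test ball of its cell, which then has fewer than [k]
     points, or it is contained in that test ball enlarged by the factor [1 + t]. *)
  have [rr|rr] := leP (rg g + enorm (x - g)) r.
    exfalso; apply: nU; exists (cell M x) => //; rewrite /V/= -/g.
    apply: leq_ltn_trans xk; apply: sub_cnt => y; rewrite /oball/= => yg.
    by have := enorm_triangle y g x; rewrite (enormB g x); lra.
  apply: le_trans (upper g Bg); apply: prob_le; [exact: measurable_oball|exact: measurable_oball|].
  move=> y; rewrite /oball/= => yx.
  by have := enorm_triangle y x g; lra.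
Unshelve. all: by end_near. Qed.

End holes.

(** * Empty balls where the density is nearly least *)

Section empty_balls.
Context (dT : measure_display) (T : measurableType dT) (R : realType) (d : nat)
  (P : probability T R) (X : nat -> {mfun T >-> 'rV[R]_d}).
Hypothesis X_iid : forall (J : seq nat) (D : nat -> set 'rV[R]_d),
  uniq J -> (forall j, measurable (D j)) ->
  P (\bigcap_(j in [set` J]) X j @^-1` D j) = (\prod_(j <- J) law P X (D j))%E.
Variables (B : set 'rV[R]_d) (f : 'rV[R]_d -> R) (f0 : R).
Hypotheses (d_gt0 : (0 < d)%N) (f0_gt0 : 0 < f0) (f_ge : forall x, B x -> f0 <= f x)
  (f_near : forall e, 0 < e -> exists x s, [/\ 0 < s, oball x s `<=` B &
    forall y, oball x s y -> f y <= f0 + e]).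
Local Notation mu D := (fine (law P X D)).
Local Notation vol r := (ball_vol R d * r ^+ d).
Local Notation lnd n := (ln n%:R / n%:R : R).
Hypothesis mass_oball : forall e, 0 < e -> e < f0 -> exists2 r0, 0 < r0 &
  forall x r, B x -> 0 < r -> r <= r0 ->
  (f x - e) * vol r <= mu (oball x r) <= (f x + e) * vol r.

(** Each ball of the family is empty with probability at least [n^(e/4 - 1)], and their number is at
    least of order [n / ln n]; so the mean number of empty ones is at least of order [ln n], and
    [neg_correlated] bounds the probability that there is none by the inverse of this mean. *)
Lemma lower_holes (e : R) : 0 < e -> e < 1 -> exists2 C : R, 0 < C & \forall n \near \oo,
  exists U r, [/\ measurable U, fine (P U) <= C / ln n%:R, 0 < r,
    (forall x, B x -> (1 - e) * lnd n <= mu (oball x r)) &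
    forall w, ~ U w -> exists2 x, B x & cnt (pts X n w) (oball x r) = 0%N].
Proof.
move=> e0 e1.
have [||t [t0 t1 slack]] := @near_slack R 2 (1 - e) (1 - e / 2); [lra|lra|].
have t1' : 0 < 1 - t by rewrite subr_gt0.
have tf : 0 < t * f0 by rewrite mulr_gt0.
have [|r0 r00 mass] := mass_oball tf; first by rewrite gtr_pMl.
have [x0 [s [s0 sB fs]]] := f_near tf.
have th0 := ball_vol_gt0 R d.
(* With this volume, small balls centred in [B] have mass at least [(1 - e) * lnd n], while those
   where [f] is nearly least have mass at most [(1 - e / 2) * lnd n]. The remaining [e / 2] yields
   the power of [n]. *)
pose al := (1 - e) / (1 - t).
have al0 : 0 < al by rewrite divr_gt0//; lra.
have d0 : 0 < d%:R :> R by rewrite ltr0n.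
pose c := (s / (4 * d%:R)) ^+ d * (f0 * ball_vol R d) / al.
have c0 : 0 < c by apply: divr_gt0 => //; rewrite !mulr_gt0// exprn_gt0// divr_gt0// mulr_gt0.
have s40 : 0 < s / (4 * d%:R) by rewrite divr_gt0// mulr_gt0.
pose b := Num.min r0 (s / (4 * d%:R)).
have b0 : 0 < b by rewrite lt_min r00.
(* [64] comes from [expR u >= u ^+ 2 / 4] at [u = e / 4 * ln n], and [c] from the bound [c / lnd n]
   on the number of balls. *)
exists (64 / (c * e ^+ 2)); first by rewrite divr_gt0// mulr_gt0// exprn_gt0.
have bd0 : 0 < b ^+ d * (f0 * ball_vol R d) / al.
  by apply: divr_gt0 => //; rewrite !mulr_gt0// exprn_gt0.
have e40 : 0 < e / 4 by rewrite divr_gt0.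
near=> n.
have n0 : (0 < n)%N by near: n; exact: nbhs_infty_gt.
have n0' : 0 < n%:R :> R by rewrite ltr0n.
have ln1 : 1 <= ln (n%:R : R) by near: n; exact: near_ln_ge.
have ln0 : 0 < ln (n%:R : R) by exact: lt_le_trans ln1.
have Ln0 : 0 < lnd n by exact: divr_gt0.
have [|r r_gt0 rE] := @exists_root R d (al * lnd n / (f0 * ball_vol R d)) d_gt0.
  by apply: divr_gt0; apply: mulr_gt0.
have rb : r <= b.
  rewrite -(@ler_pXn2r _ d)// ?nnegrE ?(ltW r_gt0) ?(ltW b0)// rE.
  rewrite ler_pdivrMr ?mulr_gt0// mulrC -ler_pdivlMr//.
  by near: n; exact: near_ln_div.
have [rr0 rs] : r <= r0 /\ r <= s / (4 * d%:R) by move: rb; rewrite le_min => /andP[].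
have volr : f0 * vol r = al * lnd n by rewrite rE; field; rewrite !gt_eqF.
(* Number of centres per axis, at spacing [2 * r]; the divisor [d] keeps all of them within
   Euclidean distance [s] of [x0]. *)
pose m := Num.truncn (s / (2 * r * d%:R)).
have rd0 : 0 < 2 * r * d%:R by rewrite !mulr_gt0.
have s2 : 2 <= s / (2 * r * d%:R).
  rewrite ler_pdivlMr//; move: rs; rewrite ler_pdivlMr ?mulr_gt0//; lra.
have mle : m%:R <= s / (2 * r * d%:R) by rewrite truncn_le// (le_trans _ s2).
have mge : s / (4 * d%:R) / r <= m%:R.
  have : s / (2 * r * d%:R) < m%:R + 1 by rewrite natr1 truncnS_gt.
  have -> : s / (4 * d%:R) / r = s / (2 * r * d%:R) / 2.
    by field; rewrite !gt_eqF.
  lra.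
pose y (l : {ffun 'I_d -> 'I_m}) : 'rV[R]_d := x0 + (2 * r) *: \row_j (l j)%:R.
have yB l : oball x0 s (y l).
  rewrite /oball/= /y addrC addKr.
  apply: (@le_lt_trans _ _ (d%:R * (2 * r * (m%:R - 1)))).
    apply: enorm_le_coord => j; rewrite !mxE ger0_norm; last by rewrite mulr_ge0// mulr_ge0// ltW.
    rewrite ler_pM2l ?mulr_gt0// lerBrDr natr1 ler_nat; exact: ltn_ord.
  have : m%:R * (2 * r * d%:R) <= s by rewrite -ler_pdivlMr.
  rewrite mulrBr mulr1 mulrBr; have := mulr_gt0 d0 (mulr_gt0 (ltr0n R 2) r_gt0).
  by lra.
have y_far l l' : l != l' -> 2 * r <= enorm (y l - y l').
  move=> ll'; have [j lj] : exists j, l j != l' j.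
    apply/existsP; rewrite -negb_forall; apply: contra ll' => /forallP h.
    by apply/eqP/ffunP => j; apply/eqP.
  apply: le_trans (coord_le_enorm _ j); rewrite /y !mxE opprD addrACA subrr add0r -mulrBr.
  rewrite normrM gtr0_norm ?mulr_gt0// ler_peMr//; first by rewrite mulr_ge0// ltW.
  have [h|h|h] := ltngtP (l j) (l' j); last by move: lj; rewrite -val_eqE /= h eqxx.
    rewrite distrC ger0_norm ?subr_ge0 ?ler_nat 1?ltnW// lerBrDr nat1r ler_nat//.
  by rewrite ger0_norm ?subr_ge0 ?ler_nat 1?ltnW// lerBrDr nat1r ler_nat.
pose E l := [set w | cnt (pts X n w) (oball (y l) r) = 0%N].
have mE l : measurable (E l).
  rewrite (_ : E l = [set w | (cnt (pts X n w) (oball (y l) r) < 1)%N]).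
    by apply: measurable_pts_cnt_lt; exact: measurable_oball.
  by apply/seteqP; split=> w; rewrite /E/= ltnS leqn0 => /eqP.
have mass_y l : mu (oball (y l) r) <= (1 - e / 2) * lnd n.
  have /andP[_ h] := mass (y l) r (sB _ (yB l)) r_gt0 rr0.
  apply: le_trans h _.
  have vol0 : 0 <= vol r by rewrite mulr_ge0 ?exprn_ge0 ?ltW.
  apply: (@le_trans _ _ ((1 + t) ^+ 2 * (f0 * vol r))).
    rewrite [leRHS]mulrA ler_wpM2r//.
    apply: (@le_trans _ _ ((1 + 2 * t) * f0)); first by have := fs _ (yB l); lra.
    by rewrite ler_pM2r//; have := sqr_ge0 t; lra.
  rewrite volr mulrA ler_wpM2r ?(ltW Ln0)// /al mulrA ler_pdivrMr//.
  apply: le_trans slack _; rewrite expr2 -mulrA [leRHS]mulrC ler_piMl ?mulr_ge0 ?(ltW t1')//; lra.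
have mo l : measurable (oball (y l) r) by exact: measurable_oball.
have PE l : n%:R^-1 * expR (e / 4 * ln n%:R) <= fine (P (E l)).
  rewrite /E (void_prob X_iid)//.
  pose q := (1 - e / 2) * lnd n.
  have q4 : q <= e / 4.
    apply: (@le_trans _ _ (lnd n)); first by rewrite ler_piMl ?(ltW Ln0)//; lra.
    by near: n; exact: near_ln_div.
  have q0 : 0 <= q by rewrite mulr_ge0 ?(ltW Ln0)//; lra.
  have q1 : 0 < 1 - q by lra.
  apply: (@le_trans _ _ ((1 - q) ^+ n)); last first.
    rewrite lerXn2r ?nnegrE ?(ltW q1) ?subr_ge0 ?prob_le1//.
    by rewrite lerD2l lerN2 mass_y.
  apply: (@le_trans _ _ (expR (- (q / (1 - q))) ^+ n)); last first.
    by rewrite lerXn2r ?nnegrE ?expR_ge0 ?(ltW q1)// onem_ge_expR//; lra.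
  rewrite -expRM_natl -[X in X^-1]lnK ?posrE// -expRN -expRD ler_expR.
  rewrite mulrN lerNr opprD opprK mulrA ler_pdivrMr//.
  have -> : n%:R * q = (1 - e / 2) * ln n%:R by rewrite /q; field; rewrite gt_eqF.
  apply: (@le_trans _ _ ((ln n%:R - e / 4 * ln n%:R) * (1 - e / 4))).
    have -> : (ln n%:R - e / 4 * ln n%:R) * (1 - e / 4) = ((1 - e / 4) * (1 - e / 4)) * ln (n%:R : R) by ring.
    by rewrite ler_wpM2r ?(ltW ln0)//; have := sqr_ge0 e; lra.
  rewrite ler_wpM2l//; last lra.
  have -> : ln n%:R - e / 4 * ln n%:R = (1 - e / 4) * ln (n%:R : R) by ring.
  by rewrite mulr_ge0 ?(ltW ln0)//; lra.
pose U := \bigcap_l ~` E l.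
have mU : measurable U.
  by rewrite /U -setC_bigcup; apply: measurableC; apply: fin_bigcup_measurable => //; exact: finite_finset.
exists U, r; split => //.
(* For disjoint balls of masses [a] and [b] this is [1 - a - b <= (1 - a) * (1 - b)], raised to the
   power [n]. *)
- have nc l l' : l != l' -> fine (P (E l `&` E l')) <= fine (P (E l)) * fine (P (E l')).
    move=> ll'; have disj : oball (y l) r `&` oball (y l') r = set0.
      apply/seteqP; split=> // z [/= z1 z2]; have := y_far _ _ ll'; rewrite leNgt => /negP; apply.
      apply: le_lt_trans (enorm_triangle _ z _) _; move: z1 z2; rewrite /oball/= (enormB z (y l)); lra.
    rewrite (_ : E l `&` E l' = [set w | cnt (pts X n w) (oball (y l) r `|` oball (y l') r) = 0%N]).
      rewrite /E !(void_prob X_iid)//; last exact: measurableU.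
      rewrite measureU// fineD ?fin_num_measure// -exprMn lerXn2r ?nnegrE//.
      + rewrite -fineD ?fin_num_measure// -measureU// subr_ge0 prob_le1//.
        exact: measurableU.
      + by rewrite mulr_ge0// subr_ge0 prob_le1.
      + have := mulr_ge0 (prob_ge0 (law P X) (oball (y l) r)) (prob_ge0 (law P X) (oball (y l') r)).
        lra.
    have c0E D w : (cnt (pts X n w) D = 0%N) <-> (forall z, z \in pts X n w -> ~ D z).
      split=> [/eqP|h]; first by rewrite -leqn0 leqNgt -has_count => /hasPn h z /h /negP zD /mem_set.
      by apply/eqP; rewrite -leqn0 leqNgt -has_count; apply/hasPn => z /h nD; apply/negP => /set_mem.
    apply/seteqP; split=> w; rewrite /E /=.
      by move=> [/c0E h1 /c0E h2]; apply/c0E => z zw [|]; [exact: h1|exact: h2].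
    by move=> /c0E h; split; apply/c0E => z /h nz zD; apply: nz; [left|right].
  have := neg_correlated mE nc; rewrite -/U.
  have : c * e ^+ 2 / 64 * ln n%:R <= \sum_l fine (P (E l)).
    apply: le_trans (ler_sum _ (fun l _ => PE l)).
    rewrite sumr_const card_ffun !card_ord -[leRHS]mulr_natl natrX.
    apply: (@le_trans _ _ ((s / (4 * d%:R) / r) ^+ d * (n%:R^-1 * ((e / 4 * ln n%:R) ^+ 2 / 4)))); last first.
      apply: ler_pM.
      + by rewrite exprn_ge0// divr_ge0 ?ltW.
      + by rewrite mulr_ge0 ?divr_ge0 ?sqr_ge0 ?invr_ge0 ?ltW.
      + by rewrite lerXn2r ?nnegrE// divr_ge0 ?ltW.
      + by rewrite ler_wpM2l ?invr_ge0 ?(ltW n0')// expR_ge_sqr// mulr_ge0 ?ltW.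
    rewrite expr_div_n rE /c le_eqVlt; apply/orP; left; apply/eqP; field.
    by rewrite !gt_eqF.
  set S := \sum_l _; move=> hS hU.
  have ce0 : 0 < c * e ^+ 2 / 64 * ln n%:R.
    by rewrite mulr_gt0// divr_gt0// mulr_gt0// exprn_gt0.
  have -> : 64 / (c * e ^+ 2) / ln n%:R = (c * e ^+ 2 / 64 * ln n%:R)^-1.
    by field; rewrite !gt_eqF.
  rewrite -[leRHS]mul1r ler_pdivlMr//; apply: le_trans hU.
  by rewrite mulrC ler_wpM2r ?prob_ge0.
- move=> x Bx; have /andP[h _] := mass x r Bx r_gt0 rr0; apply: le_trans h.
  apply: (@le_trans _ _ ((1 - t) * (f0 * vol r))).
    by rewrite volr /al mulrA [(1 - t) * _]mulrC mulfVK ?gt_eqF.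
  rewrite [leLHS]mulrA ler_wpM2r//; first by rewrite mulr_ge0 ?exprn_ge0 ?(ltW r_gt0) ?(ltW th0).
  by have := f_ge Bx; lra.
- move=> w nU; have [l El] : exists l, E l w.
    by apply: contrapT => nE; apply: nU => l _ El; apply: nE; exists l.
  by exists (y l) => //; exact: sB.
Unshelve. all: by end_near. Qed.

End empty_balls.

(** * Uniqueness of the hole *)

Section directions.
Context (R : realType) (d : nat).
Implicit Types (x y u : 'rV[R]_d).

(** Round a large multiple [Q%:R *: u]: the rounding error stays bounded while the positive products
    grow with [Q]. Integer directions are wanted because they are countable and map a grid to
    itself. *)
Lemma int_direction u (ys : seq 'rV[R]_d) : exists v : 'I_d -> int,
  forall y, y \in ys -> 0 < dot u y -> 0 < dot (\row_j (v j)%:~R) y.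
Proof.
have [Q HQ] : exists Q : nat, forall y, y \in ys -> 0 < dot u y ->
    d%:R * enorm y < Q%:R * dot u y.
  have : \forall Q \near \oo, forall y, y \in ys -> 0 < dot u y ->
      d%:R * enorm y < Q%:R * dot u y.
    apply: filter_all_seq => y.
    have [uy|uy] := ltP 0 (dot u y); last by exists 0%N => // Q _; rewrite ltNge uy.
    near=> Q => _; rewrite -ltr_pdivrMr//.
    by near: Q; exact: nbhs_infty_gtr.
  by move=> [Q _ /(_ Q (leqnn Q))] h; exists Q.
exists (fun j => Num.floor (Q%:R * u ord0 j)) => y ys0 uy.
pose w : 'rV[R]_d := \row_j (Num.floor (Q%:R * u ord0 j))%:~R.
have wu : enorm (Q%:R *: u - w) <= d%:R * 1.
  apply: enorm_le_coord => j; rewrite !mxE ger0_norm; last by rewrite subr_ge0 floor_le.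
  by have := floorD1_gt (Q%:R * u ord0 j); rewrite intrD => /ltW; rewrite lerBlDl.
have -> : dot (\row_j (Num.floor (Q%:R * u ord0 j))%:~R) y =
    Q%:R * dot u y - dot (Q%:R *: u - w) y.
  by rewrite dotDl dotNl dotZl opprB addrCA subrr addr0.
rewrite subr_gt0; apply: le_lt_trans (HQ y ys0 uy).
rewrite (le_trans (cauchy_schwarz _ _))// ler_wpM2r ?enorm_ge0//.
by rewrite (le_trans wu)// mulr1.
Unshelve. all: by end_near. Qed.

Lemma dot_line z u t : dot (z + t *: u) (z + t *: u) =
  dot z z + t * (2 * dot u z) + t * (t * dot u u).
Proof. by rewrite !(dotDl, dotDr, dotZl, dotZr) (dotC z u); ring. Qed.

Lemma near_inv_le (b : R) : 0 < b -> \forall m \near \oo, m.+1%:R^-1 <= b.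
Proof.
move=> b0; have [n _ hn] := @near_infty_natSinv_lt R (PosNum b0).
by exists n => // m /hn /ltW.
Qed.

(* Moving [p] outwards from the sphere of centre [x] (inwards for the sphere of
   centre [y]), also when [p] lies on both: the bisecting direction [y - x]
   then serves both purposes. *)
Lemma separating_direction (x y p : 'rV[R]_d) r : 0 < r -> x != y ->
  exists u, (enorm (p - x) = r -> 0 < dot u (p - x)) /\
            (enorm (p - y) = r -> 0 < dot u (- (p - y))).
Proof.
move=> r0 xy; have pos z : enorm (p - z) = r -> 0 < dot (p - z) (p - z).
  by move=> pz; rewrite -sqr_enorm pz exprn_gt0.
have [px|px] := eqVneq (enorm (p - x)) r; last first.
  exists (- (p - y)); split => [h|/pos]; first by rewrite h eqxx in px.
  by rewrite dotNl dotNr opprK.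
have [py|py] := eqVneq (enorm (p - y)) r; last first.
  by exists (p - x); split => [/pos//|h]; rewrite h eqxx in py.
exists (y - x); have yx : 0 < dot (y - x) (y - x) by rewrite dot_gt0// subr_eq0 eq_sym.
have e : p - y = (p - x) - (y - x) by rewrite opprB addrA subrK.
have h : dot (p - y) (p - y) = dot (p - x) (p - x) by rewrite -!sqr_enorm px py.
move: h yx; rewrite {}e; move: (p - x) (y - x) => a w h ww.
by split=> _; move: h; rewrite !(dotDl, dotDr, dotNl, dotNr) (dotC a w); lra.
Qed.

(** The same [m] limits the length of the move and gives the rate of growth, so that one natural
    number indexes both. On the sphere the growth comes from the positive derivative
    [2 * dot u (p - x)] of the squared distance; strictly outside, from the gap to the sphere. *)
Lemma sphere_growth (x p u : 'rV[R]_d) r : 0 < r -> r <= enorm (p - x) ->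
  (enorm (p - x) = r -> 0 < dot u (p - x)) ->
  \forall m \near \oo, forall t : R, 0 <= t -> t <= m.+1%:R^-1 ->
    r + t / m.+1%:R <= enorm (p + t *: u - x).
Proof.
move=> r0; rewrite le_eqVlt => /predU1P[rp|rp] hu.
  have a0 := hu (esym rp); set a := dot u _ in a0.
  have b0 : 0 < 2 * a / (2 * r + 1) by apply: divr_gt0; lra.
  near=> m => t t0 tm.
  have d0 : 0 < m.+1%:R^-1 :> R by rewrite invr_gt0.
  have d1 : m.+1%:R^-1 <= 1 :> R by rewrite invf_le1// ler1n.
  have : m.+1%:R^-1 <= 2 * a / (2 * r + 1).
    by near: m; exact: near_inv_le.
  rewrite ler_pdivlMr; last lra.
  move: (m.+1%:R^-1) d0 d1 tm => dl d0 d1 tm ra.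
  rewrite -ler_sqr ?nnegrE ?enorm_ge0//; last by rewrite addr_ge0 ?(ltW r0)// mulr_ge0// ltW.
  have -> : p + t *: u - x = (p - x) + t *: u by rewrite addrAC.
  rewrite sqr_enorm dot_line -sqr_enorm -rp -/a.
  have uu := dot_ge0 u.
  have h1 : 0 <= t * (t * dot u u) by rewrite !mulr_ge0.
  have h2 : t * dl ^+ 2 <= dl by rewrite expr2 mulrA ler_piMl ?(ltW d0)// mulr_ile1 ?(ltW d0)// (le_trans tm).
  have h3 : 0 <= t * (2 * a - 2 * r * dl - t * dl ^+ 2) by rewrite mulr_ge0//; lra.
  have -> : (r + t * dl) ^+ 2 = r ^+ 2 + t * (2 * a) - t * (2 * a - 2 * r * dl - t * dl ^+ 2) by ring.
  lra.
pose g := enorm (p - x) - r; have g0 : 0 < g by rewrite subr_gt0.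
have b0 : 0 < g / (enorm u + 1) by apply: divr_gt0 => //; have := enorm_ge0 u; lra.
near=> m => t t0 tm.
have d0 : 0 < m.+1%:R^-1 :> R by rewrite invr_gt0.
have d1 : m.+1%:R^-1 <= 1 :> R by rewrite invf_le1// ler1n.
have : m.+1%:R^-1 <= g / (enorm u + 1).
  by near: m; exact: near_inv_le.
have u0 := enorm_ge0 u; rewrite ler_pdivlMr; last lra.
move: (m.+1%:R^-1) d0 d1 tm => dl d0 d1 tm.
have h1 : t * (enorm u + 1) <= dl * (enorm u + 1) by rewrite ler_wpM2r//; lra.
have h2 : t * dl <= t by rewrite ler_piMr.
have := enorm_triangle (p - x) (- (t *: u)) 0.
rewrite !subr0 enormN enormZ ger0_norm// opprK addrAC.
have -> : p + t *: u - x = p - x + t *: u by rewrite addrAC.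
rewrite /g; lra.
Unshelve. all: by end_near. Qed.

End directions.

(** * Two holes make a corner *)

Section corners.
Context (R : realType) (d n k : nat) (B : set 'rV[R]_d).
Implicit Types (p q : 'I_n -> 'rV[R]_d) (v : {ffun 'I_n * 'I_d -> int}).

Definition conf p : seq 'rV[R]_d := [seq p i | i <- enum 'I_n].

Definition move p v (t : R) : 'I_n -> 'rV[R]_d :=
  fun i => p i + t *: \row_j (v (i, j))%:~R.

Lemma size_conf p : size (conf p) = n.
Proof. by rewrite size_map size_enum_ord. Qed.

Lemma thr_conf_lipschitz p q (e : R) : 0 < e -> (forall i, enorm (p i - q i) <= e) ->
  (thr B k (conf q) <= thr B k (conf p) + e%:E)%E.
Proof.
move=> e0 pq; apply: thr_lipschitz => // [|i]; first by rewrite !size_conf.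
rewrite size_conf => ni; rewrite /conf.
by rewrite !(nth_map (Ordinal ni)) -?enumT ?size_enum_ord.
Qed.

(* [p] is a quantitative strict local minimum of the threshold along the line
   of direction [v] *)
Definition corner v (m : nat) p := forall t : R, `|t| <= m.+1%:R^-1 ->
  (thr B k (conf p) + (`|t| / m.+1%:R)%:E <= thr B k (conf (move p v t)))%E.

(** [x] stays a hole at a growing scale: no point at distance at least [r] from [x] enters the
    growing ball, and the points already inside can change the count only by leaving. *)
Lemma half_corner p (x : 'rV[R]_d) v r : B x -> 0 < r ->
  (cnt (conf p) (oball x r) < k)%N ->
  (forall i, enorm (p i - x) = r -> 0 < dot (\row_j (v (i, j))%:~R) (p i - x)) ->
  \forall m \near \oo, forall t : R, 0 <= t -> t <= m.+1%:R^-1 ->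
    ((r + t / m.+1%:R)%:E <= thr B k (conf (move p v t)))%E.
Proof.
move=> Bx r0 xk hv.
have : \forall m \near \oo, forall i, i \in enum 'I_n -> r <= enorm (p i - x) ->
    forall t : R, 0 <= t -> t <= m.+1%:R^-1 ->
    r + t / m.+1%:R <= enorm (move p v t i - x).
  apply: filter_all_seq => i.
  have [rp|rp] := leP r (enorm (p i - x)); last by exists 0%N.
  have := sphere_growth r0 rp (hv i).
  by apply: filterS => m h _; exact: h.
apply: filterS => m h t t0 tm; apply: (thr_ge Bx); apply: leq_ltn_trans xk.
rewrite /cnt !count_map; apply: sub_count => i /= /set_mem.
rewrite /oball/= => h1; apply: mem_set; rewrite /oball/= ltNge; apply/negP => h2.
by have := h i (mem_enum _ i) h2 t t0 tm; rewrite leNgt h1.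
Qed.

(** Along one line, the points on the sphere of [x] move away from [x] for [t >= 0], and those on
    the sphere of [y] move away from [y] for [t < 0]. The hole [x] bounds the threshold from below
    on the first half of the line, and [y] on the other. *)
Lemma corner_exists p (x y : 'rV[R]_d) r : 0 < r -> thr B k (conf p) = r%:E ->
  x != y -> B x -> B y ->
  (cnt (conf p) (oball x r) < k)%N -> (cnt (conf p) (oball y r) < k)%N ->
  exists v m, corner v m p.
Proof.
move=> r0 pr xy Bx By xk yk.
have /choice[u hu] : forall i, exists v : 'I_d -> int,
    (enorm (p i - x) = r -> 0 < dot (\row_j (v j)%:~R) (p i - x)) /\
    (enorm (p i - y) = r -> 0 < dot (\row_j (v j)%:~R) (- (p i - y))).
  move=> i; have [u [ux uy]] := separating_direction (p i) r0 xy.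
  have [v hv] := int_direction u [:: p i - x; - (p i - y)].
  by exists v; split => [/ux|/uy]; apply: hv; rewrite !inE eqxx ?orbT.
pose v : {ffun 'I_n * 'I_d -> int} := [ffun ij => u ij.1 ij.2].
pose v' : {ffun 'I_n * 'I_d -> int} := [ffun ij => - u ij.1 ij.2].
have vE i : \row_j (v (i, j))%:~R = \row_j (u i j)%:~R :> 'rV[R]_d.
  by apply/rowP => j; rewrite !mxE ffunE.
have v'E i : \row_j (v' (i, j))%:~R = - \row_j (u i j)%:~R :> 'rV[R]_d.
  by apply/rowP => j; rewrite !mxE ffunE/= mulrNz.
have hx := @half_corner p x v r Bx r0 xk.
have hy := @half_corner p y v' r By r0 yk.
have {}hx := hx (fun i h => ltac:(rewrite vE; exact: (proj1 (hu i) h))).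
have {}hy := hy (fun i h => ltac:(rewrite v'E dotNl -dotNr; exact: (proj2 (hu i) h))).
have [m _ hm] := filterI hx hy.
have {hm} [hmx hmy] := hm m (leqnn m).
exists v, m => t tm; rewrite pr -EFinD.
have [t0|t0] := leP 0 t; first by rewrite ger0_norm//; apply: hmx => //; rewrite -(ger0_norm t0).
rewrite ltr0_norm// in tm *.
have -> : move p v t = move p v' (- t).
  by apply/funext => i; rewrite /move v'E vE scalerN scaleNr opprK.
by apply: hmy => //; rewrite oppr_ge0 ltW.
Qed.

(** Going from [p] to near [q] raises the threshold by [t / m.+1] up to an error [e], and so does
    going back; the sum gives [2 * (t / m.+1) <= 2 * e]. *)
Lemma corner_unique p q v m (t e : R) : 0 < e ->
  thr B k (conf p) \is a fin_num -> thr B k (conf q) \is a fin_num ->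
  corner v m p -> corner v m q ->
  0 <= t -> t <= m.+1%:R^-1 ->
  (forall i, enorm (q i - move p v t i) <= e) -> t / m.+1%:R <= e.
Proof.
move=> e0 + + cp cq t0 tm qp.
have {}cp := cp t; have {}cq := cq (- t).
rewrite normrN ger0_norm// in cp cq; have {}cp := cp tm; have {}cq := cq tm.
have h1 : (thr B k (conf (move p v t)) <= thr B k (conf q) + e%:E)%E.
  exact: thr_conf_lipschitz.
have h2 : (thr B k (conf (move q v (- t))) <= thr B k (conf p) + e%:E)%E.
  apply: thr_conf_lipschitz => // i; rewrite enormB.
  by have := qp i; rewrite /move scaleNr opprD addrA addrAC.
have {cp}h1 := le_trans cp h1; have {cq}h2 := le_trans cq h2.
move: h1 h2; case: (thr B k (conf p)) => [a||]//; case: (thr B k (conf q)) => [b||]// h1 h2 _ _.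
by move: h1 h2; rewrite -!EFinD !lee_fin; move: (t / _) => c; lra.
Qed.

End corners.

(** * Corners form a null set *)

Section corner_null.
Context (dT : measure_display) (T : measurableType dT) (R : realType) (d : nat)
  (P : probability T R) (X : nat -> {mfun T >-> 'rV[R]_d}).
Hypothesis X_iid : forall (J : seq nat) (D : nat -> set 'rV[R]_d),
  uniq J -> (forall j, measurable (D j)) ->
  P (\bigcap_(j in [set` J]) X j @^-1` D j) = (\prod_(j <- J) law P X (D j))%E.
Variables (B : set 'rV[R]_d) (k n K : nat) (C : R).
Local Notation mu D := (fine (law P X D)).
Hypotheses (d_gt0 : (0 < d)%N) (C_gt0 : 0 < C).
Hypothesis mass_cube : forall (a : 'I_d -> R) h, 0 < h ->
  mu (box a (fun j => a j + h)) <= C * h ^+ d.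
Hypothesis thr_fin_num : forall p : 'I_n -> 'rV[R]_d, thr B k (conf p) \is a fin_num.
Variables (v : {ffun 'I_n * 'I_d -> int}) (m : nat).

Definition in_range (p : 'I_n -> 'rV[R]_d) := forall i j, `|p i ord0 j| <= K%:R.

Section grid.
Variable N : nat.
Hypothesis N_gt0 : (0 < N)%N.

(** Cells have side [1 / q]. A shift by [a] cells is just too long for [corner_unique] when the
    error is [d / q], the bound for points known up to a cell; fewer than [N] such shifts stay
    within the range [1 / m.+1] of a corner. [V] bounds the direction; [D1] and [D2] count cells
    along the range and along the range widened by all the shifts. *)
Let a := (d * m.+1).+1.
Let q := (N * a * m.+1)%N.
Let V := \max_(ij : 'I_n * 'I_d) `|v ij|%N.
Let D1 := (2 * K * q)%N.
Let D2 := ((2 * K + 2 * V) * q)%N.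

Let q0 : 0 < q%:R :> R.
Proof. by rewrite ltr0n !muln_gt0 N_gt0. Qed.

Let cellp (p : 'I_n -> 'rV[R]_d) : {ffun 'I_n * 'I_d -> 'I_D1.+1} :=
  [ffun ij => inord (Num.truncn (q%:R * (p ij.1 ord0 ij.2 + K%:R)))].

Let cellpP p i j : in_range p ->
  (cellp p (i, j))%:R <= q%:R * (p i ord0 j + K%:R) < (cellp p (i, j)).+1%:R.
Proof.
move=> rp; have := rp i j; rewrite ler_norml => /andP[h1 h2].
have h0 : 0 <= q%:R * (p i ord0 j + K%:R) by rewrite mulr_ge0 ?(ltW q0)//; lra.
rewrite ffunE/= inordK; first exact: truncn_itv.
rewrite ltnS -(@ler_nat R) (@le_trans _ _ (q%:R * (p i ord0 j + K%:R))) ?truncn_le//.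
rewrite /D1 natrM mulrC ler_pM2r// natrM; lra.
Qed.

Let bad : {set {ffun 'I_n * 'I_d -> 'I_D1.+1}} :=
  [set c | `[< exists p, [/\ in_range p, corner k B v m p & cellp p = c] >]].

(* The union of the bad cells is disjoint from its translates by multiples of
   [a] along [v]; [N] disjoint translates fit in a region of bounded size, so
   that the bad cells fill a proportion [O(1 / N)] of it. *)
Let no_shift (c c' : {ffun 'I_n * 'I_d -> 'I_D1.+1}) (s : nat) : c \in bad -> c' \in bad ->
  (0 < s < N)%N -> ~ forall ij, (c ij)%:Z = (c' ij)%:Z + (s * a)%:Z * v ij.
Proof.
move=> cb cb' /andP[s0 sN] h.
have := cb; rewrite inE => /asboolP[p [rp cp pc]].
have := cb'; rewrite inE => /asboolP[p' [rp' cp' pc']].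
pose t : R := (s * a)%:R / q%:R.
have t0 : 0 <= t by rewrite divr_ge0.
have tm : t <= m.+1%:R^-1.
  rewrite ler_pdivrMr// ler_pdivlMl// -natrM ler_nat /q mulnC leq_mul2r.
  by rewrite leq_mul2r ltnW ?orbT.
have e0 : 0 < d%:R / q%:R :> R by rewrite divr_gt0// ltr0n.
have pp' : forall i, enorm (p i - move p' v t i) <= d%:R / q%:R.
  move=> i; apply: enorm_le_coord => j; rewrite !mxE.
  rewrite -[X in _ <= X]mul1r -[q%:R in X in _ <= X]gtr0_norm// ler_pdivlMr ?normr_gt0 ?gt_eqF// -normrM.
  have := cellpP i j rp; have := cellpP i j rp'; rewrite pc pc' => /andP[b1 b2] /andP[b3 b4].
  have hc : (c (i, j))%:R = (c' (i, j))%:R + (s * a)%:R * (v (i, j))%:~R :> R.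
    by have := congr1 (fun z : int => z%:~R : R) (h (i, j)); rewrite intrD intrM !pmulrn.
  have -> : (p i ord0 j - (p' i ord0 j + t * (v (i, j))%:~R)) * q%:R =
     q%:R * (p i ord0 j + K%:R) - q%:R * (p' i ord0 j + K%:R) - (s * a)%:R * (v (i, j))%:~R.
    by rewrite /t; field; rewrite gt_eqF.
  move: b1 b2 b3 b4; rewrite -!natr1 hc ler_norml; lra.
have := corner_unique e0 (thr_fin_num p') (thr_fin_num p) cp' cp t0 tm pp'.
rewrite /t ler_pdivrMr// mulrAC ler_pM2r ?invr_gt0// -natrM ler_nat leqNgt => /negP; apply.
by rewrite /a (leq_trans (ltnSn _))// leq_pmull.
Qed.

(** The offset [q * V] keeps the shifted indices nonnegative and at most [D2], so that neither
    [absz] nor [inord] alters them. *)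
Let shift (jc : 'I_N * {ffun 'I_n * 'I_d -> 'I_D1.+1}) : {ffun 'I_n * 'I_d -> 'I_D2.+1} :=
  [ffun ij => inord (absz ((jc.2 ij)%:Z + (jc.1 * a)%:Z * v ij + (q * V)%:Z))].

Let shiftE (j : 'I_N) (c : {ffun 'I_n * 'I_d -> 'I_D1.+1}) ij :
  (shift (j, c) ij)%:Z = (c ij)%:Z + (j * a)%:Z * v ij + (q * V)%:Z.
Proof.
have vV : (`|v ij| <= V)%N by exact: (leq_bigmax_cond (F := fun ij => `|v ij|%N)).
have jN := ltn_ord j.
have h1 : (j * a * `|v ij| <= q * V)%N.
  apply: leq_mul => //; rewrite /q -[(j * a)%N]muln1 leq_mul// leq_mul// ltnW//.
have aux (p : int) (w x y : nat) : (`|p| <= y)%N -> (w < x.+1)%N ->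
    (absz (w%:Z + p + y%:Z)%R < (x + 2 * y).+1)%N /\
    (absz (w%:Z + p + y%:Z))%:Z = w%:Z + p + y%:Z by lia.
have h2 : (absz ((j * a)%N%:Z * v ij)%R <= q * V)%N by rewrite abszM.
have [h3 h4] := aux _ _ _ _ h2 (ltn_ord (c ij)).
rewrite ffunE /= inordK//; move: h3; congr (_ < _.+1)%N.
by rewrite /D1 /D2 mulnDl -(mulnA 2 V) (mulnC V).
Qed.

Let shift_inj : {in finset.setX [set: 'I_N]%SET bad &, injective shift}.
Proof.
move=> [j c] [j' c']; rewrite !inE /= => cb cb' e.
have h ij : (c ij)%:Z + (j * a)%:Z * v ij = (c' ij)%:Z + (j' * a)%:Z * v ij.
  by have := shiftE j c ij; rewrite e shiftE => /addIr.
have [jj|jj|jj] := ltngtP j j'.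
- exfalso; apply: (@no_shift c c' (j' - j)%N); rewrite ?inE//.
    by rewrite subn_gt0 jj (leq_ltn_trans (leq_subr _ _)).
  move=> ij; have := h ij; rewrite mulnBl -subzn ?leq_mul2r 1?ltnW ?orbT// mulrBl.
  by move=> hij; rewrite addrA -hij addrK.
- exfalso; apply: (@no_shift c' c (j - j')%N); rewrite ?inE//.
    by rewrite subn_gt0 jj (leq_ltn_trans (leq_subr _ _)).
  move=> ij; have := h ij; rewrite mulnBl -subzn ?leq_mul2r 1?ltnW ?orbT// mulrBl.
  by move=> hij; rewrite addrA hij addrK.
- have {}jj : j = j' by exact: val_inj.
  rewrite jj; congr (_, _); apply/ffunP => ij; apply: val_inj.
  by have := h ij; rewrite jj => /addIr[].
Qed.

Let card_bad : (N * #|bad| <= D2.+1 ^ (n * d))%N.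
Proof.
rewrite -[N in (N * _)%N]card_ord -cardsT -cardsX -(card_in_imset shift_inj).
by rewrite (leq_trans (max_card _))// card_ffun card_prod !card_ord.
Qed.

Let cbox (c : {ffun 'I_n * 'I_d -> 'I_D1.+1}) (i : 'I_n) : set 'rV[R]_d :=
  box (fun j => (c (i, j))%:R / q%:R - K%:R) (fun j => (c (i, j))%:R / q%:R - K%:R + q%:R^-1).

Let U := \bigcup_(c : {ffun 'I_n * 'I_d -> 'I_D1.+1})
  if c \in bad then sampl X (fun i : 'I_n => val i) @^-1` rect (cbox c) else set0.

Let mE c : measurable (if c \in bad then sampl X (fun i : 'I_n => val i) @^-1` rect (cbox c) else set0).
Proof.
case: ifP => // _; rewrite -[X in measurable X]setTI; apply: measurable_sampl => //.
by apply: measurable_rect => i; exact: measurable_box.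
Qed.

(** There are at most [D2.+1 ^ (n * d) / N] bad cells, each of probability at most
    [(C / q ^ d) ^ n]. As [D2] is proportional to [q], the powers of [q] cancel and [1 / N] is
    left. *)
Lemma corner_cover : exists U : set T, [/\ measurable U,
  fine (P U) <= (2 * K + 2 * V).+1%:R ^+ (n * d) * C ^+ n / N%:R &
  forall w, in_range (fun i => X i w) -> corner k B v m (fun i => X i w) -> U w].
Proof.
exists U; split.
- by apply: fin_bigcup_measurable => // ; exact: finite_finset.
- apply: le_trans (prob_bigU P mE) _.
  rewrite (bigID (fun c => c \in bad))/= [X in _ + X]big1 ?addr0; last first.
    by move=> c /negbTE ->; rewrite measure0.
  apply: (@le_trans _ _ (\sum_(c in bad) (C * q%:R^-1 ^+ d) ^+ n)).
    apply: ler_sum => c ->; rewrite (sampl_rect X_iid) => [||i].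
    - have -> : (C * q%:R^-1 ^+ d) ^+ n = \prod_(i < n) (C * q%:R^-1 ^+ d).
        by rewrite prodr_const card_ord.
      rewrite (eq_bigr (fun i => (mu (cbox c i))%:E)) => [|i _]; last first.
        by rewrite fineK// fin_num_measure//; exact: measurable_box.
      rewrite prodEFin/=; apply: ler_prod => i _; rewrite prob_ge0/=.
      by apply: mass_cube; rewrite invr_gt0.
    - exact: val_inj.
    - exact: measurable_box.
  rewrite sumr_const -[leLHS]mulr_natl ler_pdivlMr ?ltr0n//.
  have hb : N%:R * #|bad|%:R <= (D2.+1 ^ (n * d))%:R :> R by rewrite -natrM ler_nat card_bad.
  rewrite mulrAC [_ * N%:R]mulrC; apply: le_trans (ler_wpM2r _ hb) _.
    by rewrite exprn_ge0// mulr_ge0 ?(ltW C_gt0)// exprn_ge0// invr_ge0.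
  rewrite exprMn mulrCA [leRHS]mulrC ler_wpM2l ?exprn_ge0 ?(ltW C_gt0)//.
  rewrite natrX -exprM mulnC exprVn ler_pdivrMr ?exprn_gt0// -exprMn.
  rewrite lerXn2r ?nnegrE ?mulr_ge0// -natrM ler_nat mulSn /D2 -addn1 addnC leq_add2r.
  by rewrite -(ltr0n R).
- move=> w rw cw; exists (cellp (fun i => X i w)) => //.
  have -> : cellp (fun i => X i w) \in bad.
    by rewrite inE; apply/asboolP; exists (fun i => X i w).
  move=> i j; rewrite tnth_mktuple.
  have /andP[h1 h2] := cellpP i j rw.
  set c := cellp _ _ in h1 h2 *.
  have h3 : c%:R / q%:R <= X i w ord0 j + K%:R by rewrite ler_pdivrMr// mulrC.
  have h4 : X i w ord0 j + K%:R <= c%:R / q%:R + q%:R^-1.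
    have -> : c%:R / q%:R + q%:R^-1 = (c.+1%:R) / q%:R :> R by rewrite -natr1 mulrDl mul1r.
    by rewrite ler_pdivlMr// mulrC ltW.
  by move: h3 h4; rewrite -/c; lra.
Qed.

End grid.
End corner_null.

Section negligible_facts.
Context (dT : measure_display) (T : measurableType dT) (R : realType) (P : probability T R).

Lemma negligible_small (Z : set T) :
  (forall e : R, 0 < e -> exists U, [/\ measurable U, fine (P U) <= e & Z `<=` U]) ->
  P.-negligible Z.
Proof.
move=> h; have /choice[U hU] : forall n : nat, exists U : set T,
    [/\ measurable U, fine (P U) <= n.+1%:R^-1 & Z `<=` U].
  by move=> n; apply: h; rewrite invr_gt0.
have mU : measurable (\bigcap_n U n) by apply: bigcapT_measurable => n; have [] := hU n.
exists (\bigcap_n U n); split => //; last by move=> w Zw n _; have [_ _] := hU n; exact.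
have : fine (P (\bigcap_n U n)) <= 0.
  apply/ler_addgt0Pr => e e0; rewrite add0r.
  have [n _ hn] := @near_infty_natSinv_lt R (PosNum e0).
  apply: le_trans (ltW (hn n (leqnn n))); have [mUn PUn _] := hU n.
  apply: le_trans PUn; apply: prob_le => //.
  exact: bigcap_inf.
move=> h0; have : fine (P (\bigcap_n U n)) = 0.
  by apply/eqP; rewrite eq_le h0 prob_ge0.
by move=> h1; rewrite -[LHS]fineK ?fin_num_measure// h1.
Qed.

Lemma negligible_countable (I : countType) (Z : I -> set T) :
  (forall i, P.-negligible (Z i)) -> P.-negligible (\bigcup_i Z i).
Proof.
move=> h; pose F n := if unpickle n is Some i then Z i else set0.
apply: (negligibleS (A := \bigcup_n F n)).
  by move=> w [i _ Zw]; exists (pickle i) => //; rewrite /F pickleK.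
apply: negligible_bigcup => n; rewrite /F; case: unpickle => // .
exact: negligible_set0.
Qed.

End negligible_facts.

Section unique_witness.
Context (dT : measure_display) (T : measurableType dT) (R : realType) (d : nat)
  (P : probability T R) (X : nat -> {mfun T >-> 'rV[R]_d}).
Hypothesis X_iid : forall (J : seq nat) (D : nat -> set 'rV[R]_d),
  uniq J -> (forall j, measurable (D j)) ->
  P (\bigcap_(j in [set` J]) X j @^-1` D j) = (\prod_(j <- J) law P X (D j))%E.
Variables (B : set 'rV[R]_d) (k n K : nat) (C : R).
Local Notation mu D := (fine (law P X D)).
Hypotheses (d_gt0 : (0 < d)%N) (C_gt0 : 0 < C).
Hypothesis mass_cube : forall (a : 'I_d -> R) h, 0 < h ->
  mu (box a (fun j => a j + h)) <= C * h ^+ d.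
Hypothesis mass_range : law P X (~` box (fun=> - K%:R) (fun=> K%:R)) = 0%E.

Lemma marginal i D : measurable D -> P (X i @^-1` D) = law P X D.
Proof.
move=> mD; have := X_iid (J := [:: i]) (D := fun=> D) isT (fun=> mD).
rewrite big_seq1 => <-; congr (P _); apply/seteqP; split => w /=.
  by move=> Dw j /=; rewrite inE => /eqP ->.
by move=> h; apply: (h i) => /=; rewrite inE.
Qed.

Lemma pts_conf w : pts X n w = conf (fun i : 'I_n => X i w).
Proof. by rewrite /pts /conf -val_enum_ord -map_comp. Qed.

Hypothesis thr_fin_num : forall p : 'I_n -> 'rV[R]_d, thr B k (conf p) \is a fin_num.

Lemma negligible_corner (v : {ffun 'I_n * 'I_d -> int}) m : P.-negligible
  [set w | in_range K (fun i : 'I_n => X i w) /\ corner k B v m (fun i => X i w)].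
Proof.
apply: negligible_small => e e0.
pose V := \max_(ij : 'I_n * 'I_d) `|v ij|%N.
pose c : R := (2 * K + 2 * V).+1%:R ^+ (n * d) * C ^+ n.
have c0 : 0 < c by rewrite mulr_gt0// exprn_gt0.
have [N N0 cN] : exists2 N : nat, (0 < N)%N & c / N%:R <= e.
  exists (Num.truncn (c / e)).+1 => //; rewrite ler_pdivrMr// mulrC -ler_pdivrMr//.
  by rewrite ltW// truncnS_gt.
have [U [mU PU hU]] := corner_cover X_iid K d_gt0 C_gt0 mass_cube thr_fin_num v m N0.
exists U; split => //; first exact: le_trans PU cN.
by move=> w [rw cw]; exact: hU.
Qed.

Lemma negligible_out_of_range :
  P.-negligible [set w | ~ in_range K (fun i : 'I_n => X i w)].
Proof.
have mbox : measurable (~` box (fun=> - K%:R) (fun=> K%:R) : set 'rV[R]_d).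
  by apply: measurableC; exact: measurable_box.
apply: (negligibleS (A := \bigcup_(i : 'I_n) X i @^-1` (~` box (fun=> - K%:R) (fun=> K%:R)))).
  move=> w /existsNP[i /existsNP[j hj]]; exists i => // h; apply: hj.
  by rewrite ler_norml; exact: h.
apply: negligible_countable => i; apply/negligibleP.
  by rewrite -[X in measurable X]setTI; exact: measurable_funP.
by apply: etrans (marginal i mbox) _.
Qed.

(** Two holes make a corner for some integer direction [v] and some [m], and there are countably
    many such pairs. *)
Lemma negligible_two_witnesses : P.-negligible [set w | exists x y r,
  [/\ 0 < r, thr B k (pts X n w) = r%:E, x != y & B x /\ B y /\
    (cnt (pts X n w) (oball x r) < k)%N /\ (cnt (pts X n w) (oball y r) < k)%N]].
Proof.
apply: (negligibleS (A := [set w | ~ in_range K (fun i : 'I_n => X i w)] `|`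
  \bigcup_(vm : {ffun 'I_n * 'I_d -> int} * nat)
   [set w | in_range K (fun i : 'I_n => X i w) /\ corner k B vm.1 vm.2 (fun i => X i w)])).
  move=> w [x [y [r]]]; rewrite pts_conf => -[r0 rE xy [Bx [By [xk yk]]]].
  have [rw|] := pselect (in_range K (fun i : 'I_n => X i w)); last by left.
  right; have [v [m h]] := corner_exists r0 rE xy Bx By xk yk.
  by exists (v, m).
apply: negligibleU; first exact: negligible_out_of_range.
by apply: negligible_countable => -[v m]; exact: negligible_corner.
Qed.

End unique_witness.

(** * Hits and records *)

Section hits_measurable.
Context (dZ : measure_display) (Z : measurableType dZ) (R : realType) (d : nat)
  (B : set 'rV[R]_d) (k m : nat) (f : Z -> seq 'rV[R]_d) (g : Z -> 'rV[R]_d).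
Hypotheses (B_neq0 : B !=set0) (f_size : forall z, size (f z) = m)
  (f_meas : forall i, (i < m)%N -> measurable_fun setT (fun z => nth 0 (f z) i))
  (g_meas : measurable_fun setT g).

Lemma measurable_lowers : measurable [set z | lowers B k (f z) (g z)].
Proof.
rewrite -[X in measurable X]setTI; apply: measurable_lte => //; last first.
  exact: measurable_thr f_size f_meas.
apply: (@measurable_thr _ _ _ _ _ _ _ _ m.+1) => // [z|i]; first by rewrite size_rcons f_size.
rewrite ltnS leq_eqVlt => /predU1P[->|im].
  by under eq_fun do rewrite nth_rcons f_size ltnn eqxx.
by under eq_fun do rewrite nth_rcons f_size im; exact: f_meas.
Qed.

Lemma measurable_hits : measurable [set z | hits B k (f z) (g z)].
Proof.
rewrite -[X in measurable X]setTI; apply: measurable_lte => //; last first.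
  exact: measurable_thr f_size f_meas.
apply: (@measurable_thr _ _ _ _ _ _ _ _ (m + k)) => // [z|i ik].
  by rewrite size_cat f_size size_nseq.
under eq_fun do rewrite nth_cat f_size; case: ltnP => im; first exact: f_meas.
by under eq_fun do rewrite nth_nseq; rewrite ltn_subLR// ik.
Qed.

End hits_measurable.

(** * Conditional probabilities and the martingale *)

Section conditional.
Context (dT : measure_display) (T : measurableType dT) (R : realType) (d : nat)
  (P : probability T R) (X : nat -> {mfun T >-> 'rV[R]_d}).
Hypothesis X_iid : forall (J : seq nat) (D : nat -> set 'rV[R]_d),
  uniq J -> (forall j, measurable (D j)) ->
  P (\bigcap_(j in [set` J]) X j @^-1` D j) = (\prod_(j <- J) law P X (D j))%E.
Variable Q : seq 'rV[R]_d -> 'rV[R]_d -> bool.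
(** Measurability for every measurable presentation of the sample: outcomes, tuples and prefixes of
    tuples all occur below. [Q] stands for [lowers], [hits] or [occurs]. *)
Hypothesis Q_meas : forall (dZ : measure_display) (Z : measurableType dZ) m
  (f : Z -> seq 'rV[R]_d) (g : Z -> 'rV[R]_d),
  (forall z, size (f z) = m) ->
  (forall i, (i < m)%N -> measurable_fun setT (fun z => nth 0 (f z) i)) ->
  measurable_fun setT g -> measurable [set z | Q (f z) (g z)].

Definition event n w : R := (Q (pts X n w) (X n w))%:R.

Definition condP (s : seq 'rV[R]_d) : R := fine (law P X [set y | Q s y]).

Lemma measurable_Q s : measurable [set y | Q s y].
Proof.
apply: (@Q_meas _ _ (size s) (fun=> s) id) => // i _; exact: measurable_cst.
Qed.

Lemma condP_ge0 s : 0 <= condP s.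
Proof. exact: prob_ge0. Qed.

Lemma condP_le1 s : condP s <= 1.
Proof. by apply: prob_le1; exact: measurable_Q. Qed.

Lemma measurable_condP (dZ : measure_display) (Z : measurableType dZ) m
    (f : Z -> seq 'rV[R]_d) : (forall z, size (f z) = m) ->
  (forall i, (i < m)%N -> measurable_fun setT (fun z => nth 0 (f z) i)) ->
  measurable_fun setT (fun z => condP (f z)).
Proof.
move=> f_size f_meas.
have mQ : measurable [set zy : Z * 'rV[R]_d | Q (f zy.1) zy.2].
  apply: (@Q_meas _ _ m) => // i im.
  exact: (measurableT_comp (f_meas i im) measurable_fst).
have := @measurable_fun_xsection _ _ _ _ _ (law P X) _ mQ.
have mfine : measurable_fun setT (@fine R) by [].
move=> h; have := measurableT_comp mfine h.
congr measurable_fun; apply/funext => z /=; congr (fine (law P X _)).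
by apply/seteqP; split => y; rewrite xsectionE/= => //; rewrite inE.
Qed.

Lemma measurable_event n : measurable [set w | Q (pts X n w) (X n w)].
Proof.
apply: (@Q_meas _ _ n) => // [w|i ni]; first exact: size_pts.
by under eq_fun do rewrite nth_pts//; exact: measurable_funP.
Qed.

Lemma eventE n : event n = \1_[set w | Q (pts X n w) (X n w)].
Proof.
by apply/funext => w; rewrite /event indicE; congr ((nat_of_bool _)%:R); apply/idP/idP => [/mem_set|/set_mem].
Qed.

Lemma bmf_event n : bmf (event n).
Proof. by rewrite eventE; apply: bmf_indic; exact: measurable_event. Qed.

Lemma bmf_condP n : bmf (fun w => condP (pts X n w)).
Proof.
split; last by exists 1 => w; rewrite ger0_norm ?condP_ge0 ?condP_le1.
apply: (@measurable_condP _ _ n) => [w|i ni]; first exact: size_pts.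
by under eq_fun do rewrite nth_pts//; exact: measurable_funP.
Qed.

Lemma measurable_nth_tuple n i : (i < n)%N ->
  measurable_fun setT (fun t : n.-tuple 'rV[R]_d => nth 0 t i).
Proof.
move=> ni; rewrite (_ : (fun _ => _) = (fun t : n.-tuple 'rV[R]_d => tnth t (Ordinal ni))).
  exact: measurable_tnth.
by apply/funext => t; rewrite (tnth_nth 0).
Qed.

Lemma cond_ge0 n (g : n.-tuple 'rV[R]_d -> R) : bmf g -> (forall t, 0 <= g t) ->
  Ex P (fun w => g (first X n w) * event n w) =
  Ex P (fun w => g (first X n w) * condP (pts X n w)).
Proof.
move=> bg g0.
have mQ : measurable [set zy : n.-tuple 'rV[R]_d * 'rV[R]_d | Q zy.1 zy.2].
  apply: (@Q_meas _ _ n) => // [z|i im]; first exact: size_tuple.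
  exact: (measurableT_comp (measurable_nth_tuple im) measurable_fst).
have QE s y : (Q s y)%:R = \1_[set y | Q s y] y :> R.
  by rewrite indicE; congr ((nat_of_bool _)%:R); apply/idP/idP => [/mem_set|/set_mem].
pose F (zy : n.-tuple 'rV[R]_d * 'rV[R]_d) := (g zy.1 * (Q zy.1 zy.2)%:R)%:E.
have mF : measurable_fun setT F.
  apply/measurable_EFinP; apply: measurable_funM.
    exact: (measurableT_comp (proj1 bg) measurable_fst).
  rewrite (_ : (fun _ => _) = \1_[set zy : n.-tuple 'rV[R]_d * 'rV[R]_d | Q zy.1 zy.2]).
    exact: measurable_indic.
  by apply/funext => z; rewrite indicE; congr ((nat_of_bool _)%:R); apply/idP/idP => [/mem_set|/set_mem].
have F0 z : (0 <= F z)%E by rewrite lee_fin mulr_ge0.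
have h := indep_integral (first_indep X_iid (n := n)) mF F0.
rewrite /Ex /Rintegral; congr fine.
transitivity (\int[P]_w F (first X n w, X n w))%E.
  by apply: eq_integral => w _; rewrite /event pts_first.
rewrite h; apply: eq_integral => w _; rewrite pts_first /condP EFinM.
rewrite fineK; last by rewrite fin_num_measure//; exact: measurable_Q.
under eq_integral do rewrite /F /= QE EFinM.
rewrite ge0_integralZl//; last 2 first.
- apply/measurable_EFinP; apply: measurable_indic; exact: measurable_Q.
- by rewrite lee_fin g0.
by rewrite integral_indic ?setIT//; exact: measurable_Q.
Qed.

End conditional.

Section martingale.
Context (dT : measure_display) (T : measurableType dT) (R : realType) (d : nat)
  (P : probability T R) (X : nat -> {mfun T >-> 'rV[R]_d}).
Hypothesis X_iid : forall (J : seq nat) (D : nat -> set 'rV[R]_d),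
  uniq J -> (forall j, measurable (D j)) ->
  P (\bigcap_(j in [set` J]) X j @^-1` D j) = (\prod_(j <- J) law P X (D j))%E.
Variable Q : seq 'rV[R]_d -> 'rV[R]_d -> bool.
Hypothesis Q_meas : forall (dZ : measure_display) (Z : measurableType dZ) m
  (f : Z -> seq 'rV[R]_d) (g : Z -> 'rV[R]_d),
  (forall z, size (f z) = m) ->
  (forall i, (i < m)%N -> measurable_fun setT (fun z => nth 0 (f z) i)) ->
  measurable_fun setT g -> measurable [set z | Q (f z) (g z)].

Local Notation I := (event X Q).
Local Notation p n := (fun w => condP P X Q (pts X n w)).

Let bI n : bmf (I n). Proof. exact: (bmf_event _ Q_meas). Qed.
Let bp n : bmf (p n). Proof. exact: bmf_condP. Qed.

Lemma bmf_first n (g : n.-tuple 'rV[R]_d -> R) : bmf g -> bmf (fun w => g (first X n w)).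
Proof.
move=> [mg [M gM]]; split; last by exists M.
exact: (measurableT_comp mg (measurable_funP _)).
Qed.

(** Adding the bound [M] makes [g] nonnegative, and the case of the constant [M] is then
    subtracted. *)
Lemma cond_bmf n (g : n.-tuple 'rV[R]_d -> R) : bmf g ->
  Ex P (fun w => g (first X n w) * I n w) = Ex P (fun w => g (first X n w) * p n w).
Proof.
move=> bg; have [mg [M gM]] := bg.
have bgf := bmf_first bg.
have M0 : 0 <= M by rewrite (le_trans _ (gM point))// normr_ge0.
have h1 := cond_ge0 X_iid Q_meas (bmfD bg (bmf_cst _ M)).
have h2 := cond_ge0 X_iid Q_meas (bmf_cst (n.-tuple 'rV[R]_d) M).
have {}h1 : Ex P (fun w => (g (first X n w) + M) * I n w) =
    Ex P (fun w => (g (first X n w) + M) * p n w).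
  by apply: h1 => t; rewrite -lerBlDr sub0r; have := gM t; rewrite ler_norml => /andP[].
have {}h2 : Ex P (fun w => M * I n w) = Ex P (fun w => M * p n w) by exact: h2.
have split (J : T -> R) : bmf J -> Ex P (fun w => g (first X n w) * J w) =
    Ex P (fun w => (g (first X n w) + M) * J w) - Ex P (fun w => M * J w).
  move=> bJ; rewrite -ExB; last 2 first.
  - by apply: bmfM => //; exact: bmfD bgf (bmf_cst _ M).
  - exact: bmfZ.
  by congr Ex; apply/funext => w; ring.
by rewrite !split// h1 h2.
Qed.

Lemma Ex_event n : Ex P (I n) = Ex P (p n).
Proof.
have := cond_bmf (bmf_cst (n.-tuple 'rV[R]_d) 1).
by under eq_fun do rewrite mul1r; under [in RHS]eq_fun do rewrite mul1r.
Qed.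

Definition mdiff n w : R := I n w - p n w.

Let bD n : bmf (mdiff n). Proof. exact: bmfB. Qed.

Let tuple_p n i (ni : (i <= n)%N) :
  bmf (fun t : n.-tuple 'rV[R]_d => condP P X Q (take i t)).
Proof.
split; last by exists 1 => w; rewrite ger0_norm ?condP_ge0 ?condP_le1.
apply: (@measurable_condP _ _ _ _ _ _ _ Q_meas _ _ i) => [t|j ji].
  by rewrite size_takel// size_tuple.
under eq_fun do rewrite nth_take//.
by apply: measurable_nth_tuple; exact: leq_trans ni.
Qed.

Let tuple_diff n i (ni : (i < n)%N) :
  bmf (fun t : n.-tuple 'rV[R]_d => (Q (take i t) (nth 0 t i))%:R - condP P X Q (take i t)).
Proof.
apply: bmfB; last exact/tuple_p/ltnW.
rewrite (_ : (fun _ => _) = \1_[set t : n.-tuple 'rV[R]_d | Q (take i t) (nth 0 t i)]).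
  apply: bmf_indic; apply: (@Q_meas _ _ i) => [t|j ji|].
  - by rewrite size_takel// size_tuple ltnW.
  - under eq_fun do rewrite nth_take//.
    by apply: measurable_nth_tuple; exact: ltn_trans ni.
  - exact: measurable_nth_tuple.
by apply/funext => t; rewrite indicE; congr ((nat_of_bool _)%:R); apply/idP/idP => [/mem_set|/set_mem].
Qed.

Lemma take_pts n i w : (i <= n)%N -> take i (pts X n w) = pts X i w.
Proof.
by move=> ni; rewrite /pts -map_take take_iota (minn_idPl ni).
Qed.

(** For [i < n], [mdiff i] is a function of the first [n] points, read off a prefix of the tuple;
    conditioning on these points removes [mdiff n]. *)
Lemma mdiff_orth n i : (i < n)%N -> Ex P (fun w => mdiff i w * mdiff n w) = 0.
Proof.
move=> ni; have := cond_bmf (tuple_diff ni).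
have e w : (Q (take i (first X n w)) (nth 0 (first X n w) i))%:R -
    condP P X Q (take i (first X n w)) = mdiff i w.
  by rewrite -pts_first take_pts ?(ltnW ni)// nth_pts.
under eq_fun do rewrite e; under [in RHS]eq_fun do rewrite e.
move=> h; rewrite [X in Ex P X](_ : _ = (fun w => mdiff i w * I n w - mdiff i w * p n w)).
  by rewrite ExB ?h ?subrr//; exact: bmfM.
by apply/funext => w; rewrite -mulrBr.
Qed.

(** As [I * I = I], the left side is the mean of [p - p ^+ 2]. *)
Lemma Ex_mdiff2 n : Ex P (fun w => mdiff n w * mdiff n w) <= Ex P (p n).
Proof.
have h : Ex P (fun w => p n w * I n w) = Ex P (fun w => p n w * p n w).
  have := cond_bmf (tuple_p (leqnn n)).
  have e w : take n (first X n w) = pts X n w by rewrite -pts_first take_pts.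
  by under eq_fun do rewrite e; under [in RHS]eq_fun do rewrite e.
have -> : (fun w => mdiff n w * mdiff n w) =
    (fun w => (I n w - 2 * (p n w * I n w)) + p n w * p n w).
  apply/funext => w; rewrite /mdiff /event; case: (Q _ _); rewrite /=; ring.
rewrite ExD; [|by apply: bmfB => //; apply: bmfZ; exact: bmfM|exact: bmfM].
rewrite ExB//; last by apply: bmfZ; exact: bmfM.
rewrite ExZ ?h; last exact: bmfM.
rewrite Ex_event; have : 0 <= Ex P (fun w => p n w * p n w).
  by apply: Ex_ge0 => w; rewrite mulr_ge0 ?condP_ge0.
by lra.
Qed.

Lemma Ex_martingale k n :
  Ex P (fun w => (\sum_(k <= i < n) mdiff i w) * (\sum_(k <= i < n) mdiff i w)) <=
  \sum_(k <= i < n) Ex P (p i).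
Proof.
elim: n => [|n IH].
  rewrite big_geq//; under eq_fun do rewrite big_geq// mul0r.
  by rewrite Ex_cst.
have [kn|kn] := leqP k n; last first.
  rewrite big_geq//; under eq_fun do rewrite big_geq// mul0r.
  by rewrite Ex_cst.
rewrite big_nat_recr//=.
have bS : bmf (fun w => \sum_(k <= i < n) mdiff i w) by exact: bmf_sum.
have -> : (fun w => (\sum_(k <= i < n.+1) mdiff i w) * (\sum_(k <= i < n.+1) mdiff i w)) =
    (fun w => ((\sum_(k <= i < n) mdiff i w) * (\sum_(k <= i < n) mdiff i w) +
     2 * \sum_(k <= i < n) (mdiff i w * mdiff n w)) + mdiff n w * mdiff n w).
  by apply/funext => w; rewrite big_nat_recr//= -mulr_suml; ring.
have bSD : bmf (fun w => \sum_(k <= i < n) (mdiff i w * mdiff n w)).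
  by apply: bmf_sum => i; exact: bmfM.
rewrite ExD; [|by apply: bmfD; [exact: bmfM|exact: bmfZ]|exact: bmfM].
rewrite ExD; [|exact: bmfM|exact: bmfZ].
rewrite ExZ// Ex_sum => [|i]; last exact: bmfM.
rewrite [X in 2 * X]big_nat_cond [X in 2 * X]big1 => [|i /andP[/andP[_ ni] _]]; last exact: mdiff_orth.
by rewrite mulr0 addr0 lerD// Ex_mdiff2.
Qed.

End martingale.

(** * Exchangeability *)

Section exchange.
Context (dT : measure_display) (T : measurableType dT) (R : realType) (d : nat)
  (P : probability T R) (X : nat -> {mfun T >-> 'rV[R]_d}).
Hypothesis X_iid : forall (J : seq nat) (D : nat -> set 'rV[R]_d),
  uniq J -> (forall j, measurable (D j)) ->
  P (\bigcap_(j in [set` J]) X j @^-1` D j) = (\prod_(j <- J) law P X (D j))%E.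
Variables (B : set 'rV[R]_d) (k : nat).
Hypotheses (B_compact : compact B) (k_gt0 : (0 < k)%N) (B_neq0 : B !=set0).
Hypothesis thr_pos : forall s, (k <= size s)%N -> exists2 r, 0 < r & thr B k s = r%:E.

Lemma hits_perm s t y : perm_eq s t -> hits B k s y = hits B k t y.
Proof.
move=> st; rewrite /hits (perm_thr _ _ st); congr (_ < _)%E; apply: perm_thr.
by rewrite perm_cat2r.
Qed.

Lemma count_pts (a : pred 'rV[R]_d) n w :
  (count a (pts X n w))%:R = \sum_(i < n) (a (X i w))%:R :> R.
Proof.
elim: n => [|n IH]; first by rewrite big_ord0.
by rewrite ptsS -cats1 count_cat natrD IH big_ord_recr /= addn0.
Qed.

(** All [n.+1] points hit the full sample with the same probability, and fewer than [k] of them do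
    so at a time. *)
Lemma prob_hits_last n : (k <= n.+1)%N ->
  n.+1%:R * fine (P [set w | hits B k (pts X n.+1 w) (X n w)]) <= k%:R.
Proof.
move=> kn; pose E : set (n.+1.-tuple 'rV[R]_d) := [set t : n.+1.-tuple 'rV[R]_d | hits B k t (tnth t ord_max)].
have mE : measurable E.
  apply: (@measurable_hits _ _ _ _ _ _ n.+1) => // [t|i ni|]; first exact: size_tuple.
    exact: measurable_nth_tuple.
  exact: measurable_tnth.
pose H i := [set w | hits B k (pts X n.+1 w) (X (i : 'I_n.+1) w)].
have HE i : P (H i) = P (H ord_max).
  (* The transposition of [i] and the last index carries one event to the other, as hits do not
     depend on the order of the sample. *)
  pose s (j : 'I_n.+1) : nat := val (tperm i ord_max j).
  have sinj : injective s by move=> j j' /val_inj /perm_inj.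
  have vinj : injective (fun j : 'I_n.+1 => val j) by exact: val_inj.
  have := sampl_law X_iid sinj vinj mE.
  have pe w : perm_eq (pts X n.+1 w) (sampl X s w).
    rewrite pts_first; apply/tuple_permP; exists (tperm i ord_max).
    congr (val _); apply: eq_from_tnth => j.
    by rewrite !tnth_mktuple /s tpermK.
  have -> : sampl X s @^-1` E = H i.
    by apply/seteqP; split=> w; rewrite /E /H /= tnth_mktuple /s tpermR -(hits_perm _ (pe w)).
  move=> ->; congr (P _); apply/seteqP; split=> w; rewrite /E /H /= tnth_mktuple pts_first//.
have mH i : measurable (H i).
  apply: (@measurable_hits _ _ _ _ _ _ n.+1) => // [t|j nj]; first exact: size_pts.
  by under eq_fun do rewrite nth_pts//; exact: measurable_funP.
have -> : n.+1%:R * fine (P [set w | hits B k (pts X n.+1 w) (X n w)]) =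
    \sum_(i < n.+1) fine (P (H i)).
  by under eq_bigr do rewrite HE; rewrite sumr_const card_ord mulr_natl.
under eq_bigr do rewrite -Ex_indic//.
rewrite -Ex_sum => [|i]; last exact: bmf_indic.
rewrite -[leRHS](@Ex_cst _ _ _ P); apply: Ex_le; [|exact: bmf_cst|].
  by apply: bmf_sum => i; exact: bmf_indic.
move=> w; have [r r0 rE] := @thr_pos (pts X n.+1 w) (ltac:(by rewrite size_pts)).
apply: (@le_trans _ _ (count (hits B k (pts X n.+1 w)) (pts X n.+1 w))%:R); last first.
  by rewrite ler_nat ltnW// (count_hits B_compact r0 rE).
rewrite count_pts; apply: ler_sum => i _; rewrite indicE.
by case: (boolP (w \in H i)) => [/set_mem ->|].
Qed.

End exchange.

(** * The number of records *)

Section log_sums.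
Context (R : realType).
Implicit Types (n m : nat).

Lemma ln_step m : (0 < m)%N ->
  (m.+1%:R)^-1 <= ln (m.+1%:R : R) - ln m%:R <= m%:R^-1.
Proof.
move=> m0; have mR : 0 < m%:R :> R by rewrite ltr0n.
have mS : 0 < m.+1%:R :> R by rewrite ltr0n.
rewrite -ln_div ?posrE//; apply/andP; split.
  rewrite -lerN2 -lnV ?posrE ?divr_gt0// invf_div.
  have -> : m%:R / m.+1%:R = 1 + - (m.+1%:R)^-1 :> R.
    by rewrite -natr1; field; rewrite natr1 gt_eqF.
  by apply: le_ln1Dx; rewrite ltrN2 invf_lt1// ltr1n.
have -> : m.+1%:R / m%:R = 1 + m%:R^-1 :> R by rewrite -natr1; field; rewrite gt_eqF.
by apply: le_ln1Dx; rewrite (lt_trans (ltrN10 R))// invr_gt0.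
Qed.

Lemma ln_nat_ge0 n : 0 <= ln (n%:R : R).
Proof. by case: n => [|n]; [rewrite ln0|rewrite ln_ge0// ler1n]. Qed.

Lemma sum_inv_le n : (0 < n)%N -> \sum_(1 <= m < n) m%:R^-1 <= 1 + ln n%:R :> R.
Proof.
move=> n0; apply: (@le_trans _ _ (\sum_(1 <= m < n.+1) m%:R^-1)).
  by rewrite big_nat_recr//= lerDl invr_ge0.
elim: n n0 => // -[|n] IH _; first by rewrite big_nat1 ln1 addr0 invr1.
rewrite big_nat_recr//=; apply: le_trans (lerD (IH isT) (lexx _)) _.
by rewrite -addrA lerD2l -lerBrDl; have /andP[] := @ln_step n.+1 isT.
Qed.

(** The increment of half the squared logarithm from [m] to [m + 1] differs from [ln m / m] by at
    most [1 / m], and these errors sum to at most [1 + ln n]. *)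
Lemma sum_ln_div n : (0 < n)%N ->
  `|\sum_(1 <= m < n) (ln m%:R / m%:R) - 2^-1 * ln n%:R ^+ 2| <= 1 + ln n%:R :> R.
Proof.
move=> n0; apply: le_trans (sum_inv_le n0).
elim: n n0 => // -[|n] IH _.
  by rewrite !big_geq// ln1 expr0n mulr0 subrr normr0.
rewrite (big_nat_recr n.+1)//= (big_nat_recr n.+1)//=; have {IH} := IH isT.
have /andP[h1 h2] := @ln_step n.+1 isT.
have mR : 0 < n.+1%:R :> R by rewrite ltr0n.
have m0 : 0 < n.+1%:R^-1 :> R by rewrite invr_gt0.
have m1 : n.+1%:R^-1 <= 1 :> R by rewrite invf_le1// ler1n.
have h3 : ln (n.+1%:R : R) <= n.+1%:R by rewrite ltW// ln_sublinear.
have a0 := ln_nat_ge0 n.+1.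
have h4 : ln (n.+1%:R : R) / n.+1%:R - n.+1%:R^-1 <= ln n.+1%:R * (n.+2%:R)^-1.
  have aux0 (c c' l : R) : 0 < c -> c' != 0 -> c' = c + 1 ->
      l * c'^-1 - (l / c - c^-1) = (c' - l) * (c' * c)^-1.
    by move=> c0 c1 e; move: c1; rewrite e => c1; field; rewrite c1 gt_eqF.
  rewrite -subr_ge0 aux0 ?natr1 ?pnatr_eq0//.
  by rewrite mulr_ge0 ?invr_ge0 ?mulr_ge0// subr_ge0 (le_trans h3)// ler_nat.
(* Here [a = ln m], [b = ln (m + 1)], [u = 1 / m], [v = 1 / (m + 1)] and [l = ln m / m]; the square
   of [b] is expanded around [a]. *)
have aux (s t a b u v l : R) : v <= b - a -> b - a <= u -> 0 < u -> u <= 1 -> 0 <= a ->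
    0 <= v -> l - u <= a * v -> l = a * u ->
    `|s - 2^-1 * a ^+ 2| <= t -> `|s + l - 2^-1 * b ^+ 2| <= t + u.
  move=> p1 p2 u0 u1 q0 v0 p3 lE; rewrite !ler_norml => /andP[p4 p5].
  have ba : 0 <= b - a by exact: le_trans p1.
  have p6 : (b - a) * (b - a) <= u.
    by apply: le_trans (_ : 1 * u <= u); [apply: ler_pM => //; exact: le_trans u1|rewrite mul1r].
  have p7 : a * (b - a) <= a * u by rewrite ler_wpM2l.
  have p8 : a * v <= a * (b - a) by rewrite ler_wpM2l.
  have p9 : 0 <= (b - a) * (b - a) by rewrite mulr_ge0.
  have -> : 2^-1 * b ^+ 2 = 2^-1 * a ^+ 2 + a * (b - a) + 2^-1 * ((b - a) * (b - a)) by field.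
  by apply/andP; split; lra.
have v0 : 0 <= n.+2%:R^-1 :> R by rewrite invr_ge0.
by move=> IHn; exact: (aux _ _ _ _ _ _ _ h1 h2 m0 m1 a0 v0 h4 erefl IHn).
Qed.

End log_sums.

Section record_count.
Context (dT : measure_display) (T : measurableType dT) (R : realType) (d : nat)
  (P : probability T R) (X : nat -> {mfun T >-> 'rV[R]_d}).
Hypothesis X_iid : forall (J : seq nat) (D : nat -> set 'rV[R]_d),
  uniq J -> (forall j, measurable (D j)) ->
  P (\bigcap_(j in [set` J]) X j @^-1` D j) = (\prod_(j <- J) law P X (D j))%E.
Variables (B : set 'rV[R]_d) (k : nat).
Hypotheses (B_compact : compact B) (k_gt0 : (0 < k)%N) (B_neq0 : B !=set0).
Hypothesis thr_pos : forall s, (k <= size s)%N -> exists2 r, 0 < r & thr B k s = r%:E.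
Local Notation mu D := (fine (law P X D)).
Local Notation lnd n := (ln n%:R / n%:R : R).

Hypothesis upper : forall e : R, 0 < e -> exists2 C : R, 0 < C & \forall n \near \oo,
  exists U : set T, [/\ measurable U, fine (P U) <= C * expR (- (e / 2 * ln n%:R)) &
    forall w x r, ~ U w -> B x -> 0 < r -> (cnt (pts X n w) (oball x r) < k)%N ->
      mu (oball x r) <= (1 + e) * lnd n].
Hypothesis lower : forall e : R, 0 < e -> e < 1 -> exists2 C : R, 0 < C & \forall n \near \oo,
  exists U r, [/\ measurable U, fine (P U) <= C / ln n%:R, 0 < r,
    (forall x, B x -> (1 - e) * lnd n <= mu (oball x r)) &
    forall w, ~ U w -> exists2 x, B x & cnt (pts X n w) (oball x r) = 0%N].
Hypothesis unique : forall n, (k <= n)%N -> P.-negligible [set w | exists x y r,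
  [/\ 0 < r, thr B k (pts X n w) = r%:E, x != y & B x /\ B y /\
    (cnt (pts X n w) (oball x r) < k)%N /\ (cnt (pts X n w) (oball y r) < k)%N]].

Let lowers_meas (dZ : measure_display) (Z : measurableType dZ) m
  (f : Z -> seq 'rV[R]_d) (g : Z -> 'rV[R]_d) :
  (forall z, size (f z) = m) ->
  (forall i, (i < m)%N -> measurable_fun setT (fun z => nth 0 (f z) i)) ->
  measurable_fun setT g -> measurable [set z | lowers B k (f z) (g z)].
Proof. exact: measurable_lowers. Qed.

Let hits_meas (dZ : measure_display) (Z : measurableType dZ) m
  (f : Z -> seq 'rV[R]_d) (g : Z -> 'rV[R]_d) :
  (forall z, size (f z) = m) ->
  (forall i, (i < m)%N -> measurable_fun setT (fun z => nth 0 (f z) i)) ->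
  measurable_fun setT g -> measurable [set z | hits B k (f z) (g z)].
Proof. exact: measurable_hits. Qed.

Local Notation I n := (event X (lowers B k) n).
Local Notation p n := (fun w => condP P X (lowers B k) (pts X n w)).
Local Notation h n := (fun w => condP P X (hits B k) (pts X n w)).

Lemma lowers_le_hits n w : p n w <= h n w.
Proof.
apply: prob_le; [exact: (measurable_Q lowers_meas)|exact: (measurable_Q hits_meas)|].
by move=> y; exact: lowers_hits.
Qed.

Lemma Ex_hits_lowers n : (k <= n)%N -> Ex P (h n) - Ex P (p n) <= k%:R / n.+1%:R.
Proof.
move=> kn; have mh := measurable_event X hits_meas n; have ml := measurable_event X lowers_meas n.
rewrite -(Ex_event X_iid hits_meas) -(Ex_event X_iid lowers_meas) !eventE !Ex_indic//.
rewrite ler_pdivlMr// mulrC.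
apply: (le_trans _ (prob_hits_last X_iid B_compact B_neq0 thr_pos (leqW kn))).
rewrite ler_wpM2l// lerBlDr -lee_fin EFinD !fineK ?fin_num_measure//; last first.
  apply: (@measurable_hits _ _ _ _ _ _ n.+1) => // [t|j nj]; first exact: size_pts.
  by under eq_fun do rewrite nth_pts//; exact: measurable_funP.
have mS : measurable [set w | hits B k (pts X n.+1 w) (X n w)].
  apply: (@measurable_hits _ _ _ _ _ _ n.+1) => // [t|j nj]; first exact: size_pts.
  by under eq_fun do rewrite nth_pts//; exact: measurable_funP.
apply: (le_trans _ (measureU2 _ mS ml)).
apply: le_measure; rewrite ?inE//; first exact: measurableU.
move=> w /= hw; have [lw|lw] := boolP (lowers B k (pts X n w) (X n w)); first by right.
by left; rewrite /= ptsS; exact: hits_rcons.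
Qed.

(** [U1], where the upper bound fails, has probability of order [n^-(e/2)], too much by itself; but
    outside [U2], of probability [O(1/n)], the mass is at most [3 * L], so that [U1] costs only
    [2 * L]. On [U3], of probability [O(1 / ln n)], at most [L] is lost. The null set [U4] holds the
    outcomes with several holes. *)
Lemma hit_error (e : R) : 0 < e -> e < 1 -> exists2 C : R, 0 < C & \forall n \near \oo,
  exists err : T -> R, [/\ bmf err, (forall w, 0 <= err w), Ex P err <= C / n%:R &
    forall w, `|h n w - lnd n| <= e * lnd n + err w].
Proof.
move=> e0 e1; have [C1 C10 H1] := upper e0; have [C2 C20 H2] := upper (ltr0n R 2).
have [C3 C30 H3] := lower e0 e1.
exists (4 / e * C1 + C2 + C3).
  by rewrite !addr_gt0// mulr_gt0// divr_gt0.
near=> n.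
have [U1 [mU1 PU1 hU1]] : exists U : set T, [/\ measurable U, fine (P U) <= C1 * expR (- (e / 2 * ln n%:R)) &
    forall w x r, ~ U w -> B x -> 0 < r -> (cnt (pts X n w) (oball x r) < k)%N ->
      mu (oball x r) <= (1 + e) * lnd n] by near: n; exact: H1.
have [U2 [mU2 PU2 hU2]] : exists U : set T, [/\ measurable U, fine (P U) <= C2 * expR (- (2 / 2 * ln n%:R)) &
    forall w x r, ~ U w -> B x -> 0 < r -> (cnt (pts X n w) (oball x r) < k)%N ->
      mu (oball x r) <= (1 + 2) * lnd n] by near: n; exact: H2.
have [U3 [r3 [mU3 PU3 r30 hr3 hU3]]] : exists U r, [/\ measurable U, fine (P U) <= C3 / ln n%:R, 0 < r,
    (forall x, B x -> (1 - e) * lnd n <= mu (oball x r)) &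
    forall w, ~ U w -> exists2 x, B x & cnt (pts X n w) (oball x r) = 0%N] by near: n; exact: H3.
have kn : (k <= n)%N by near: n; exact: nbhs_infty_ge.
have [U4 [mU4 PU4 hU4]] := unique kn.
have n0 : (0 < n)%N by exact: leq_trans kn.
have n0' : 0 < n%:R :> R by rewrite ltr0n.
have ln1 : 1 <= ln (n%:R : R) by near: n; exact: near_ln_ge.
have ln0 : 0 < ln (n%:R : R) by exact: lt_le_trans ln1.
have Ln0 : 0 < lnd n by exact: divr_gt0.
have Ln1 : lnd n <= 1 by near: n; exact: near_ln_div.
set L := lnd n in Ln0 Ln1 hU1 hU2 hr3 *.
exists (fun w => 2 * L * \1_U1 w + \1_U2 w + L * \1_U3 w + \1_U4 w).
have bU1 : bmf (fun w => 2 * L * \1_U1 w) by exact/bmfZ/bmf_indic.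
have bU2 : bmf (\1_U2 : T -> R) by exact: bmf_indic.
have bU3 : bmf (fun w => L * \1_U3 w) by exact/bmfZ/bmf_indic.
have bU4 : bmf (\1_U4 : T -> R) by exact: bmf_indic.
have i0 (U : set T) w : 0 <= \1_U w :> R by rewrite indicE.
split.
- by do 3 (apply: bmfD => //).
- by move=> w; rewrite !addr_ge0// !mulr_ge0// ltW.
- have b12 : bmf (fun w => 2 * L * \1_U1 w + \1_U2 w) by exact: bmfD.
  have b123 : bmf (fun w => 2 * L * \1_U1 w + \1_U2 w + L * \1_U3 w) by exact: bmfD.
  rewrite (ExD _ b123 bU4) (ExD _ b12 bU3) (ExD _ bU1 bU2) !ExZ ?Ex_indic//; try exact: bmf_indic.
  rewrite PU4 /= addr0.
  have a1 : 2 * L * fine (P U1) <= 4 / e * C1 / n%:R.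
    apply: (@le_trans _ _ (2 * L * (C1 * expR (- (e / 2 * ln n%:R))))).
      by rewrite ler_wpM2l// mulr_ge0// ltW.
    have e20 : 0 < e / 2 by rewrite divr_gt0.
    have := expRN_mul_le e20 (ltW ln0); move: (expR _) => E hE.
    have -> : 2 * L * (C1 * E) = 2 * C1 / n%:R * (E * ln n%:R) by rewrite /L; field; rewrite gt_eqF.
    have -> : 4 / e * C1 / n%:R = 2 * C1 / n%:R * (e / 2)^-1.
      by field; rewrite !gt_eqF.
    by rewrite ler_wpM2l// mulr_ge0 ?mulr_ge0 ?invr_ge0 ?(ltW C10) ?(ltW n0').
  have a2 : fine (P U2) <= C2 / n%:R.
    apply: le_trans PU2 _; rewrite mulfV// mul1r expRN lnK//.
  have a3 : L * fine (P U3) <= C3 / n%:R.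
    apply: (@le_trans _ _ (L * (C3 / ln n%:R))); first by rewrite ler_wpM2l// ltW.
    rewrite /L le_eqVlt; apply/orP; left; apply/eqP; field.
    by rewrite !gt_eqF.
  by rewrite (mulrDl (4 / e * C1 + C2) C3) (mulrDl (4 / e * C1) C2) (lerD (lerD a1 a2) a3).
- move=> w; have [r r0 rE] := @thr_pos (pts X n w) (ltac:(by rewrite size_pts)).
  have [x Bx xk] := thr_witness B_compact r0 rE.
  have h0 : 0 <= h n w := condP_ge0 _ _ _ _.
  have h1 : h n w <= 1 by apply: prob_le1; exact: (measurable_Q hits_meas).
  have hx : h n w <= mu (oball x r).
    apply: prob_le; [exact: (measurable_Q hits_meas)|exact: measurable_oball|].
    by move=> y; exact: (hits_sub Bx xk rE).
  have up : h n w <= L + e * L + (2 * L * \1_U1 w + \1_U2 w).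
    have [Uw1|Uw1] := pselect (U1 w); last first.
      apply: le_trans hx _; apply: le_trans (hU1 w x r Uw1 Bx r0 xk) _.
      rewrite mulrDl mul1r lerDl addr_ge0// mulr_ge0// mulr_ge0// ltW//.
    have [Uw2|Uw2] := pselect (U2 w); last first.
      apply: le_trans hx _; apply: le_trans (hU2 w x r Uw2 Bx r0 xk) _.
      have -> : \1_U1 w = 1 :> R by rewrite indicE mem_set.
      have := i0 U2 w; have : 0 <= e * L by rewrite mulr_ge0 ?ltW.
      lra.
    have -> : \1_U2 w = 1 :> R by rewrite indicE mem_set.
    apply: le_trans h1 _; rewrite addrA lerDr.
    apply: addr_ge0; last by rewrite !mulr_ge0// ltW.
    by apply: addr_ge0; [exact: ltW|rewrite mulr_ge0// ltW].
  have lo : L - e * L - (L * \1_U3 w + \1_U4 w) <= h n w.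
    have low0 : L - e * L <= L by rewrite lerBlDr lerDl mulr_ge0 ?(ltW e0) ?(ltW Ln0).
    have [Uw3|Uw3] := pselect (U3 w).
      apply: le_trans h0; rewrite subr_le0; apply: le_trans low0 _.
      have -> : \1_U3 w = 1 :> R by rewrite indicE mem_set.
      by rewrite mulr1 lerDl.
    have [Uw4|Uw4] := pselect (U4 w).
      apply: le_trans h0; rewrite subr_le0; apply: le_trans low0 (le_trans Ln1 _).
      have -> : \1_U4 w = 1 :> R by rewrite indicE mem_set.
      by rewrite lerDr mulr_ge0// ltW.
    have -> : \1_U3 w = 0 :> R by rewrite indicE memNset.
    have -> : \1_U4 w = 0 :> R by rewrite indicE memNset.
    (* The empty ball at [x'] forces [r3 <= r]; as [x] is the only hole, every point within [r3] of
       [x] hits. *)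
    have [x' Bx' x'0] := hU3 w Uw3.
    have rr : r3 <= r by rewrite -lee_fin -rE (thr_ge Bx')// x'0.
    rewrite mulr0 addr0 subr0; apply: (@le_trans _ _ (mu (oball x r3))).
      by rewrite (le_trans _ (hr3 x Bx))// mulrBl mul1r.
    apply: prob_le; [exact: measurable_oball|exact: (measurable_Q hits_meas)|].
    move=> y xy; apply: (sub_hits B_compact r0 rE) => z Bz zk.
    have -> : z = x.
      apply: contrapT => /eqP zx; apply: Uw4; apply: hU4.
      by exists z, x, r.
    exact: lt_le_trans rr.
  have u13 : 0 <= 2 * L * \1_U1 w + \1_U2 w.
    by apply: addr_ge0 => //; rewrite !mulr_ge0// ltW.
  have u34 : 0 <= L * \1_U3 w + \1_U4 w by apply: addr_ge0 => //; rewrite mulr_ge0// ltW.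
  have key (a b c l z : R) : 0 <= a -> 0 <= b -> z <= l + c + a -> l - c - b <= z ->
    `|z - l| <= c + (a + b) by move=> *; rewrite ler_norml; lra.
  by have := key _ _ _ _ _ u13 u34 up lo; rewrite !addrA.
Unshelve. all: by end_near. Qed.

End record_count.

(** * From hits to records *)

Section record_estimate.
Context (dT : measure_display) (T : measurableType dT) (R : realType) (d : nat)
  (P : probability T R) (X : nat -> {mfun T >-> 'rV[R]_d}).
Hypothesis X_iid : forall (J : seq nat) (D : nat -> set 'rV[R]_d),
  uniq J -> (forall j, measurable (D j)) ->
  P (\bigcap_(j in [set` J]) X j @^-1` D j) = (\prod_(j <- J) law P X (D j))%E.
Variables (B : set 'rV[R]_d) (k : nat).
Hypotheses (B_compact : compact B) (k_gt0 : (0 < k)%N) (B_neq0 : B !=set0).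
Hypothesis thr_pos : forall s, (k <= size s)%N -> exists2 r, 0 < r & thr B k s = r%:E.
Local Notation lnd n := (ln n%:R / n%:R : R).
Local Notation I n := (event X (lowers B k) n).
Local Notation p n := (fun w => condP P X (lowers B k) (pts X n w)).
Local Notation h n := (fun w => condP P X (hits B k) (pts X n w)).

Hypothesis hit_err : forall e : R, 0 < e -> e < 1 -> exists2 C : R, 0 < C & \forall n \near \oo,
  exists err : T -> R, [/\ bmf err, (forall w, 0 <= err w), Ex P err <= C / n%:R &
    forall w, `|h n w - lnd n| <= e * lnd n + err w].

Let lowers_meas (dZ : measure_display) (Z : measurableType dZ) m
  (f : Z -> seq 'rV[R]_d) (g : Z -> 'rV[R]_d) :
  (forall z, size (f z) = m) ->
  (forall i, (i < m)%N -> measurable_fun setT (fun z => nth 0 (f z) i)) ->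
  measurable_fun setT g -> measurable [set z | lowers B k (f z) (g z)].
Proof. exact: measurable_lowers. Qed.

Let hits_meas (dZ : measure_display) (Z : measurableType dZ) m
  (f : Z -> seq 'rV[R]_d) (g : Z -> 'rV[R]_d) :
  (forall z, size (f z) = m) ->
  (forall i, (i < m)%N -> measurable_fun setT (fun z => nth 0 (f z) i)) ->
  measurable_fun setT g -> measurable [set z | hits B k (f z) (g z)].
Proof. exact: measurable_hits. Qed.

Let lnd_ge0 n : 0 <= lnd n.
Proof. by rewrite divr_ge0 ?ln_nat_ge0. Qed.

Let lnd_le1 n : (0 < n)%N -> lnd n <= 1.
Proof.
move=> n0; have nR : 0 < n%:R :> R by rewrite ltr0n.
by rewrite ler_pdivrMr// mul1r ltW// ln_sublinear.
Qed.

Lemma hit_error_all (e : R) : 0 < e -> e < 1 -> exists2 C : R, 0 < C &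
  forall n, (0 < n)%N -> exists err : T -> R,
    [/\ bmf err, (forall w, 0 <= err w), Ex P err <= C / n%:R &
    forall w, `|h n w - lnd n| <= e * lnd n + err w].
Proof.
move=> e0 e1; have [C C0 [n0 _ hn]] := hit_err e0 e1.
exists (C + 2 * n0%:R); first by rewrite ltr_wpDr// mulr_ge0.
move=> n n_gt0; have nR : 0 < n%:R :> R by rewrite ltr0n.
have [/hn[err [berr err0 Eerr herr]]|nn0] := leqP n0 n.
  exists err; split => //; apply: le_trans Eerr _.
  by rewrite ler_wpM2r ?invr_ge0 ?(ltW nR)// lerDl mulr_ge0.
(* Both [h n] and [lnd n] lie between [0] and [1], and [2 <= 2 * n0 / n] for these finitely many
   [n]. *)
exists (fun=> 2); split => //; first exact: bmf_cst.
  rewrite Ex_cst ler_pdivlMr// ler_wpDl ?(ltW C0)// ler_wpM2l// ler_nat ltnW//.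
move=> w; have h0 : 0 <= h n w := condP_ge0 _ _ _ _.
have h1 : h n w <= 1 by apply: prob_le1; exact: (measurable_Q hits_meas).
have l0 := lnd_ge0 n; have l1 := lnd_le1 n_gt0.
apply: (@le_trans _ _ 2); last by rewrite lerDr mulr_ge0// ltW.
by rewrite ler_norml; move: h0 h1 l0 l1; move: (h n w) (lnd n) => x y; lra.
Qed.

Definition record_sum n w : R := 1 + \sum_(k <= i < n) I i w.

Lemma bmf_record_sum n : bmf (record_sum n).
Proof.
by apply: bmfD; [exact: bmf_cst|apply: bmf_sum => i; exact: (bmf_event _ lowers_meas)].
Qed.

Let sum_lnd n : (k <= n)%N -> 1 <= ln (n%:R : R) ->
  [/\ \sum_(k <= i < n) lnd i <= 2^-1 * ln n%:R ^+ 2 + 2 * ln n%:R &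
   `|\sum_(k <= i < n) lnd i - 2^-1 * ln n%:R ^+ 2| <= (k%:R + 2) * ln n%:R].
Proof.
move=> kn L1; have n0 : (0 < n)%N := leq_trans k_gt0 kn.
have := sum_ln_div R n0; rewrite (@big_cat_nat _ _ _ k)//=.
have a0 : 0 <= \sum_(1 <= i < k) lnd i by apply: sumr_ge0.
have ak : \sum_(1 <= i < k) lnd i <= k%:R * ln n%:R.
  apply: (@le_trans _ _ (\sum_(1 <= i < k) 1)).
    rewrite big_nat_cond [leRHS]big_nat_cond; apply: ler_sum => i /andP[/andP[i1 _] _].
    exact: lnd_le1.
  rewrite sumr_const_nat; apply: (@le_trans _ _ k%:R); first by rewrite ler_nat leq_subr.
  by rewrite ler_peMr.
move: a0 ak L1; move: (\sum_(1 <= i < k) _) (\sum_(k <= i < n) _) (ln (n%:R : R) ^+ 2) (ln (n%:R : R)) => a b q L.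
move=> a0 ak L1; rewrite !ler_norml (mulrDl k%:R); move: (k%:R * L) ak => K ak /andP[u v].
split; first by lra.
by apply/andP; split; lra.
Qed.

(** The deviation splits into the martingale [S], the conditional probabilities [D] of hits without
    record, the error of the hit probabilities, and that of the sum of [lnd]. *)
Lemma record_error (e : R) : 0 < e -> e < 1 -> exists2 C : R, 0 < C & \forall n \near \oo,
  exists Y : T -> R, [/\ bmf Y, (forall w, 0 <= Y w), Ex P Y <= C * ln n%:R &
    forall w, `|record_sum n w - 2^-1 * ln n%:R ^+ 2| <= e * ln n%:R ^+ 2 + Y w].
Proof.
move=> e0 e1; have [C C0 hC] := hit_error_all e0 e1.
have /choice[err herr] : forall n, exists err : T -> R, (0 < n)%N ->
    [/\ bmf err, (forall w, 0 <= err w), Ex P err <= C / n%:R &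
    forall w, `|h n w - lnd n| <= e * lnd n + err w].
  move=> n; have [->|/hC[err herr]] := posnP n; first by exists (fun=> 0).
  by exists err.
(* In order: the second moment of [S] divided by [L], the mean of [F], the mean of [D], and the
   deterministic part. The last one collects the initial [1], the [L] paid for [S], and the terms
   [2 * L] and [(k + 2) * L] from the sum of [lnd]. *)
exists (5 + 2 * C + 2 * C + 2 * k%:R + (k%:R + 6)).
  by rewrite !addr_gt0// ?mulr_gt0// ltr0n.
near=> n.
have kn : (k <= n)%N by near: n; exact: nbhs_infty_ge.
have L1 : 1 <= ln (n%:R : R) by near: n; exact: near_ln_ge.
have n0 : (0 < n)%N := leq_trans k_gt0 kn.
have [suml suml'] := sum_lnd kn L1.
set L := ln n%:R in L1 suml suml' *.
have L0 : 0 < L by exact: lt_le_trans L1.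
have suminv : \sum_(k <= i < n) (i%:R^-1 : R) <= 2 * L.
  apply: (@le_trans _ _ (1 + L)); last by move: L1; lra.
  apply: le_trans (sum_inv_le R n0); rewrite [leRHS](@big_cat_nat _ _ _ k)//= lerDr.
  by apply: sumr_ge0 => i _; rewrite invr_ge0.
pose S w := \sum_(k <= i < n) mdiff P X (lowers B k) i w.
pose D w := \sum_(k <= i < n) (h i w - p i w).
pose er i : T -> R := if (0 < i)%N then err i else fun=> 0.
have ber i : bmf (er i) by rewrite /er; case: ifP => [/herr[]//|_]; exact: bmf_cst.
have er0 i w : 0 <= er i w by rewrite /er; case: ifP => [/herr[]//|_].
have Eer i : Ex P (er i) <= C * i%:R^-1.
  by rewrite /er; case: ifP => [/herr[]//|_]; rewrite Ex_cst mulr_ge0// ?ltW// invr_ge0.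
pose F w := \sum_(k <= i < n) er i w.
have bp i : bmf (p i) by apply: bmf_condP; exact: lowers_meas.
have bh i : bmf (h i) by apply: bmf_condP; exact: hits_meas.
have bI i : bmf (I i) by exact: (bmf_event _ lowers_meas).
have bm i : bmf (mdiff P X (lowers B k) i) by exact: bmfB.
have bS : bmf S by exact: bmf_sum.
have bD : bmf D by apply: bmf_sum => i; exact: bmfB.
have bF : bmf F by exact: bmf_sum.
have bSS : bmf (fun w => S w * S w) by exact: bmfM.
have bSL : bmf (fun w => L^-1 * (S w * S w)) by exact: bmfZ.
have hp i w : p i w <= h i w by exact: lowers_le_hits.
have D0 w : 0 <= D w by apply: sumr_ge0 => i _; rewrite subr_ge0.
have F0 w : 0 <= F w by apply: sumr_ge0.
exists (fun w => (L^-1 * (S w * S w) + D w + F w) + (k%:R + 6) * L); split.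
- by apply: bmfD; [do 2 apply: bmfD => //|exact: bmf_cst].
- move=> w; have SS0 : 0 <= S w * S w by rewrite -expr2 sqr_ge0.
  apply: addr_ge0; last by rewrite mulr_ge0 ?(ltW L0)// addr_ge0.
  by do 2 apply: addr_ge0 => //; rewrite mulr_ge0// invr_ge0 ltW.
- rewrite ExD ?Ex_cst; [|by do 2 apply: bmfD => //|exact: bmf_cst].
  rewrite ExD//; last exact: bmfD.
  rewrite ExD// ExZ// !(mulrDl _ _ L); apply: lerD => //.
  have EF : Ex P F <= 2 * C * L.
    rewrite Ex_sum//; apply: (@le_trans _ _ (\sum_(k <= i < n) C * i%:R^-1)).
      exact: ler_sum.
    by rewrite -mulr_sumr (mulrC 2 C) -mulrA ler_wpM2l// ltW.
  have ED : Ex P D <= 2 * k%:R * L.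
    rewrite Ex_sum => [|i]; last exact: bmfB.
    apply: (@le_trans _ _ (\sum_(k <= i < n) k%:R * i%:R^-1)).
      rewrite big_nat_cond [leRHS]big_nat_cond; apply: ler_sum => i /andP[/andP[ki _] _].
      rewrite ExB//; apply: le_trans (Ex_hits_lowers X_iid B_compact B_neq0 thr_pos ki) _.
      by rewrite ler_wpM2l// lef_pV2 ?posrE ?ltr0n ?(leq_trans k_gt0 ki)// ler_nat.
    by rewrite -mulr_sumr (mulrC 2 k%:R) -mulrA ler_wpM2l.
  have ES : L^-1 * Ex P (fun w => S w * S w) <= (5 + 2 * C) * L.
    rewrite mulrC ler_pdivrMr// -mulrA.
    apply: le_trans (Ex_martingale X_iid lowers_meas k n) _.
    apply: (@le_trans _ _ (\sum_(k <= i < n) (2 * lnd i + C * i%:R^-1))).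
      rewrite big_nat_cond [leRHS]big_nat_cond; apply: ler_sum => i /andP[/andP[ki _] _].
      have i0 : (0 < i)%N := leq_trans k_gt0 ki.
      have [_ _ _ he] := herr i i0.
      apply: (@le_trans _ _ (Ex P (fun w => 2 * lnd i + er i w))).
        apply: Ex_le => //; first by apply: bmfD => //; exact: bmf_cst.
        move=> w; apply: le_trans (hp i w) _; have := he w; rewrite /er i0 ler_norml => /andP[_].
        have : e * lnd i <= lnd i by rewrite ler_piMl// ltW.
        by move: (h i w) (lnd i) (err i w) => a b c; lra.
      by rewrite ExD// ?Ex_cst ?lerD//; exact: bmf_cst.
    rewrite big_split/= -!mulr_sumr.
    have CS : C * \sum_(k <= i < n) (i%:R^-1 : R) <= 2 * (C * L) by rewrite [leRHS]mulrCA ler_wpM2l// ltW.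
    have LL : L <= L * L by rewrite ler_peMl// ltW.
    have CL : C * L <= C * (L * L) by rewrite ler_wpM2l// ltW.
    move: suml CS LL CL; rewrite expr2 (mulrDl 5 (2 * C)) -(mulrA 2 C); move: (L * L) (\sum_(k <= i < n) (ln i%:R / i%:R)) (C * \sum_(k <= i < n) i%:R^-1) => q a b.
    by move: (C * L) (C * q) => u v; lra.
  move: EF ED ES; move: (Ex P F) (Ex P D) (L^-1 * _) => a b c.
  by rewrite !(mulrDl _ _ L); lra.
- move=> w.
  have -> : record_sum n w - 2^-1 * L ^+ 2 = 1 + S w - D w +
      \sum_(k <= i < n) (h i w - lnd i) + (\sum_(k <= i < n) lnd i - 2^-1 * L ^+ 2).
    rewrite /record_sum /S /D /mdiff !sumrB; ring.
  (* This turns the second moment [O(L ^+ 2)] into a bound of mean [O(L)]. *)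
  have hS : `|S w| <= L^-1 * (S w * S w) + L.
    have -> : L^-1 * (S w * S w) + L = (`|S w| ^+ 2 + L ^+ 2) / L.
      by rewrite -normrX ger0_norm ?sqr_ge0//; field; rewrite gt_eqF.
    rewrite ler_pdivlMr//; have := sqr_ge0 (`|S w| - L); have := normr_ge0 (S w).
    have := sqr_ge0 (`|S w|); have := sqr_ge0 L.
    by move: (`|S w|) => a; rewrite sqrrB; lra.
  have hH : `|\sum_(k <= i < n) (h i w - lnd i)| <= e * \sum_(k <= i < n) lnd i + F w.
    apply: le_trans (ler_norm_sum _ _ _) _; rewrite mulr_sumr -big_split/=.
    rewrite big_nat_cond [leRHS]big_nat_cond; apply: ler_sum => i /andP[/andP[ki _] _].
    have i0 : (0 < i)%N := leq_trans k_gt0 ki.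
    by have [_ _ _] := herr i i0; rewrite /er i0; exact.
  have eL : e * \sum_(k <= i < n) lnd i <= e * L ^+ 2 + 2 * L.
    apply: (@le_trans _ _ (e * (2^-1 * L ^+ 2 + 2 * L))); first by rewrite ler_wpM2l// ltW.
    have eq0 : 0 <= e * L ^+ 2 by rewrite mulr_ge0 ?sqr_ge0 ?(ltW e0).
    have : e * L <= L by rewrite ler_piMl ?(ltW L0) ?(ltW e1).
    rewrite mulrDr mulrCA [e * (2 * L)]mulrCA.
    by move: (e * L) (e * L ^+ 2) eq0 => a b; lra.
  have tri (x y z u v : R) : `|x + y - z + u + v| <= `|x| + `|y| + `|z| + `|u| + `|v|.
    by do 4 (rewrite (le_trans (ler_normD _ _)) ?normrN// lerD2r ?lerD//).
  apply: le_trans (tri _ _ _ _ _) _; rewrite normr1 (ger0_norm (D0 w)).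
  move: hS hH eL suml'; rewrite !(mulrDl _ _ L).
  move: (`|S w|) (D w) (F w) (e * L ^+ 2) (L^-1 * _) (`|\sum_(_ <= _ < _) _|) (`|_ - _|) => a b c x y z u.
  by move: (e * _) (k%:R * L) => f g; lra.
Unshelve. all: by end_near. Qed.

End record_estimate.

(** * Almost sure convergence *)

Section almost_sure.
Context (dT : measure_display) (T : measurableType dT) (R : realType)
  (P : probability T R).

Lemma sum_inv_sqr_le n : \sum_(0 <= j < n) (j.+1%:R ^+ 2)^-1 <= 2 :> R.
Proof.
case: n => [|n]; first by rewrite big_geq.
suff : \sum_(0 <= j < n.+1) (j.+1%:R ^+ 2)^-1 <= 2 - n.+1%:R^-1 :> R.
  by move=> h; apply: le_trans h _; rewrite gerBl invr_ge0.
elim: n => [|n IH]; first by rewrite big_nat1 expr1n invr1; lra.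
rewrite big_nat_recr//=; apply: le_trans (lerD IH (lexx _)) _.
have a0 : n.+1%:R != 0 :> R by rewrite pnatr_eq0.
have b0 : n.+2%:R != 0 :> R by rewrite pnatr_eq0.
have h : n.+2%:R = n.+1%:R + 1 :> R by rewrite -[in LHS]natr1.
rewrite -subr_ge0.
have -> : 2 - n.+2%:R^-1 - (2 - n.+1%:R^-1 + (n.+2%:R ^+ 2)^-1) =
   (n.+2%:R ^+ 2 * n.+1%:R)^-1 :> R.
  by move: a0 b0; rewrite h; move: (n.+1%:R : R) => a a0 b0; field; rewrite a0.
by rewrite invr_ge0 mulr_ge0// sqr_ge0.
Qed.

(** The Borel-Cantelli lemma for a bound that holds only from [J] on, hence the shifted sequence
    [G]. *)
Lemma ae_eventually_notin (F : nat -> set T) (C : R) J : (forall j, measurable (F j)) ->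
  (forall j, (J <= j)%N -> fine (P (F j)) <= C / j.+1%:R ^+ 2) ->
  {ae P, forall w, \forall j \near \oo, ~ F j w}.
Proof.
move=> mF hF; pose G j := F (j + J)%N.
have mG j : measurable (G j) by exact: mF.
have C0 : 0 <= C.
  have := hF J (leqnn J); rewrite ler_pdivlMr ?exprn_gt0 ?ltr0n//.
  by apply: le_trans; rewrite mulr_ge0 ?sqr_ge0// prob_ge0.
have G0 : P (lim_sup_set G) = 0%E.
  apply: lim_sup_set_cvg0 => //; apply: (@le_lt_trans _ _ (C * 2)%:E); last exact: ltry.
  apply: lime_le; first exact: is_cvg_nneseries.
  apply: nearW => n; apply: (@le_trans _ _ (\sum_(0 <= j < n) (C / j.+1%:R ^+ 2)%:E)%E).
    apply: lee_sum => j _; rewrite -[leLHS]fineK ?fin_num_measure// lee_fin.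
    apply: le_trans (hF _ (leq_addl _ _)) _; rewrite ler_wpM2l//.
    rewrite lef_pV2 ?posrE ?exprn_gt0 ?ltr0n// lerXn2r ?nnegrE//.
    by rewrite ler_nat ltnS leq_addr.
  by rewrite sumEFin lee_fin -mulr_sumr ler_wpM2l// sum_inv_sqr_le.
exists (lim_sup_set G); split => //.
  by apply: bigcap_measurable => // n _; exact: bigcup_measurable.
move=> w /= nw n _; apply: contrapT => h; apply: nw.
exists (n + J)%N => // j /= nj Fj; apply: h.
have Jj : (J <= j)%N by apply: leq_trans nj; exact: leq_addl.
by exists (j - J)%N; rewrite /= ?leq_subRL 1?addnC // /G subnK.
Qed.

End almost_sure.

(** * Interpolation between the times [2 ^ (j ^ 2)] *)

Section interpolation.
Variable R : realType.
Implicit Types (N : nat -> R) (e : R).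
Local Notation L n := (ln (n%:R : R)).

Lemma asymp_half_sqr N :
  (forall e, 0 < e -> \forall n \near \oo, `|N n - 2^-1 * L n ^+ 2| <= e * L n ^+ 2) ->
  asymp N (fun n => 2^-1 * L n ^+ 2).
Proof.
move=> h; apply/cvgrPdist_le => e e0.
have e2 : 0 < e / 2 by rewrite divr_gt0.
near=> n.
have L1 : 1 <= L n by near: n; exact: near_ln_ge.
have : `|N n - 2^-1 * L n ^+ 2| <= e / 2 * L n ^+ 2 by near: n; exact: h.
have L0 : 0 < L n ^+ 2 by rewrite exprn_gt0// (lt_le_trans _ L1).
move: (L n ^+ 2) (N n) L0 => q x q0 hq.
have -> : 1 - x / (2^-1 * q) = - ((x - 2^-1 * q) / (2^-1 * q)).
  by field; rewrite gt_eqF.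
rewrite normrN normrM normfV [`|_ * q|]ger0_norm ?mulr_ge0 ?(ltW q0)//.
rewrite ler_pdivrMr ?mulr_gt0//; apply: le_trans hq _.
by rewrite le_eqVlt; apply/orP; left; apply/eqP; field.
Unshelve. all: by end_near. Qed.

Local Notation m j := (2 ^ (j ^ 2))%N.

(* Along [2 ^ (j ^ 2)] the probability bound [O(1 / ln n)] is summable, while
   the ratio of consecutive values of [ln n] tends to 1. *)
Lemma ln_gauge j : L (m j) = j%:R ^+ 2 * ln 2.
Proof. by rewrite natrX lnXn// -(mulr_natl (ln 2)) natrX. Qed.

(** From [m j] to [m j.+1] the squared logarithm grows at most by the factor [1 + e] once [j] is
    large. Passing from [e] to [3 * e] pays for this factor on both sides. *)
Lemma interpolate N e : {homo N : a b / (a <= b)%N >-> a <= b} -> 0 < e -> e <= 4^-1 ->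
  (\forall j \near \oo, `|N (m j) - 2^-1 * L (m j) ^+ 2| <= e * L (m j) ^+ 2) ->
  \forall n \near \oo, `|N n - 2^-1 * L n ^+ 2| <= 3 * e * L n ^+ 2.
Proof.
move=> Nle e0 e1 [J _ hJ].
(* [15 = 4 + 6 + 4 + 1]: for [x >= 1], the fourth power of [x + 1] exceeds that of [x] by at most
   [15 * x ^+ 3], which is at most [e * x ^+ 4] once [15 / e <= x]. *)
pose K := (maxn J (Num.truncn (15 / e)).+1)%N.
near=> n; have nK : (m K <= n)%N by near: n; exact: nbhs_infty_ge.
have [j jn jmax] : exists2 j, (m j <= n)%N & (n < m j.+1)%N.
  have exj : exists j, (m j <= n)%N by exists K.
  have jb j : (m j <= n)%N -> (j <= n)%N.
    apply: leq_trans; apply: (leq_trans (ltnW (ltn_expl j (ltnSn 1)))).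
    by rewrite leq_exp2l//; case: j => // j; rewrite -mulnn leq_pmulr.
  case: (ex_maxnP exj jb) => j jn jm; exists j => //.
  by rewrite ltnNge; apply/negP => /jm; rewrite ltnn.
have Kj : (K <= j)%N.
  rewrite -ltnS -(@ltn_exp2r _ _ 2)// -(@ltn_exp2l 2)//.
  exact: leq_ltn_trans jmax.
have Jj : (J <= j)%N by apply: leq_trans Kj; exact: leq_maxl.
have ej : 15 / e <= j%:R.
  apply: (@le_trans _ _ K%:R); last by rewrite ler_nat.
  apply: (@le_trans _ _ (Num.truncn (15 / e)).+1%:R); last by rewrite ler_nat leq_maxr.
  by rewrite ltW// truncnS_gt.
have j0 : 0 < j%:R :> R by apply: lt_le_trans ej; rewrite divr_gt0.
have ln20 : 0 < ln 2 :> R by rewrite ln_gt0// ltr1n.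
have mj0 i : 0 < (m i)%:R :> R by rewrite ltr0n expn_gt0.
have ab : L (m j) <= L n by rewrite ler_ln ?posrE// ?ler_nat// (lt_le_trans (mj0 j))// ler_nat.
have bc : L n <= L (m j.+1).
  by rewrite ler_ln ?posrE// ?ler_nat ?(ltnW jmax)// (lt_le_trans (mj0 j))// ler_nat.
have a0 : 0 < L (m j) by rewrite ln_gauge mulr_gt0// exprn_gt0.
have hj := hJ j Jj; have hj1 := hJ j.+1 (leqW Jj).
have ca : L (m j.+1) ^+ 2 <= (1 + e) * L (m j) ^+ 2.
  rewrite !ln_gauge !(exprMn 2 (_ ^+ 2)) [leRHS]mulrA ler_wpM2r ?sqr_ge0// -!exprM.
  have je : 15 <= e * j%:R by rewrite mulrC -ler_pdivrMr.
  have j1 : 1 <= j%:R :> R by rewrite ler1n -(ltr0n R).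
  rewrite -natr1; move: (j%:R : R) je j1 => x je x1.
  have -> : (x + 1) ^+ (2 * 2) = x ^+ 4 + (4 * x ^+ 3 + 6 * x ^+ 2 + 4 * x + 1) by ring.
  have -> : (1 + e) * x ^+ (2 * 2) = x ^+ 4 + e * x * x ^+ 3 by ring.
  rewrite lerD2l.
  apply: (@le_trans _ _ (15 * x ^+ 3)).
    have x2 : x <= x ^+ 2 by rewrite expr2 ler_peMl// (le_trans _ x1).
    have x3 : x ^+ 2 <= x ^+ 3 by rewrite [leRHS]exprS ler_peMl// sqr_ge0.
    by move: (x ^+ 2) (x ^+ 3) x2 x3 => u v; lra.
  by rewrite ler_wpM2r// exprn_ge0// (le_trans _ x1).
have ab2 : L (m j) ^+ 2 <= L n ^+ 2.
  by rewrite lerXn2r ?nnegrE// ltW// (lt_le_trans a0).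
have bc2 : L n ^+ 2 <= L (m j.+1) ^+ 2.
  have b0 := lt_le_trans a0 ab.
  by rewrite lerXn2r ?nnegrE// ltW// (lt_le_trans b0).
have N1 := Nle _ _ jn; have N2 := Nle _ _ (ltnW jmax).
move: ca ab2 bc2 hj hj1 N1 N2 (exprn_gt0 2 a0).
move: (N _) (N n) (N _) (L (m j) ^+ 2) (L n ^+ 2) (L (m j.+1) ^+ 2) => x y z a b c.
rewrite !ler_norml => ca ab' bc' /andP[h1 h2] /andP[h3 h4] xy yz pa.
have b0 : 0 < b by exact: lt_le_trans ab'.
have ea : 0 <= e * e * a by rewrite !mulr_ge0 ?(ltW e0) ?(ltW pa).
have eb : 0 < e * b by rewrite mulr_gt0.
have eeb : e * e * b <= 4^-1 * (e * b) by rewrite -mulrA ler_wpM2r// ltW.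
have u1 : (2^-1 - 2 * e) * b <= (2^-1 - 2 * e) * ((1 + e) * a).
  by apply: ler_wpM2l; [lra|exact: le_trans bc' ca].
have u2 : (2^-1 + e) * c <= (2^-1 + e) * ((1 + e) * b).
  apply: ler_wpM2l; first by move: e0; lra.
  by apply: le_trans ca _; rewrite ler_wpM2l// addr_ge0// ltW.
by apply/andP; split; lra.
Unshelve. all: by end_near. Qed.
End interpolation.

Section strong_law.
Context (dT : measure_display) (T : measurableType dT) (R : realType)
  (P : probability T R) (N : nat -> T -> R).
Hypotheses (bN : forall n, bmf (N n))
  (Nle : forall w, {homo N^~ w : a b / (a <= b)%N >-> a <= b}).
Local Notation L n := (ln (n%:R : R)).
Hypothesis N_error : forall e : R, 0 < e -> e < 1 -> exists2 C : R, 0 < C & \forall n \near \oo,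
  exists Y : T -> R, [/\ bmf Y, (forall w, 0 <= Y w), Ex P Y <= C * L n &
    forall w, `|N n w - 2^-1 * L n ^+ 2| <= e * L n ^+ 2 + Y w].

Let bmf_dist n : bmf (fun w => `|N n w - 2^-1 * L n ^+ 2|).
Proof.
have [mf [M hM]] : bmf (fun w => N n w - 2^-1 * L n ^+ 2) by apply: bmfB => //; exact: bmf_cst.
split; last by exists M => w; rewrite normr_id.
exact: (measurableT_comp (@normr_measurable R setT) mf).
Qed.

Lemma Ex_asymp : asymp (fun n => Ex P (N n)) (fun n => 2^-1 * L n ^+ 2).
Proof.
apply: asymp_half_sqr => e e0; pose t := Num.min (e / 2) 2^-1.
have t0 : 0 < t by rewrite lt_min divr_gt0//= invr_gt0.
have te : t <= e / 2 by rewrite ge_min lexx.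
have t1 : t < 1 by rewrite gt_min orbC invf_lt1// ltr1n.
have [C C0 hC] := N_error t0 t1.
near=> n.
have L1 : 1 <= L n by near: n; exact: near_ln_ge.
have LC : 2 * C / e <= L n by near: n; exact: near_ln_ge.
have [Y [bY Y0 EY hY]] : exists Y : T -> R, [/\ bmf Y, (forall w, 0 <= Y w), Ex P Y <= C * L n &
    forall w, `|N n w - 2^-1 * L n ^+ 2| <= t * L n ^+ 2 + Y w] by near: n; exact: hC.
have L0 : 0 < L n by exact: lt_le_trans L1.
apply: (@le_trans _ _ (t * L n ^+ 2 + C * L n)).
  apply: (@le_trans _ _ (t * L n ^+ 2 + Ex P Y)); last by rewrite lerD2l.
  have c1 := bmf_cst T (2^-1 * L n ^+ 2); have c2 := bmf_cst T (t * L n ^+ 2).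
  have -> : Ex P (N n) - 2^-1 * L n ^+ 2 = Ex P (fun w => N n w - 2^-1 * L n ^+ 2).
    by rewrite ExB// Ex_cst.
  have -> : t * L n ^+ 2 + Ex P Y = Ex P (fun w => t * L n ^+ 2 + Y w).
    by rewrite ExD// Ex_cst.
  have bd := bmfB (bN n) c1; have bs := bmfD c2 bY.
  rewrite ler_norml; apply/andP; split; last first.
    by apply: Ex_le => // w; apply: le_trans (ler_norm _) (hY w).
  rewrite lerNl -[leLHS]mulN1r -ExZ//; apply: Ex_le => //; first exact: bmfZ.
  by move=> w; rewrite mulN1r; apply: le_trans (hY w); rewrite -normrN ler_norm.
have h : C * L n <= e / 2 * L n ^+ 2.
  rewrite expr2 mulrA ler_wpM2r ?(ltW L0)// mulrAC ler_pdivlMr// mulrC.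
  by move: LC; rewrite ler_pdivrMr// (mulrC _ e).
have h' : t * L n ^+ 2 <= e / 2 * L n ^+ 2 by rewrite ler_wpM2r ?sqr_ge0.
apply: le_trans (lerD h' h) _; rewrite -mulrDl.
by have -> : e / 2 + e / 2 = e by field.
Unshelve. all: by end_near. Qed.

Local Notation m j := (2 ^ (j ^ 2))%N.

(** Markov's inequality at level [e * L (m j) ^+ 2] gives the bound [C / (e * L (m j))], which is
    summable as [L (m j) = j ^+ 2 * ln 2]. The factor [4] in the proof replaces [j] by [j.+1]. *)
Lemma ae_gauge (e : R) : 0 < e -> e < 1 ->
  {ae P, forall w, \forall j \near \oo, `|N (m j) w - 2^-1 * L (m j) ^+ 2| <= 2 * e * L (m j) ^+ 2}.
Proof.
move=> e0 e1; have [C C0 [n0 _ hC]] := N_error e0 e1.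
pose F j := [set w | 2 * e * L (m j) ^+ 2 <= `|N (m j) w - 2^-1 * L (m j) ^+ 2|].
have mF j : measurable (F j) by apply: measurable_ge_set; exact: (proj1 (bmf_dist _)).
have ln20 : 0 < ln 2 :> R by rewrite ln_gt0// ltr1n.
have hF j : (n0.+1 <= j)%N -> fine (P (F j)) <= (4 * C / (e * ln 2)) / j.+1%:R ^+ 2.
  move=> jn; have j0 : (0 < j)%N by exact: leq_ltn_trans jn.
  have nj : (n0 <= m j)%N.
    apply: ltnW; apply: (leq_trans jn); apply: (leq_trans (ltnW (ltn_expl j (ltnSn 1)))).
    by rewrite leq_exp2l// -[leqLHS]expn1 leq_pexp2l.
  have [Y [bY Y0 EY hY]] := hC _ nj.
  have a0 : 0 < L (m j) by rewrite ln_gauge mulr_gt0// exprn_gt0// ltr0n.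
  have FY : fine (P (F j)) <= fine (P [set w | e * L (m j) ^+ 2 <= Y w]).
    apply: prob_le => //; first exact: measurable_ge_set (proj1 bY).
    move=> w /= h; have := le_trans h (hY w).
    by rewrite -mulrA; move: (e * _) (Y w) => a b; lra.
  apply: le_trans FY _.
  have := le_trans (Ex_markov P (e * L (m j) ^+ 2) bY Y0) EY.
  have : 0 <= fine (P [set w | e * L (m j) ^+ 2 <= Y w]) by exact: prob_ge0.
  move: (fine _) => q q0; rewrite expr2 mulrA (mulrAC _ (L _)) ler_pM2r// => hq.
  have j1 : (j.+1%:R : R) ^+ 2 <= 4 * j%:R ^+ 2.
    have : 1 <= j%:R :> R by rewrite ler1n.
    rewrite -natr1; move: (j%:R : R) => x x1.
    have -> : 4 * x ^+ 2 = (x + x) ^+ 2 by ring.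
    by rewrite lerXn2r ?nnegrE ?lerD2l// addr_ge0// (le_trans _ x1).
  rewrite ler_pdivlMr ?exprn_gt0 ?ltr0n//.
  apply: (@le_trans _ _ (q * (4 * j%:R ^+ 2))); first by rewrite ler_wpM2l.
  rewrite ler_pdivlMr ?mulr_gt0//.
  have -> : q * (4 * j%:R ^+ 2) * (e * ln 2) = 4 * (e * L (m j) * q).
    by rewrite ln_gauge; ring.
  by rewrite ler_pM2l.
apply: filterS (ae_eventually_notin mF hF) => w /=; apply: filterS => j.
by move=> /negP; rewrite -ltNge => /ltW.
Qed.

Lemma ae_asymp : {ae P, forall w, asymp (N^~ w) (fun n => 2^-1 * L n ^+ 2)}.
Proof.
(* Countably many levels [1 / (i + 8)] suffice; the [8] gives [2 / (i + 8) <= 1 / 4], as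
   [interpolate] requires. *)
have c8 i : 8 <= i%:R + 8 :> R by rewrite lerDr.
have c0 i : 0 < i%:R + 8 :> R by apply: lt_le_trans (c8 i).
have e0 i : 0 < (i%:R + 8)^-1 :> R by rewrite invr_gt0.
have e1 i : (i%:R + 8)^-1 < 1 :> R.
  by rewrite invf_lt1//; apply: lt_le_trans (c8 i); rewrite ltr1n.
have /ae_foralln := fun i => ae_gauge (e0 i) (e1 i).
apply: filterS => w hw; apply: asymp_half_sqr => e ep.
pose i := Num.truncn (6 / e).
have ei : 3 * (2 * (i%:R + 8)^-1) <= e.
  rewrite mulrA -natrM ler_pdivrMr// mulrC -ler_pdivrMr//.
  by apply: (le_trans (ltW (truncnS_gt _))); rewrite -natr1 lerD2l ler1n.
have h := interpolate (Nle w) _ _ (hw i).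
apply: filterS (h _ _) => [n /le_trans| |]; last 2 first.
- by rewrite mulr_gt0.
- rewrite ler_pdivrMr//; apply: le_trans (_ : 4^-1 * 8 <= _); last by rewrite ler_wpM2l.
  lra.
by apply; rewrite ler_wpM2r// sqr_ge0.
Qed.

End strong_law.

(** * Record times *)

Section record_times.
Context (T : Type) (R : realType) (d : nat) (X : nat -> T -> 'rV[R]_d)
  (B : set 'rV[R]_d) (k : nat) (w : T).
Hypothesis k_gt0 : (0 < k)%N.
Local Notation N n := (nrecords X B k n w).
Local Notation L n := (ln (n%:R : R)).

Lemma nrecordsS n : (k <= n)%N -> N n.+1 = (N n + is_record X B k n.+1 w)%N.
Proof. by move=> kn; rewrite /nrecords big_nat_recr//= addnA. Qed.

Lemma nrecords_le : {homo (fun n => N n) : a b / (a <= b)%N >-> (a <= b)%N}.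
Proof.
apply: homo_leq => [//|? ? ?|n]; first exact: leq_trans.
have [kn|kn] := leqP k n; first by rewrite nrecordsS// leq_addr.
by rewrite /nrecords !big_geq// ltnS ltnW.
Qed.

(** Crude, but enough to send the record times to infinity and to bound the count under the
    expectation. *)
Lemma nrecords_leq n : (N n <= n.+1)%N.
Proof.
elim: n => [|n IH]; first by rewrite /nrecords big_geq.
have [kn|kn] := leqP k n; last by rewrite /nrecords big_geq// ltnS.
by rewrite nrecordsS// -(addn1 n.+1) leq_add// leq_b1.
Qed.

Hypothesis N_unbounded : forall m, exists n, (m < N n)%N.

(** A later record exists because the count is unbounded; as the next record time is the least such
    index, the count rises by exactly one. The index [m.+1] avoids the irrelevant value at [0]. *)
Lemma record_timeE m : exists n, [/\ record_time X B k m.+1 w = n%:R%:E, (k <= n)%N & N n = m.+1].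
Proof.
elim: m => [|m [n [nE kn Nn]]]; first by exists k; split => //; rewrite /nrecords big_geq.
have exn : exists i, (n < i)%N && is_record X B k i w.
  have [p pN] := N_unbounded m.+1; rewrite -Nn in pN.
  apply: contrapT => h.
  suff : N p = N n by move=> pn; rewrite pn ltnn in pN.
  have np : (n <= p)%N by rewrite leqNgt; apply/negP => /ltnW/nrecords_le; rewrite leqNgt pN.
  rewrite /nrecords (@big_cat_nat _ _ _ n.+1)//= [X in (_ + (_ + X))%N]big1_seq ?addn0//.
  move=> i /andP[_]; rewrite mem_index_iota => /andP[ni _].
  by case: (boolP (is_record _ _ _ _ _)) => // ri; case: h; exists i; rewrite ni.
case: (ex_minnP exn) => i /andP[ni ri] imin; exists i; split; last first.
- have i0 : i.-1.+1 = i by rewrite prednK// (leq_ltn_trans _ ni).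
  have ni1 : (n <= i.-1)%N by rewrite -ltnS i0.
  rewrite -i0 nrecordsS ?(leq_trans kn)// i0 ri addn1; congr S; rewrite -Nn.
  rewrite /nrecords (@big_cat_nat _ _ _ n.+1)//= [X in (_ + (_ + X))%N]big1_seq ?addn0//.
  move=> j /andP[_]; rewrite mem_index_iota i0 => /andP[nj ji].
  case: (boolP (is_record _ _ _ _ _)) => // rj.
  by have := imin j; rewrite nj rj leqNgt ji => /(_ isT).
- exact: leq_trans (ltnW ni).
- rewrite /= -/(record_time X B k m.+1 w).
  apply/eqP; rewrite eq_le; apply/andP; split.
    apply: ereal_inf_lbound; exists i => //; split => //=.
    by rewrite -/(record_time X B k m.+1 w) nE lte_fin ltr_nat.
  apply: le_ereal_inf_tmp => _ [j [jn rj] <-]; rewrite lee_fin ler_nat imin// rj andbT.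
  by move: jn; rewrite -/(record_time X B k m.+1 w) nE lte_fin ltr_nat.
Qed.
End record_times.

Section record_time_limit.
Context (T : Type) (R : realType) (d : nat) (X : nat -> T -> 'rV[R]_d)
  (B : set 'rV[R]_d) (k : nat) (w : T).
Hypothesis k_gt0 : (0 < k)%N.
Local Notation N n := (nrecords X B k n w).
Local Notation L n := (ln (n%:R : R)).
Hypothesis N_asymp : asymp (fun n => (N n)%:R) (fun n => 2^-1 * L n ^+ 2).

Lemma nrecords_unbounded m : exists n, (m < N n)%N.
Proof.
have := N_asymp => /cvgrPdist_lt /(_ 2^-1) h.
have {}h : \forall n \near \oo, `|1 - (N n)%:R / (2^-1 * L n ^+ 2)| < 2^-1.
  by apply: h; rewrite invr_gt0.
near \oo => n; exists n; rewrite -(ltr_nat R).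
have L1 : 1 <= L n by near: n; exact: near_ln_ge.
have L4 : 4 * m.+1%:R <= L n by near: n; exact: near_ln_ge.
have LL : 0 < 2^-1 * L n ^+ 2 by rewrite mulr_gt0// exprn_gt0// (lt_le_trans _ L1).
have : `|1 - (N n)%:R / (2^-1 * L n ^+ 2)| < 2^-1 by near: n.
rewrite ltr_norml => /andP[_]; rewrite ltrBlDr -ltrBlDl => h1.
have h2 : 2^-1 < (N n)%:R / (2^-1 * L n ^+ 2) by apply: le_lt_trans h1; lra.
move: h2; rewrite ltr_pdivlMr//; apply: lt_trans.
have : L n <= L n ^+ 2 by rewrite expr2 ler_peMl// (le_trans _ L1).
have m0 : 0 <= m%:R :> R by [].
by move: L4; rewrite -[m.+1%:R]natr1; move: (L n) (L n ^+ 2) (m%:R) m0 => a b c; lra.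
Unshelve. all: by end_near. Qed.

(** If [u m] is the [m]-th record time, then [m] is asymptotic to half the square of [ln (u m)]; so
    [ln (u m) / sqrt m] tends to [sqrt 2], and the exponential is continuous. *)
Lemma record_time_cvg :
  (record_time X B k n w `^ (Num.sqrt (n%:R : R))^-1)%E @[n --> \oo]
    --> (expR (Num.sqrt (2 : R)))%:E.
Proof.
have /choice[v hv] := record_timeE nrecords_unbounded.
pose u m := v m.-1.
have uE m : (0 < m)%N -> [/\ record_time X B k m w = (u m)%:R%:E, (k <= u m)%N & N (u m) = m].
  by case: m => // m _; exact: hv.
have ule m : (0 < m)%N -> (m <= (u m).+1)%N.
  by move=> /uE[_ _ {1}<-]; exact: nrecords_leq.
have uoo : u m @[m --> \oo] --> \oo.
  apply/cvgnyPge => A; near=> m.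
  have Am : (A < m)%N by near: m; exact: nbhs_infty_gt.
  by rewrite -ltnS (leq_trans Am)// ule// (leq_ltn_trans _ Am).
have c1 : m%:R / (2^-1 * L (u m) ^+ 2) @[m --> \oo] --> (1 : R).
  have := cvg_comp _ _ uoo N_asymp; apply: cvg_trans; apply: near_eq_cvg.
  near=> m => /=; have m0 : (0 < m)%N by near: m; exact: nbhs_infty_gt.
  by have [_ _ ->] := uE m m0.
have c2 : L (u m) / Num.sqrt (m%:R : R) @[m --> \oo] --> (Num.sqrt (2 : R)).
  have c3 : 2 * (m%:R / (2^-1 * L (u m) ^+ 2))^-1 @[m --> \oo] --> (2 * 1^-1 : R).
    by apply: cvgMl_tmp; apply: cvgV => //; exact: oner_neq0.
  rewrite invr1 mulr1 in c3.
  have := cvg_comp _ _ c3 (@sqrt_continuous R 2); apply: cvg_trans; apply: near_eq_cvg.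
  near=> m => /=; have m0 : (0 < m)%N by near: m; exact: nbhs_infty_gt.
  have mR : 0 < m%:R :> R by rewrite ltr0n.
  rewrite invfM invrK.
  have -> : 2 * (m%:R^-1 * (2^-1 * L (u m) ^+ 2)) = L (u m) ^+ 2 / m%:R.
    by field; rewrite gt_eqF.
  by rewrite sqrtrM ?sqr_ge0// sqrtr_sqr ger0_norm ?ln_nat_ge0// sqrtrV// ltW.
have c4 : (expR (L (u m) / Num.sqrt (m%:R : R)))%:E @[m --> \oo] --> (expR (Num.sqrt (2 : R)))%:E.
  by apply: cvg_EFin; [exact: nearW|exact: cvg_comp _ _ c2 (@continuous_expR R _)].
apply: cvg_trans c4; apply: near_eq_cvg.
near=> m; have m0 : (0 < m)%N by near: m; exact: nbhs_infty_gt.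
have [-> ku _] := uE m m0; rewrite poweR_EFin; congr (_%:E).
by rewrite /powR pnatr_eq0 eqn0Ngt (leq_trans k_gt0 ku) /= mulrC.
Unshelve. all: by end_near. Qed.

End record_time_limit.

(** * Distinct sample points *)

Section distinct.
Context (dT : measure_display) (T : measurableType dT) (R : realType) (d : nat)
  (P : probability T R) (X : nat -> {mfun T >-> 'rV[R]_d}).
Hypothesis X_iid : forall (J : seq nat) (D : nat -> set 'rV[R]_d),
  uniq J -> (forall j, measurable (D j)) ->
  P (\bigcap_(j in [set` J]) X j @^-1` D j) = (\prod_(j <- J) law P X (D j))%E.
Hypothesis law_point : forall x, law P X [set x] = 0%E.

Definition occurs (s : seq 'rV[R]_d) (y : 'rV[R]_d) : bool := y \in s.

Lemma measurable_occurs (dZ : measure_display) (Z : measurableType dZ) m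
  (f : Z -> seq 'rV[R]_d) (g : Z -> 'rV[R]_d) :
  (forall z, size (f z) = m) ->
  (forall i, (i < m)%N -> measurable_fun setT (fun z => nth 0 (f z) i)) ->
  measurable_fun setT g -> measurable [set z | occurs (f z) (g z)].
Proof.
move=> f_size f_meas g_meas.
rewrite (_ : [set z | _] = \bigcup_(i in `I_m) \bigcap_(j in [set: 'I_d])
    [set z | nth 0 (f z) i ord0 j == g z ord0 j]).
  apply: bigcup_measurable => i im; apply: fin_bigcap_measurable => // j _.
  rewrite -[X in measurable X]setTI; apply: measurable_fun_eqr => //.
    exact: (measurableT_comp (measurable_coord j) (f_meas i im)).
  exact: (measurableT_comp (measurable_coord j) g_meas).
apply/seteqP; split=> z /=.
  move=> /(nthP 0)[i]; rewrite f_size => im fg; exists i => // j _ /=.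
  by rewrite fg.
move=> [i im h]; rewrite /occurs (_ : g z = nth 0 (f z) i) ?mem_nth ?f_size//.
by apply/rowP => j; apply/esym/eqP; exact: h.
Qed.

Lemma law_seq (s : seq 'rV[R]_d) : law P X [set y | occurs s y] = 0%E.
Proof.
have mem0 r : measurable [set y | occurs r y].
  by apply: (@measurable_occurs _ _ (size r) (fun=> r) id) => // i _; exact: measurable_cst.
elim: s => [|x s IH].
  by rewrite (_ : [set y | _] = set0) ?measure0//; apply/seteqP; split.
rewrite (_ : [set y | _] = [set y | occurs [:: x] y] `|` [set y | occurs s y]); last first.
  apply/seteqP; split => y /=; rewrite /occurs; first by rewrite !inE => /orP[yx|]; [left|right].
  by rewrite !inE => -[->//|->]; rewrite orbT.
apply/eqP; rewrite eq_le measure_ge0 andbT.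
have h1 : law P X [set y | occurs [:: x] y] = 0%E.
  rewrite -[RHS](law_point x); congr (law P X _).
  by apply/seteqP; split => y /=; rewrite /occurs inE => /eqP.
apply: le_trans (measureU2 _ (mem0 [:: x]) (mem0 s)) _.
have -> : (0 = law P X [set y | occurs [:: x] y] + law P X [set y | occurs s y])%E.
  by rewrite h1 IH adde0.
exact: lexx.
Qed.

(** Needed because [npoints] counts a set while [thr] counts with multiplicity. Given the earlier
    points, a repetition has probability the mass of a finite set. *)
Lemma distinct_ae : {ae P, forall w, forall n, (X n w : 'rV[R]_d) \notin pts X n w}.
Proof.
apply/ae_foralln => n.
pose Q := occurs.
have Q_meas (dZ : measure_display) (Z : measurableType dZ) m
  (f : Z -> seq 'rV[R]_d) (g : Z -> 'rV[R]_d) :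
  (forall z, size (f z) = m) ->
  (forall i, (i < m)%N -> measurable_fun setT (fun z => nth 0 (f z) i)) ->
  measurable_fun setT g -> measurable [set z | Q (f z) (g z)] by exact: measurable_occurs.
have mE := measurable_event X Q_meas n.
exists [set w | Q (pts X n w) (X n w)]; split => //; last first.
  by move=> w /= /negP; rewrite negbK.
rewrite -[LHS]fineK ?fin_num_measure// -Ex_indic// -eventE (Ex_event X_iid Q_meas).
under eq_fun do rewrite /condP law_seq.
by rewrite Ex_cst.
Qed.

Lemma uniq_pts w : (forall n, (X n w : 'rV[R]_d) \notin pts X n w) -> forall n, uniq (pts X n w).
Proof. by move=> h; elim=> // n IH; rewrite ptsS rcons_uniq h. Qed.

Lemma nrecords_sum (B : set 'rV[R]_d) k w : (forall n, (X n w : 'rV[R]_d) \notin pts X n w) ->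
  forall n, (nrecords X B k n w)%:R = record_sum X B k n w.
Proof.
move=> h n; rewrite /nrecords /record_sum natrD natr_sum big_add1; congr (_ + _).
apply: eq_bigr => i _; rewrite /is_record /event /lowers -ptsS.
rewrite -[threshold _ _ _ i.+1 _]/(thr B k (undup (pts X i.+1 w))).
rewrite -[threshold _ _ _ _ _]/(thr B k (undup (pts X i w))).
by rewrite !undup_id ?uniq_pts.
Qed.

End distinct.

(* The integral of a nonnegative function is a supremum over simple functions,
   hence is monotone even for non-measurable functions. *)
Lemma ge0_le_integral_nomeas (dT : measure_display) (T : measurableType dT) (R : realType)
    (P : {measure set T -> \bar R}) (f g : T -> \bar R) :
  (forall x, 0 <= f x)%E -> (forall x, f x <= g x)%E ->
  (\int[P]_x f x <= \int[P]_x g x)%E.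
Proof.
move=> f0 fg; have g0 x : (0 <= g x)%E by exact: le_trans (fg x).
rewrite !ge0_integralTE//; apply: le_ereal_sup => _ [h hf <-].
by exists h => // x; exact: le_trans (fg x).
Qed.

(** [f] equals [g] off a null set [N] but is not known to be measurable; it is squeezed between [g]
    cut off on [N] and that function plus [M] on [N]. *)
Lemma ae_integral_bmf (dT : measure_display) (T : measurableType dT) (R : realType)
    (P : probability T R) (f g : T -> R) (M : R) : bmf g -> (forall x, 0 <= g x) ->
  (forall x, 0 <= f x <= M) -> {ae P, forall x, f x = g x} ->
  (\int[P]_x (f x)%:E = (Ex P g)%:E)%E.
Proof.
move=> bg g0 f0 [N [mN PN hN]].
have fg x : ~ N x -> f x = g x by move=> Nx; apply: contrapT => fgx; apply: Nx; exact: hN.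
have int_ae (u : T -> R) : bmf u -> (forall x, ~ N x -> u x = g x) ->
    (\int[P]_x (u x)%:E = (Ex P g)%:E)%E.
  move=> bu ug; rewrite -ExE//; apply: ae_eq_integral => //.
  - exact/measurable_EFinP/(proj1 bu).
  - exact/measurable_EFinP/(proj1 bg).
  - by exists N; split => // x /= h; apply: contrapT => Nx; apply: h => _; rewrite ug.
have M0 : 0 <= M by have /andP[a b] := f0 point; exact: le_trans a b.
have bN : bmf (\1_(~` N) : T -> R) by apply: bmf_indic; exact: measurableC.
have bN' : bmf (fun x => M * (\1_N x : R)) by apply/bmfZ/bmf_indic.
have i1 x : ~ N x -> \1_(~` N) x = 1 :> R by move=> Nx; rewrite indicE mem_set.
have i2 x : ~ N x -> \1_N x = 0 :> R by move=> Nx; rewrite indicE memNset.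
have i3 x : N x -> \1_(~` N) x = 0 :> R by move=> Nx; rewrite indicE memNset//= => /(_ Nx).
have i4 x : N x -> \1_N x = 1 :> R by move=> Nx; rewrite indicE mem_set.
apply/eqP; rewrite eq_le; apply/andP; split.
  rewrite -(int_ae (fun x => g x * \1_(~` N) x + M * \1_N x)).
  - apply: ge0_le_integral_nomeas => x; rewrite lee_fin; first by case/andP: (f0 x).
    have [Nx|Nx] := pselect (N x); last by rewrite i1// i2// mulr1 mulr0 addr0 fg.
    by rewrite i3// i4// mulr0 add0r mulr1; case/andP: (f0 x).
  - by apply: bmfD => //; exact: bmfM.
  - by move=> x Nx; rewrite i1// i2// mulr1 mulr0 addr0.
rewrite -(int_ae (fun x => g x * \1_(~` N) x)).
- apply: ge0_le_integral_nomeas => x; rewrite lee_fin; first by rewrite mulr_ge0// indicE.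
  have [Nx|Nx] := pselect (N x); last by rewrite i1// mulr1 fg.
  by rewrite i3// mulr0; case/andP: (f0 x).
- exact: bmfM.
- by move=> x Nx; rewrite i1// mulr1.
Qed.

Theorem theorem1 (R : realType) (d : nat) (A B : set 'rV[R]_d)
    (f : 'rV[R]_d -> R) (dT : measure_display) (T : measurableType dT)
    (P : probability T R) (X : nat -> T -> 'rV[R]_d) (k : nat)
    (d_gt0 : (0 < d)%N)
    (A_compact : compact A) (A_int : interior A !=set0)
    (A_reg : closure (interior A) = A)
    (B_compact : compact B) (B_sub_A : B `<=` A)
    (X_meas : forall i, measurable_fun [set: T] (X i))
    (X_indep : independent_seq P X)
    (X_density : forall i, has_density P (X i) f)
    (f_supp : closure [set x | f x != 0] = A)
    (f_cont : {within A, continuous f})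
    (f_inf : 0 < inf (f @` B))
    (B_reg : B = closure (interior B)) (B_neq0 : B !=set0)
    (B_sub_int : B `<=` interior A)
    (B_dim : (hausdorff_dim (frontier B) < d%:R%:E)%E)
    (k_gt0 : (0 < k)%N) :
  [/\ asymp (fun n => fine ('E_P[fun w => (nrecords X B k n w)%:R])%E)
            (fun n => 2^-1 * ln (n%:R : R) ^+ 2),
      {ae P, forall w, asymp (fun n => (nrecords X B k n w)%:R)
                             (fun n => 2^-1 * ln (n%:R : R) ^+ 2)} &
      {ae P, forall w,
        (record_time X B k n w `^ (Num.sqrt (n%:R : R))^-1)%E @[n --> \oo]
          --> (expR (Num.sqrt (2 : R)))%:E}].
Proof.
have [f_meas f_ge0 _] := X_density 0%N.
pose Y i : {mfun T >-> 'rV[R]_d} :=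
  HB.pack (X i) (isMeasurableFun.Build _ _ _ _ _ (X_meas i)).
pose mu : {measure set 'rV[R]_d -> \bar R} := law P Y.
have mu_f D : measurable D -> mu D = (\int[lebesgue_rV R d]_(x in D) (f x)%:E)%E.
  by move=> mD; have [_ _ <-] := X_density 0%N.
(* All points have the same density, hence the law of [Y 0]. *)
have Y_iid (J : seq nat) (D : nat -> set 'rV[R]_d) :
    uniq J -> (forall j, measurable (D j)) ->
    P (\bigcap_(j in [set` J]) Y j @^-1` D j) = (\prod_(j <- J) law P Y (D j))%E.
  move=> uJ mD; apply: etrans (X_indep J D uJ mD) _; apply: eq_bigr => j _.
  have [_ _ h] := X_density j; rewrite h//; exact/esym/mu_f.
have mass_fin D : measurable D -> mu D \is a fin_num by move=> mD; exact: fin_num_measure.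
have [Cf Cf0 f_le] := density_bounded A_compact f_supp f_cont.
have f_ge x : B x -> inf (f @` B) <= f x by exact: density_inf_le.
have mass_oball e : 0 < e -> e < inf (f @` B) -> exists2 r0, 0 < r0 &
    forall x r, B x -> 0 < r -> r <= r0 ->
    (f x - e) * (ball_vol R d * r ^+ d) <= fine (law P Y (oball x r))
      <= (f x + e) * (ball_vol R d * r ^+ d).
  move=> e0 ef; have [r0 r00 h] := density_oball B_compact f_meas f_ge0 mu_f f_cont B_sub_int e0 ef.
  exists r0 => // x r Bx rp rr0; have [h1 h2] := h x r Bx rp rr0.
  have mo := mass_fin _ (measurable_oball x r).
  by rewrite -!lee_fin fineK// h1 h2.
have inf_approx := density_inf_approx B_compact f_ge0 f_cont B_sub_int B_reg B_neq0.
have law_point x : law P Y [set x] = 0%E.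
  have -> : [set x] = box (fun j => x ord0 j) (fun j => x ord0 j).
    apply/seteqP; split => y /=; first by move=> -> j; rewrite lexx.
    by move=> h; apply/rowP => j; apply: le_anti; rewrite andbC h.
  apply/eqP; rewrite eq_le measure_ge0 andbT.
  apply: le_trans (density_le f_meas f_ge0 mu_f (measurable_box _ _) (ltW Cf0) (fun y _ => f_le y)) _.
  rewrite lebesgue_box => [|//]; case: (d) d_gt0 x => // m _ x.
  by rewrite big_ord_recl subrr mul0r mule0.
(* Some ball inside [B] has positive mass, while finite sets have mass [0]. *)
have B_inf (s : seq 'rV[R]_d) : exists2 x, B x & x \notin s.
  have [z [r [r0 rB _]]] := inf_approx 1 ltr01.
  have Bz : B z by apply: rB; exact: nbhs_singleton (oball_nbhs _ r0).
  have f20 : 0 < inf (f @` B) / 2 by rewrite divr_gt0.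
  have [|q q0 hq] := mass_oball _ f20; first by move: f_inf; lra.
  have p0 : 0 < Num.min r q by rewrite lt_min r0.
  have [|pos _] := andP (hq z _ Bz p0 _); first by rewrite ge_min lexx orbT.
  apply: contrapT => h.
  have sub : oball z (Num.min r q) `<=` [set y | occurs s y].
    move=> y zy; apply: contrapT => ys; apply: h; exists y; last exact/negP.
    by apply: rB; apply: lt_le_trans zy _; rewrite ge_min lexx.
  have : fine (law P Y (oball z (Num.min r q))) <= 0.
    have <- : fine (law P Y [set y | occurs s y]) = 0 by rewrite law_seq.
    apply: prob_le => //; first exact: measurable_oball.
    by apply: (@measurable_occurs _ _ _ _ (size s) (fun=> s) id) => // i _; exact: measurable_cst.
  rewrite leNgt => /negP; apply; apply: lt_le_trans pos.
  rewrite mulr_gt0// ?mulr_gt0 ?exprn_gt0 ?ball_vol_gt0//.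
  by rewrite subr_gt0 (lt_le_trans _ (f_ge z Bz))//; move: f_inf; lra.
have thr_pos s : (k <= size s)%N -> exists2 r, 0 < r & thr B k s = r%:E.
  by move=> ks; apply: thr_fin => //; rewrite k_gt0.
have bounded (D : set 'rV[R]_d) : compact D ->
    exists K : nat, forall x, D x -> forall j, `|x ord0 j| <= K.+1%:R.
  move=> cD; have cE : compact ((fun y => enorm (y - 0)) @` D).
    by apply: continuous_compact => //; apply: continuous_subspaceT; exact: enorm_continuous.
  have [M [_ hM]] := compact_bounded cE.
  exists (Num.truncn (M + 1)) => x Dx j; apply: le_trans (coord_le_enorm x j) _.
  apply: le_trans (ltW (truncnS_gt _)); rewrite -[x]subr0; apply: le_trans (ler_norm _) _.
  by apply: hM; [rewrite ltrDl|exists x].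
have upper := upper_holes Y_iid k d_gt0 f_inf f_ge f_le _ _ B_neq0 mass_oball.
have [KB hKB] := bounded B B_compact; have [KA hKA] := bounded A A_compact.
have {}upper := upper _ (ltr0Sn R KB) hKB.
(* [density_inf_approx] controls [f] at the centre only; shrinking the ball extends this to all its
   points at the cost of the other half of [e]. *)
have f_near e : 0 < e -> exists x s, [/\ 0 < s, oball x s `<=` B &
    forall y, oball x s y -> f y <= inf (f @` B) + e].
  move=> e0; have e20 : 0 < e / 2 by rewrite divr_gt0.
  have [x [r [r0 rB fx]]] := inf_approx _ e20.
  have [q q0 hq] := density_unif_cont B_compact f_cont B_sub_int e20.
  have Bx : B x by apply: rB; exact: nbhs_singleton (oball_nbhs _ r0).
  exists x, (Num.min r q); split; first by rewrite lt_min r0.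
    by move=> y xy; apply: rB; apply: lt_le_trans xy _; rewrite ge_min lexx.
  move=> y xy; have : enorm (y - x) < q by apply: lt_le_trans xy _; rewrite ge_min lexx orbT.
  by move=> /(hq x y Bx); rewrite ler_norml => /andP[_]; lra.
have lower := lower_holes Y_iid d_gt0 f_inf f_ge f_near mass_oball.
have mass_cube (a : 'I_d -> R) h : 0 < h ->
    fine (law P Y (box a (fun j => a j + h))) <= Cf * h ^+ d.
  move=> h0; rewrite -lee_fin fineK; last by apply: mass_fin; exact: measurable_box.
  apply: le_trans (density_le f_meas f_ge0 mu_f (measurable_box _ _) (ltW Cf0) (fun y _ => f_le y)) _.
  rewrite lebesgue_box => [|j]; last by rewrite lerDl ltW.
  rewrite -EFinM lee_fin; under eq_bigr do rewrite addrAC subrr add0r.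
  by rewrite prodr_const card_ord.
have mA : measurable (~` A).
  by apply: open_measurable_rV; rewrite -f_supp; apply: closed_openC; exact: closed_closure.
have mass_range : law P Y (~` box (fun=> - KA.+1%:R) (fun=> KA.+1%:R)) = 0%E.
  apply/eqP; rewrite eq_le measure_ge0 andbT -(density_setC f_meas f_ge0 mu_f f_supp).
  apply: le_measure; rewrite ?inE//; first by apply: measurableC; exact: measurable_box.
  by apply: subsetC => x /hKA h j; rewrite -ler_norml.
have unique n : (k <= n)%N -> P.-negligible [set w | exists x y r,
    [/\ 0 < r, thr B k (pts Y n w) = r%:E, x != y & B x /\ B y /\
    (cnt (pts Y n w) (oball x r) < k)%N /\ (cnt (pts Y n w) (oball y r) < k)%N]].
  move=> kn; apply: (negligible_two_witnesses Y_iid d_gt0 Cf0 mass_cube mass_range) => p.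
  by have [|r _ ->] := thr_pos (conf p); first by rewrite size_map size_enum_ord.
have hit := hit_error B_compact k_gt0 B_neq0 thr_pos upper lower unique.
have err := record_error Y_iid B_compact k_gt0 B_neq0 thr_pos hit.
have bN n : bmf (record_sum Y B k n) by exact: bmf_record_sum.
have Nle w : {homo (record_sum Y B k)^~ w : a b / (a <= b)%N >-> a <= b}.
  apply: homo_leq => [//|x y z|n]; first exact: le_trans.
  rewrite /record_sum lerD2l; have [kn|kn] := leqP k n; last by rewrite !big_geq// ltnW.
  by rewrite big_nat_recr//= lerDl /event.
have distinct := distinct_ae Y_iid law_point.
have ae_N : {ae P, forall w, asymp (fun n => (nrecords X B k n w)%:R)
                             (fun n => 2^-1 * ln (n%:R : R) ^+ 2)}.
  apply: filterS2 distinct (ae_asymp bN Nle err) => w dw.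
  by congr asymp; apply/funext => n; exact: esym (nrecords_sum B k dw n).
split => //; last first.
  by apply: filterS ae_N => w; exact: record_time_cvg.
have := Ex_asymp bN err; congr asymp; apply/funext => n.
rewrite unlock (@ae_integral_bmf _ _ _ _ _ (record_sum Y B k n) n.+1%:R)//.
- by move=> w; rewrite addr_ge0// sumr_ge0.
- by move=> w; rewrite ler0n ler_nat nrecords_leq.
- by apply: filterS distinct => w dw; exact: (nrecords_sum B k dw n).
Qed.
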